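(* Let $[C=C_1\cup C_2,\ \omega_C\otimes A]$ be a general Prym-canonical binary curve of genus $g\ge 12$. Then the first Gaussian map $$\mu_A:\Lambda^2H^0(C,\omega_C\otimes A)\to H^0(C,\omega_C^{\otimes 2}\otimes\Omega^1_C)$$ is surjective.
   Context: Work over $\mathbb C$. A (stable) binary curve of genus $g$ is a nodal curve $C=C_1\cup C_2$ that is the union of two smooth rational curves meeting transversally at $g+1$ distinct points. Prym-canonical binary curves. Put $k=\lfloor g/2\rfloor$ and choose parameters $a_{i,j}\in\mathbb C$, $1\le i\le g-1$, $j=1,2$, such that for each $j$ the $a_{i,j}$ are nonzero and pairwise distinct. Put $M_j(t,u)=\prod_{r=1}^{g-1}(t-a_{r,j}u)$, $A_j=\prod_{i=1}^{g-1}a_{i,j}$, let $d_2$ be a nonzero constant and $d_1=-d_2A_1/A_2$. Define $\phi_j:\mathbb P^1\to\mathbb P^{g-2}$, $j=1,2$, by letting the $i$-th homogeneous coordinate of $\phi_j(t,u)$ be $$\frac{t\,M_j(t,u)}{t-a_{i,j}u}\ \ (1\le i\le k),\qquad \frac{-M_j(t,u)\,d_j\,a_{i,j}\,u}{A_j\,(t-a_{i,j}u)}\ \ (k+1\le i\le g-1).$$ Then for both $j=1,2$: $\phi_j([a_{l,j},1])=P_l$, the $l$-th coordinate point of $\mathbb P^{g-2}$, for $1\le l\le g-1$; $\phi_j([0,1])=P_g=[0,\dots,0,1,\dots,1]$ (first $k$ coordinates $0$, the remaining ones $1$); $\phi_j([1,0])=P_{g+1}=[1,\dots,1,0,\dots,0]$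 (first $k$ coordinates $1$, the remaining ones $0$). For a general choice of the $a_{i,j}$, the curve $C=C_1\cup C_2$ with $C_j=\phi_j(\mathbb P^1)$ is a binary curve of genus $g$ with nodes $P_1,\dots,P_{g+1}$, embedded in $\mathbb P^{g-2}$ by the complete linear system $|\omega_C\otimes A|$, where $\omega_C$ is the dualizing sheaf and $A$ is a nontrivial line bundle with $A^{\otimes 2}\cong\mathcal O_C$. Explicitly, under the identification of $\mathrm{Pic}^0(C)$ (line bundles trivial on each component) with $(\mathbb C^* )^{g+1}/\mathbb C^*$ given by the gluing data at the nodes $P_1,\dots,P_{g+1}$, $A$ is the class of $(h_1,\dots,h_{g+1})$ with $h_i=1$ for $1\le i\le k$, $h_i=-1$ for $k+1\le i\le g-1$, $h_g=-1$, $h_{g+1}=1$. Such a pair $[C,A]$ (with this embedding) is called a Prym-canonical binary curve; ''general'' means for all parameters $(a_{i,j})$ in a nonempty Zariski open subset of $\mathbb C^{2(g-1)}$. Gaussian map. $\Omega^1_C$ is the sheaf of Kähler differentials of $C$ (it has torsion at the nodes). If $\sigma_i=f_i\,\xi\otimes l$, $i=1,2$, are local expressions of two sections of $\omega_C\otimes A$, with $\xi$, $l$ local generators of $\omega_C$ and $A$, then $$\mu_A(\sigma_1\wedge\sigma_2)=(f_1\,df_2-f_2\,df_1)\,\xi^2\otimes l^2,$$ a section of $(\omega_C\otimes A)^{\otimes 2}\otimes\Omega^1_C\cong\omega_C^{\otimes 2}\otimes\Omega^1_C$. *)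

(* Defs.v *)
From HB Require Import structures.
From mathcomp Require Import all_boot all_order all_algebra.
From mathcomp Require Import reals complex.
From mathcomp Require Import mpoly.
From mathcomp Require Import ring.

Set Implicit Arguments.
Unset Strict Implicit.
Unset Printing Implicit Defensive.

Import GRing.Theory.
Local Open Scope ring_scope.

Local Notation ratfun K := {fraction {poly K}}.
Local Notation "p %:F" := (FracField.tofrac p).

(* [O] is a subring of [T], and O-modules are given as subsets of [T]; [T] will
   be the total ring of fractions of [O]. *)

Section LocalAlgebra.
Variables (K : Type) (T : comNzRingType) (cst : K -> T) (O : T -> Prop).

Definition is_generator (L : T -> Prop) (xi : T) : Prop :=
  L xi /\ (forall eta, L eta -> exists2 f, O f & eta = f * xi).

(* L (x) N for invertible modules [L] and [N]: the multiples of the product of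
   a generator of [L] and a generator of [N]. *)
Definition tensor (L N : T -> Prop) (w : T) : Prop :=
  exists xi l f,
    [/\ is_generator L xi, is_generator N l, O f & w = f * xi * l].

(* M (x)_O Omega^1_{O/K} is the abelian group with generators w (x) df, for
   w in M and f in O, and the relations below; the action of O is
   g (w (x) df) = (g w) (x) df.  A sequence [:: (w_1, f_1); (w_2, f_2); ...]
   stands for the sum of the w_i (x) df_i.  [kahler_pairing] expresses that
   w (x) df |-> b w f respects the relations, so that [kahler_eq] is the
   equality of two such sums in the group so presented. *)
Definition kahler_pairing (M : T -> Prop) (G : zmodType) (b : T -> T -> G) :
    Prop :=
  [/\ forall w w' f, M w -> M w' -> O f -> b (w + w') f = b w f + b w' f,
      forall w f f', M w -> O f -> O f' -> b w (f + f') = b w f + b w f',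
      forall w f f', M w -> O f -> O f' ->
        b w (f * f') = b (f * w) f' + b (f' * w) f
    & forall w c, M w -> b w (cst c) = 0].

Definition kahler_wf (M : T -> Prop) (s : seq (T * T)) : Prop :=
  forall x, x \in s -> M x.1 /\ O x.2.

Definition kahler_eq (M : T -> Prop) (s s' : seq (T * T)) : Prop :=
  forall (G : zmodType) (b : T -> T -> G), kahler_pairing M b ->
    \sum_(x <- s) b x.1 x.2 = \sum_(x <- s') b x.1 x.2.

(* (f1 df2 - f2 df1) e, with [e] in M *)
Definition gauss (e f1 f2 : T) : seq (T * T) :=
  [:: (f1 * e, f2); (- (f2 * e), f1)].

End LocalAlgebra.

(* [ratfun K] is the function field K(x) of the projective line with homogeneous
   coordinates t, u, where x = t/u; [Some c] is the point [c,1] and [None] is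
   the point [1,0]. *)

Section ProjectiveLine.
Variable K : fieldType.
Implicit Types (f w : ratfun K) (P : option K).

(* [f] is regular at [P], with value [v]. *)
Definition has_value f P (v : K) : Prop :=
  match P with
  | Some c => exists p q : {poly K},
      [/\ q.[c] != 0, f = p%:F / q%:F & v = p.[c] / q.[c]]
  | None => exists p q : {poly K},
      [/\ q != 0, (size p <= size q)%N, f = p%:F / q%:F
        & v = p`_(size q).-1 / lead_coef q]
  end.

Definition regular P f : Prop := exists v, has_value f P v.

(* z and dz/dx, for a uniformizer z at [P] *)
Definition unif P : ratfun K :=
  if P is Some c then ('X - c%:P)%:F else ('X%:F)^-1.
Definition dunif P : ratfun K := if P is Some _ then 1 else - ('X%:F)^-2.

(* A rational function [w] encodes the rational differential form w dx. *)
Definition regular_form P w : Prop := regular P (w / dunif P).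

(* w dx has at most a simple pole at [P], with residue [r]. *)
Definition has_residue w P (r : K) : Prop :=
  has_value (w * unif P / dunif P) P r.

End ProjectiveLine.

(* C is obtained from two projective lines, indexed by ['I_2], by gluing for
   each l : 'I_g.+1 the points [node a 0 l] and [node a 1 l].  Rational
   functions, and rational sections of the line bundles below, are pairs of
   elements of K(x), one for each component. *)

Section BinaryCurve.
Variables (K : fieldType) (g : nat) (a : 'M[K]_(2, g.-1)).
Local Notation F := (ratfun K).

Definition admissible : Prop :=
  forall j : 'I_2, (forall i, a j i != 0) /\ injective (a j).

(* Indices start at 0: the nodes are a_{j,0}, ..., a_{j,g-2}, [0,1], [1,0]. *)
Definition node (j : 'I_2) (l : 'I_g.+1) : option K :=
  if insub (val l) is Some i then Some (a j i)
  else if val l == g.-1 then Some 0 else None.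

(* the gluing data (h_1, ..., h_{g+1}) of A *)
Definition hA (l : 'I_g.+1) : K :=
  if (l < g./2)%N || (val l == g) then 1 else -1.

(* A point of C is a node, or a point of one component which is not a preimage
   of a node. *)
Definition smooth_pt (x : 'I_2 * option K) : bool :=
  [forall l, node x.1 l != x.2].
Definition point : Type := ('I_g.+1 + {x | smooth_pt x})%type.

Definition component (j : 'I_2) (f : F * F) : F := if j == 0 then f.1 else f.2.

(* The total ring of fractions of the local ring of C at a point, and the
   stalks of O_C, omega_C and A in it; [stwA] and [stw2] below are those of
   omega_C (x) A and omega_C^2. *)
Record stalk := Stalk {
  amb : comNzRingType;
  germ : F * F -> amb;
  stO : amb -> Prop;
  stw : amb -> Prop;
  stA : amb -> Prop }.

(* omega_C: differentials with at most simple poles at the preimages of the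
   node, with opposite residues. *)
Definition stalk_node (l : 'I_g.+1) : stalk := @Stalk (F * F)%type id
  (fun f => exists2 v, has_value f.1 (node 0 l) v & has_value f.2 (node 1 l) v)
  (fun w => exists2 r, has_residue w.1 (node 0 l) r
                     & has_residue w.2 (node 1 l) (- r))
  (fun s => exists2 v, has_value s.1 (node 0 l) (hA l * v)
                     & has_value s.2 (node 1 l) v).

Definition stalk_smooth (x : 'I_2 * option K) : stalk := @Stalk F (component x.1)
  (regular x.2) (regular_form x.2) (regular x.2).

Definition at_pt (p : point) : stalk :=
  match p with inl l => stalk_node l | inr x => stalk_smooth (val x) end.

Definition stwA (p : point) : amb (at_pt p) -> Prop :=
  tensor (stO (s:=at_pt p)) (stw (s:=at_pt p)) (stA (s:=at_pt p)).
Definition stw2 (p : point) : amb (at_pt p) -> Prop :=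
  tensor (stO (s:=at_pt p)) (stw (s:=at_pt p)) (stw (s:=at_pt p)).
Definition stcst (p : point) (c : K) : amb (at_pt p) :=
  germ (at_pt p) (c%:P%:F, c%:P%:F).

(* [st_wf] and [st_eq] describe the stalk of omega_C^2 (x) Omega^1_C. *)
Definition st_wf (p : point) := kahler_wf (stO (s:=at_pt p)) (@stw2 p).
Definition st_eq (p : point) :=
  kahler_eq (@stcst p) (stO (s:=at_pt p)) (@stw2 p).
Definition germ2 (p : point) (x : F * F * (F * F)) :=
  (germ (at_pt p) x.1, germ (at_pt p) x.2).

Definition H0_wA (sigma : F * F) : Prop :=
  forall p : point, stwA (germ (at_pt p) sigma).

(* H^0(C, omega_C^2 (x) Omega^1_C): families of germs which locally come from
   a section sum_i w_i (x) df_i over an open subset, here the complement of a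
   finite set [Z] (dense open subsets suffice, since a section over a subset of
   C_j minus the nodes extends by 0 to the other component minus the nodes). *)
Definition germs : Type := forall p : point, seq (amb (at_pt p) * amb (at_pt p)).
Definition H0_w2Omega (s : germs) : Prop :=
  forall p, st_wf (s p) /\
    exists (Z : seq point) (sigma : seq (F * F * (F * F))), p \notin Z /\
      forall q, q \notin Z ->
        st_wf (map (germ2 q) sigma) /\ st_eq (s q) (map (germ2 q) sigma).

(* [r] stands for the sum of the sigma_1 /\ sigma_2, for (sigma_1, sigma_2)
   in [r]. *)
Definition wedge_wA (r : seq (F * F * (F * F))) : Prop :=
  forall x, x \in r -> H0_wA x.1 /\ H0_wA x.2.

(* mu_A(r) = s: at each point sigma_i = f_i xi (x) l with xi, l generators of
   the stalks of omega_C and A, and s is the sum of the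
   (f_1 df_2 - f_2 df_1) xi^2 (x) l^2.  Since hA l ^+ 2 = 1, multiplication
   identifies A (x) A with O_C, and l^2 is a local section of O_C. *)
Definition gaussian_map (r : seq (F * F * (F * F))) (s : germs) : Prop :=
  forall p, exists xi l fs,
    [/\ is_generator (stO (s:=at_pt p)) (stw (s:=at_pt p)) xi,
        is_generator (stO (s:=at_pt p)) (stA (s:=at_pt p)) l,
        forall x, x \in fs -> stO x.1 /\ stO x.2,
        map (germ2 p) r = [seq (x.1 * xi * l, x.2 * xi * l) | x <- fs]
      & st_eq (s p)
          (flatten [seq gauss (xi ^+ 2 * l ^+ 2) x.1 x.2 | x <- fs])].

Definition gaussian_map_surjective : Prop :=
  forall s : germs, H0_w2Omega s -> exists2 r, wedge_wA r & gaussian_map r s.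

End BinaryCurve.

Section FieldIdentities.
Variable L : fieldType.
Implicit Types w u d h : L.

Lemma field_id1 w u d : u != 0 -> d != 0 -> w = w * u / d * (d / u).
Proof. by move=> U D; field; rewrite U D. Qed.

Lemma field_id2 h w u d : h * h = 1 -> u != 0 -> d != 0 ->
  w = h * (w * u / d) * (d / u) * h.
Proof. by move=> H U D; rewrite -[LHS]mul1r -H; field; rewrite U D. Qed.

Lemma field_id3 f x l u v : f * (x * u * v * l) = f * x * l * u * v :> L.
Proof. by ring. Qed.

Lemma field_id3' f x l v : f * (x * v * l) = f * x * l * v :> L.
Proof. by ring. Qed.

Lemma field_id4 x y : x != 0 -> y != 0 -> y^-1 * x^-1 / - (x ^- 2) = - (x / y) :> L.
Proof. by move=> X Y; field; rewrite oppr_eq0 oner_neq0 X Y. Qed.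

Lemma field_id5 x n l : x != 0 -> n != 0 -> l != 0 -> x * n / (x * (l * n)) = l^-1 :> L.
Proof. by move=> X N Y; field; rewrite X N Y. Qed.

Lemma field_id6 c a x n l : a = x - l -> x != 0 -> n != 0 -> l != 0 ->
  - (c * a) * n / (x * (l * n)) = c * (x^-1 + -1 * l^-1) :> L.
Proof. by move=> -> X N Y; field; rewrite X N Y. Qed.

End FieldIdentities.

Section PrymCanonical.
Variables (K : fieldType) (g : nat) (a : 'M[K]_(2, g.-1)).
Implicit Types (f w : ratfun K) (P : option K).

Lemma coefM_top (p q : {poly K}) (m n : nat) :
  (size p <= m.+1)%N -> (size q <= n.+1)%N -> (p * q)`_(m + n) = p`_m * q`_n.
Proof.
move=> sp sq; rewrite coefM (bigD1 (inord m)) //= inordK ?ltnS ?leq_addr //.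
rewrite addKn big1 ?addr0 // => i; rewrite -val_eqE /= inordK ?ltnS ?leq_addr //.
rewrite neq_ltn => /orP[lt|gt].
  rewrite [q`__]nth_default ?mulr0 //; apply: leq_trans sq _.
  by rewrite ltn_subRL ltn_add2r.
by rewrite [p`__]nth_default ?mul0r //; apply: leq_trans sp _.
Qed.

Lemma has_valueM f1 f2 P v1 v2 :
  has_value f1 P v1 -> has_value f2 P v2 -> has_value (f1 * f2) P (v1 * v2).
Proof.
case: P => [c|] [p1 [q1]].
  move=> [q1n -> ->] [p2 [q2 [q2n -> ->]]].
  exists (p1 * p2), (q1 * q2); rewrite !hornerM !rmorphM /= mulf_neq0 //.
  by rewrite !invfM; split=> //; rewrite mulrACA.
move=> [q1n s1 -> ->] [p2 [q2 [q2n s2 -> ->]]].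
exists (p1 * p2), (q1 * q2).
have E q : q != 0 :> {poly K} -> size q = (size q).-1.+1.
  by move=> qn; rewrite prednK // lt0n size_poly_eq0.
have S : (size (q1 * q2)).-1 = ((size q1).-1 + (size q2).-1)%N.
  by rewrite size_mul // (E _ q1n) (E _ q2n) /= addnS.
rewrite S coefM_top -?E // mulf_neq0 // !rmorphM /= lead_coefM !invfM.
split=> //; last by rewrite mulrACA.
  rewrite (leq_trans (size_polyMleq _ _)) // size_mul //.
  by rewrite -!subn1 leq_sub2r // leq_add.
by rewrite mulrACA.
Qed.

Lemma has_valueD f1 f2 P v1 v2 :
  has_value f1 P v1 -> has_value f2 P v2 -> has_value (f1 + f2) P (v1 + v2).
Proof.
have E q : q != 0 :> {poly K} -> size q = (size q).-1.+1.
  by move=> qn; rewrite prednK // lt0n size_poly_eq0.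
case: P => [c|] [p1 [q1]].
  move=> [q1n -> ->] [p2 [q2 [q2n -> ->]]].
  exists (p1 * q2 + p2 * q1), (q1 * q2).
  rewrite hornerD !hornerM rmorphD !rmorphM /= mulf_neq0 //.
  split=> //; rewrite -addf_div // tofrac_eq0.
    by apply: contraNneq q1n => ->; rewrite horner0.
  by apply: contraNneq q2n => ->; rewrite horner0.
move=> [q1n s1 -> ->] [p2 [q2 [q2n s2 -> ->]]].
exists (p1 * q2 + p2 * q1), (q1 * q2).
have S : (size (q1 * q2)).-1 = ((size q1).-1 + (size q2).-1)%N.
  by rewrite size_mul // (E _ q1n) (E _ q2n) /= addnS.
rewrite S coefD coefM_top -?E // addnC coefM_top -?E // mulf_neq0 //.
rewrite rmorphD !rmorphM /= lead_coefM; split=> //.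
- rewrite (leq_trans (size_polyD _ _)) // geq_max.
  rewrite !(leq_trans (size_polyMleq _ _)) // size_mul //.
    by rewrite addnC -!subn1 leq_sub2r // leq_add2l.
  by rewrite -!subn1 leq_sub2r // leq_add2r.
- by rewrite -addf_div // tofrac_eq0.
by rewrite -addf_div ?lead_coef_eq0.
Qed.

Lemma has_value_const P (c : K) : has_value c%:P%:F P c.
Proof.
case: P => [b|]; exists c%:P, 1; split;
  rewrite ?rmorph1 ?hornerC ?lead_coef1 ?divr1 ?oner_neq0 //.
  by rewrite size_poly1 size_polyC leq_b1.
by rewrite size_poly1 coefC.
Qed.

Lemma has_valueZ f P (c v : K) :
  has_value f P v -> has_value (c%:P%:F * f) P (c * v).
Proof. by move=> H; apply: has_valueM => //; apply: has_value_const. Qed.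

Lemma has_value1 P : has_value (1 : ratfun K) P 1.
Proof. by have := has_value_const P 1; rewrite !rmorph1. Qed.

Lemma has_valueN f P (v : K) : has_value f P v -> has_value (- f) P (- v).
Proof.
by move=> /(has_valueZ (-1)); rewrite !rmorphN !rmorph1 !mulN1r.
Qed.

Lemma polyX_neq0 : 'X%:F != 0 :> ratfun K.
Proof. by rewrite tofrac_eq0 polyX_eq0. Qed.

Lemma polyXsubC_neq0 (c : K) : ('X - c%:P)%:F != 0 :> ratfun K.
Proof. by rewrite tofrac_eq0 polyXsubC_eq0. Qed.

Lemma unif_neq0 P : unif P != 0.
Proof.
case: P => [c|]; first exact: polyXsubC_neq0.
exact: (invr_neq0 polyX_neq0).
Qed.

Lemma dunif_neq0 P : dunif P != 0.
Proof.
case: P => [c|]; first exact: oner_neq0.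
rewrite oppr_eq0; apply: invr_neq0; apply: expf_neq0; exact: polyX_neq0.
Qed.

Lemma hA2 (l : 'I_g.+1) : hA K l * hA K l = 1 :> K.
Proof. by rewrite /hA; case: ifP; rewrite ?mulrNN mulr1. Qed.

Let xi (l : 'I_g.+1) : ratfun K * ratfun K :=
  (dunif (node a 0 l) / unif (node a 0 l),
   - (dunif (node a 1 l) / unif (node a 1 l))).
Let lA (l : 'I_g.+1) : ratfun K * ratfun K := ((hA K l)%:P%:F, 1).

Lemma generator_node_w l :
  is_generator (stO (s:=stalk_node a l)) (stw (s:=stalk_node a l)) (xi l).
Proof.
have U j := unif_neq0 (node a j l); have D j := dunif_neq0 (node a j l).
split=> /=.
  exists 1; rewrite /has_residue /=.
    by rewrite divfK ?U // divff ?D //; apply: has_value1.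
  rewrite mulNr divfK ?U // mulNr divff ?D //.
  by apply: has_valueN; apply: has_value1.
move=> [w1 w2] [r /= H1 H2].
exists (w1 * unif (node a 0 l) / dunif (node a 0 l),
        - (w2 * unif (node a 1 l) / dunif (node a 1 l))).
  by exists r => //=; rewrite -[r]opprK; apply: has_valueN.
apply: injective_projections; first exact: (field_id1 _ (U 0) (D 0)).
by rewrite [RHS]mulrNN; exact: (field_id1 _ (U 1) (D 1)).
Qed.

Lemma generator_node_A l :
  is_generator (stO (s:=stalk_node a l)) (stA (s:=stalk_node a l)) (lA l).
Proof.
split=> /=.
  exists 1; rewrite ?mulr1 /=; [exact: has_value_const | exact: has_value1].
move=> [s1 s2] [v /= H1 H2].
exists ((hA K l)%:P%:F * s1, s2).
  by exists v => //=; move/(has_valueZ (hA K l)): H1; rewrite mulrA hA2 mul1r.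
congr pair => /=; rewrite ?mulr1 //.
by rewrite mulrAC -rmorphM -rmorphM /= hA2 !rmorph1 mul1r.
Qed.

Lemma generator_smooth_w (x : 'I_2 * option K) :
  is_generator (stO (s:=stalk_smooth x)) (stw (s:=stalk_smooth x)) (dunif x.2).
Proof.
have D := dunif_neq0 x.2; split=> /=.
  by rewrite /regular_form divff //; exists 1; apply: has_value1.
by move=> w H; exists (w / dunif x.2) => //; rewrite divfK.
Qed.

Lemma generator_smooth_A (x : 'I_2 * option K) :
  is_generator (stO (s:=stalk_smooth x)) (stA (s:=stalk_smooth x)) 1.
Proof.
split=> /=; first by exists 1; apply: has_value1.
by move=> s H; exists s => //; rewrite mulr1.
Qed.

(* The sections of omega_C (x) A are the differentials with at most simple poles
   at the preimages of the nodes, whose residues satisfy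
   res_1 + h_l res_2 = 0. *)
Lemma H0_wAP (sigma : ratfun K * ratfun K) :
  H0_wA a sigma <->
  (forall l, exists2 r, has_residue sigma.1 (node a 0 l) (- (hA K l * r))
                      & has_residue sigma.2 (node a 1 l) r) /\
  (forall x, smooth_pt a x -> regular_form x.2 (component x.1 sigma)).
Proof.
split=> [H | [Hn Hs]].
  split=> [l|x sx].
    have [xi' [l' [f [[[r w1 w2] _] [[u A1 A2] _] [v O1 O2] /= ->]]]] :=
      H (inl l).
    exists (- (v * (r * u))); rewrite /has_residue.
      have -> : - (hA K l * - (v * (r * u))) = v * (r * (hA K l * u)) by ring.
      rewrite -[X in has_value X]field_id3.
      by apply: (has_valueM O1); apply: (has_valueM w1 A1).
    have -> : - (v * (r * u)) = v * (- r * u) by ring.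
    rewrite -[X in has_value X]field_id3.
    by apply: (has_valueM O2); apply: (has_valueM w2 A2).
  have := H (inr (exist _ x sx)).
  rewrite /stwA /= => -[xi' [l' [f [[[r w1] _] [[u A1] _] [v O1] ->]]]].
  exists (v * (r * u)); rewrite -[X in has_value X]field_id3'.
  by apply: (has_valueM O1); apply: (has_valueM w1 A1).
case=> [l|[x sx]]; last first.
  exists (dunif x.2), 1, (component x.1 sigma / dunif x.2); split=> /=.
  - exact: generator_smooth_w.
  - exact: generator_smooth_A.
  - exact: (Hs x sx).
  - by rewrite mulr1 divfK ?dunif_neq0.
have U j := unif_neq0 (node a j l); have D j := dunif_neq0 (node a j l).
have [r H1 H2] := Hn l.
exists (xi l), (lA l),
  ((hA K l)%:P%:F * (sigma.1 * unif (node a 0 l) / dunif (node a 0 l)),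
   - (sigma.2 * unif (node a 1 l) / dunif (node a 1 l))); split=> /=.
- exact: generator_node_w.
- exact: generator_node_A.
- exists (- r) => /=; last exact: has_valueN.
  have <- : hA K l * - (hA K l * r) = - r by rewrite mulrN [_ * (_ * _)]mulrA hA2 mul1r.
  exact: has_valueZ.
apply: injective_projections.
  by apply: (field_id2 _ _ (U 0) (D 0)); rewrite -rmorphM -rmorphM hA2 !rmorph1.
rewrite [RHS]mulr1 [RHS]mulrNN; exact: (field_id1 _ (U 1) (D 1)).
Qed.

(* The i-th homogeneous coordinate of phi_j, for u = 1. *)
Definition phi (d : 'I_2 -> K) (j : 'I_2) (i : 'I_g.-1) : {poly K} :=
  let N := \prod_(r | r != i) ('X - (a j r)%:P) in
  if (i < g./2)%N then 'X * N
  else (- (d j * a j i / \prod_r a j r))%:P * N.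

(* a common denominator for the corresponding differentials *)
Definition phi_den (j : 'I_2) : {poly K} := 'X * \prod_r ('X - (a j r)%:P).

(* phi_j is the restriction to C_j of the map to P^{g-2} given by the sections
   [phi_section d i] of omega_C (x) A, on C_2 up to the sign -1; see
   [phi_section_H0], whose hypothesis is d_1 = - d_2 A_1 / A_2. *)
Definition phi_section (d : 'I_2 -> K) (i : 'I_g.-1) : ratfun K * ratfun K :=
  ((phi d 0 i)%:F / (phi_den 0)%:F, - ((phi d 1 i)%:F / (phi_den 1)%:F)).

Let pole (c : K) : ratfun K := (('X - c%:P)%:F)^-1.

Lemma regular_pole c b : b != c -> regular_form (Some b) (pole c).
Proof.
move=> bc; exists (1 / (b - c)); exists 1, ('X - c%:P).
by split; [rewrite !hornerE subr_eq0 | rewrite tofrac1 divr1 div1r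
  | rewrite !hornerE].
Qed.

Lemma residue_regular w b : regular_form (Some b) w -> has_residue w (Some b) 0.
Proof.
move=> [v H]; rewrite /has_residue mulrAC -[0](mulr0 v).
apply: (has_valueM H); exists ('X - b%:P), 1.
by split; rewrite ?tofrac1 ?divr1 // !hornerE ?oner_neq0 // subrr divr1.
Qed.

Lemma residue_pole c b : has_residue (pole c) (Some b) (b == c)%:R.
Proof.
have [-> | bc] := eqVneq b c; last exact/residue_regular/regular_pole.
rewrite /has_residue [unif _]/= [dunif _]/= divr1.
by rewrite mulVf ?polyXsubC_neq0 //; apply: has_value1.
Qed.

Lemma residue_pole_inf c : has_residue (pole c) None (-1).
Proof.
rewrite /has_residue /pole [unif _]/= [dunif _]/=.
have -> : (('X - c%:P)%:F)^-1 * 'X%:F^-1 / - ('X%:F ^- 2) =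
          - ('X%:F / ('X - c%:P)%:F).
  exact: (field_id4 polyX_neq0 (polyXsubC_neq0 c)).
apply: has_valueN; exists 'X, ('X - c%:P).
split; rewrite ?polyXsubC_eq0 ?size_polyX ?size_XsubC //.
by rewrite lead_coefXsubC coefX divr1.
Qed.

Lemma regularD P w w' :
  regular_form P w -> regular_form P w' -> regular_form P (w + w').
Proof.
by move=> [v H] [v' H']; exists (v + v'); rewrite mulrDl; apply: has_valueD.
Qed.

Lemma regularZ P w c : regular_form P w -> regular_form P (c%:P%:F * w).
Proof. by move=> [v H]; exists (c * v); rewrite -mulrA; apply: has_valueZ. Qed.

Lemma has_residueD P w w' r r' : has_residue w P r -> has_residue w' P r' ->
  has_residue (w + w') P (r + r').
Proof.
by rewrite /has_residue => H H'; rewrite !mulrDl; apply: has_valueD.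
Qed.

Lemma has_residueZ P w c r :
  has_residue w P r -> has_residue (c%:P%:F * w) P (c * r).
Proof. by rewrite /has_residue -!mulrA; apply: has_valueZ. Qed.

Lemma phi_den_quot d j i : admissible a ->
  (phi d j i)%:F / (phi_den j)%:F =
  if (i < g./2)%N then pole (a j i)
  else (d j / \prod_r a j r)%:P%:F * (pole 0 + (-1)%:P%:F * pole (a j i)).
Proof.
move=> adm; have [nz _] := adm j.
rewrite /phi /phi_den /pole [\prod_r ('X - _)](bigD1 i) //=.
set N := \prod_(r | r != i) _.
have N0 : N%:F != 0.
  by rewrite tofrac_eq0; apply/prodf_neq0 => r _; rewrite polyXsubC_eq0.
have X0 : 'X%:F != 0 :> ratfun K := polyX_neq0.
have L0 : ('X - (a j i)%:P)%:F != 0 by rewrite tofrac_eq0 polyXsubC_eq0.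
case: ifP => _; first by rewrite !tofracM; exact: (field_id5 X0 N0 L0).
rewrite polyC0 subr0 [d j * _ / _]mulrAC !polyCN polyCM polyC1.
rewrite !(tofracM, tofracN) tofrac1; refine (field_id6 _ _ X0 N0 L0).
by rewrite tofracB opprB addrC subrK.
Qed.


Lemma smooth_ptP x : smooth_pt a x -> forall l, node a x.1 l != x.2.
Proof. by move/forallP. Qed.

Lemma phi_section_H0 (d : 'I_2 -> K) (i : 'I_g.-1) : admissible a ->
  d 0 = - (d 1 * (\prod_r a 0 r) / \prod_r a 1 r) ->
  H0_wA a (phi_section d i).
Proof.
move=> adm hd.
have PN j : \prod_r a j r != 0 :> K.
  by apply/prodf_neq0 => r _; case: (adm j).
pose c := d 1 / \prod_r a 1 r.
have c0 : d 0 / \prod_r a 0 r = - c.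
  by rewrite /c hd; field; rewrite !PN.
pose l0 : 'I_g.+1 := inord g.-1.
have gm1 : (i < g.-1)%N := ltn_ord i.
have g1 : (g.-1 < g)%N by rewrite ltn_predL; case: (g) i gm1 => [[]|].
pose li : 'I_g.+1 := inord i.
have val_li : val li = i by apply: inordK; rewrite ltnS ltnW // (ltn_trans gm1).
have val_l0 : val l0 = g.-1 by apply: inordK; rewrite ltnS ltnW.
have node_inf j : node a j ord_max = None.
  by rewrite /node insubF /= ?ltnNge ?(ltnW g1) // gtn_eqF.
have node_0 j : node a j l0 = Some 0.
  by rewrite /node val_l0 insubF ?ltnn // eqxx.
have node_i j : node a j li = Some (a j i).
  rewrite /node val_li; case: insubP => [r _ /val_inj -> //|].
  by rewrite gm1.
apply/H0_wAP; split=> [l|x /smooth_ptP sx]; last first.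
  have R : regular_form x.2 ((phi d x.1 i)%:F / (phi_den x.1)%:F).
    rewrite phi_den_quot //.
    have := sx ord_max; have := sx l0; have := sx li.
    rewrite node_inf node_0 node_i; case: x.2 => [b|] //.
    move=> bi b0 _; case: ifP => _; first by apply: regular_pole; rewrite eq_sym.
    apply: regularZ; apply: regularD; first by apply: regular_pole; rewrite eq_sym.
    by apply: regularZ; apply: regular_pole; rewrite eq_sym.
  rewrite /component; case: eqP => [e|e]; first by rewrite e in R.
  have e1 : x.1 = 1.
    case: (x.1) e => -[|[|m]] hm e //; last exact: val_inj.
    by case: e; apply: val_inj.
  rewrite e1 in R; rewrite /phi_section [(_, _).2]/= -mulN1r.
  by have := regularZ (-1) R; rewrite !rmorphN !rmorph1.
have [t0 [ti [res0 resi h1 h2]]] : exists t0 ti : K,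
    [/\ forall j, has_residue (pole 0) (node a j l) t0,
        forall j, has_residue (pole (a j i)) (node a j l) ti,
        (i < g./2)%N -> hA K l * ti = ti
      & (i < g./2)%N = false -> hA K l * (t0 - ti) = - (t0 - ti)].
  have [lmax | lmax] := eqVneq l ord_max.
    exists (-1), (-1); rewrite lmax; split=> [j|j|_|_].
    - by rewrite node_inf; apply: residue_pole_inf.
    - by rewrite node_inf; apply: residue_pole_inf.
    - by rewrite /hA /= eqxx orbT mul1r.
    - by rewrite subrr mulr0 oppr0.
  have lg : (val l == g) = false by apply: contraNF lmax => /eqP e; apply/eqP/val_inj.
  have [-> | ll0] := eqVneq l l0.
    exists 1, 0; split=> [j|j|_|_].
    - by rewrite node_0; have := residue_pole 0 0; rewrite eqxx.
    - rewrite node_0; have := residue_pole (a j i) 0.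
      by have [/(_ i)/negPf nz _] := adm j; rewrite eq_sym nz.
    - by rewrite mulr0.
    - rewrite /hA -[nat_of_ord l0]/(val l0) val_l0 ltnNge.
      have -> : (g./2 <= g.-1)%N.
        by case: (g) => // n; rewrite leq_uphalf_double -addnn leq_addr.
      by rewrite ltn_eqF //= mulN1r.
  have lr : (l < g.-1)%N.
    have := ltn_ord l; rewrite ltnS leq_eqVlt -[nat_of_ord l]/(val l) lg /=.
    move=> lg'; rewrite ltn_neqAle.
    have -> : (l <= g.-1)%N by rewrite -ltnS prednK // (leq_ltn_trans _ g1).
    rewrite andbT; apply: contraNneq ll0 => e.
    by apply/eqP/val_inj; rewrite val_l0.
  pose r := Ordinal lr.
  have node_r j : node a j l = Some (a j r).
    by rewrite /node insubT.
  exists 0, (r == i)%:R; split=> [j|j|ik|ik].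
  - rewrite node_r; have := residue_pole 0 (a j r).
    by have [/(_ r)/negPf -> _] := adm j.
  - rewrite node_r; have := residue_pole (a j i) (a j r).
    by have [_ inj] := adm j; rewrite (inj_eq inj).
  - have [e | _] := eqVneq r i; last by rewrite mulr0.
    by rewrite /hA -[nat_of_ord l]/(nat_of_ord r) e ik mul1r.
  have [e | _] := eqVneq r i; last by rewrite subrr mulr0 oppr0.
  by rewrite /hA lg -[nat_of_ord l]/(nat_of_ord r) e ik mulN1r.
rewrite /phi_section [(_, _).1]/= [(_, _).2]/= !phi_den_quot //.
case: ifP => ik; [have h := h1 ik | have h := h2 ik].
  exists (- ti); first by rewrite mulrN opprK h.
  by have := has_residueZ (-1) (resi 1); rewrite !rmorphN !rmorph1 !mulN1r.
have R j : has_residue ((d j / \prod_r a j r)%:P%:F *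
    (pole 0 + (-1)%:P%:F * pole (a j i))) (node a j l)
    (d j / (\prod_r a j r) * (t0 - ti)).
  apply: has_residueZ; apply: has_residueD => //.
  by rewrite -[- ti]mulN1r; apply: has_residueZ.
exists (- (c * (t0 - ti))).
  have := R 0; rewrite c0 => R0.
  have -> // : - (hA K l * - (c * (t0 - ti))) = - c * (t0 - ti).
  by rewrite mulrN opprK mulrCA h mulrN mulNr.
by have := has_residueZ (-1) (R 1); rewrite !rmorphN !rmorph1 !mulN1r.
Qed.

End PrymCanonical.

Definition zariski_open (K : fieldType) (n : nat) (U : 'rV[K]_n -> Prop) : Prop :=
  exists S : {mpoly K[n]} -> Prop,
    forall v, U v <-> exists2 P, S P & P.@[v 0] != 0.

(* Main.v *)
(* A section of omega_C^2 (x) Omega^1_C amounts to a cubic differential on each component,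
   with poles of order at most 2 at the nodes, and a torsion coefficient at each node.  A
   degree count shows that 5(g-1) of its polar and torsion coefficients determine it, so
   mu_A is surjective as soon as the corresponding 5(g-1) alternating forms on
   H^0(omega_C (x) A) are linearly independent, which is an open condition on the nodes.

   Independence is propagated from g to g+1 by adding a general node (x, y).  The wedge
   products of the new section with the old ones realize the four new polar coefficients,
   because the old sections separate 1-jets at x and y.  The new torsion coefficient is
   adjusted by a nonzero element of the kernel in genus g, which exists for g >= 13 since
   binomial(g-1, 2) > 5(g-1), and whose torsion at (x, y) is the evaluation of a nonzero
   alternating form at x and y.  The cases g = 12 and g = 13 are certified on explicit
   nodes by an inverse modulo 13. *)

Require Import Defs.
From Stdlib Require Import BinInt.
From mathcomp Require Import all_boot all_order all_algebra.
From mathcomp Require Import reals complex mpoly.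
From mathcomp Require Import boolp classical_sets.
From mathcomp Require Import ring zify ssrZ.

Set Implicit Arguments.
Unset Strict Implicit.
Unset Printing Implicit Defensive.

Import GRing.Theory.
Local Open Scope ring_scope.

Local Notation ratfun K := {fraction {poly K}}.
Local Notation "p %:F" := (FracField.tofrac p).

(** * Derivations and local rings of smooth points *)

(** The count: on one component the cubic differentials with at most double poles at the g+1 nodes
    form a space of dimension 2(g+1) - 6 + 1 = 2g - 3, one less than the number of polar
    coefficients at the nodes a_l. With g+1 torsion coefficients the total is 2(2g - 3) + (g+1) =
    5(g-1). The slot left free on each component, at the node [i0], stores the torsion at [0,1] or
    [1,0]. For g = 12 the exterior square has dimension 55 = 5 * 11, so surjectivity forces
    injectivity and no kernel is left to correct a torsion coefficient. Hence the induction can only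
    start at 13, and 12 is certified separately. Since floor(g/2) grows at every second step only,
    the new node must alternate between the two kinds (h = 1 and h = -1). The prime 13 is the least
    modulo which twelve nodes can stay nonzero and distinct; 2 is a primitive root, so its powers
    give a second ordering of all nonzero residues. Equality in a stalk is tested on all pairings
    that respect the relations, so it has to be derived from the relations alone: each stalk is
    brought to a normal form. *)

Section QuotientRule.
Variable L : fieldType.
Implicit Types p q r s : L.

Lemma quotient_rule_eq p q r s dp dq dr ds : q != 0 -> s != 0 ->
  p * s = r * q -> dp * s + p * ds = dr * q + r * dq ->
  (dp * q - p * dq) / q ^+ 2 = (dr * s - r * ds) / s ^+ 2.
Proof.
move=> q0 s0 e de; apply/eqP; rewrite eqr_div ?expf_neq0 //; apply/eqP.
have -> : (dp * q - p * dq) * s ^+ 2 = (dp * s) * q * s - (p * s) * dq * s by ring.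
have -> : dp * s = dr * q + r * dq - p * ds by rewrite -de; ring.
have -> : (dr * q + r * dq - p * ds) * q * s - p * s * dq * s =
  dr * q ^+ 2 * s + r * dq * q * s - (p * s) * ds * q - (p * s) * dq * s by ring.
by rewrite e; ring.
Qed.

Lemma quotient_ruleD p q r s dp dq dr ds : q != 0 -> s != 0 ->
  ((dp * s + p * ds + (dr * q + r * dq)) * (q * s) - (p * s + r * q) * (dq * s + q * ds))
    / (q * s) ^+ 2
  = (dp * q - p * dq) / q ^+ 2 + (dr * s - r * ds) / s ^+ 2.
Proof. by move=> q0 s0; field; rewrite q0 s0. Qed.

Lemma quotient_ruleM p q r s dp dq dr ds : q != 0 -> s != 0 ->
  ((dp * r + p * dr) * (q * s) - (p * r) * (dq * s + q * ds)) / (q * s) ^+ 2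
  = (dp * q - p * dq) / q ^+ 2 * (r / s) + p / q * ((dr * s - r * ds) / s ^+ 2).
Proof. by move=> q0 s0; field; rewrite q0 s0. Qed.

End QuotientRule.

Section Derivation.
Variable K : fieldType.
Implicit Types (f h : ratfun K) (p q : {poly K}).

Lemma fracE f : exists2 pq : {poly K} * {poly K}, pq.2 != 0 & f = pq.1%:F / pq.2%:F.
Proof.
elim/quotW: f => x; exists (\n_x, \d_x) => /=; first exact: denom_ratioP.
have x0 : \d_x != 0 := denom_ratioP x.
have e : FracField.tofrac \n_x = (\pi_(FracField.type _) x)%qT * FracField.tofrac \d_x.
  rewrite -[_ * _]/(FracField.mul _ _) !piE; apply/eqmodP => /=.
  rewrite FracField.equivfE /FracField.mulf !numden_Ratio ?oner_neq0 ?mulf_neq0 ?oner_neq0 //. by rewrite mulr1 mul1r mulrC.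
by rewrite e mulfK // tofrac_eq0.
Qed.

Fact fracP f : exists pq : {poly K} * {poly K}, (pq.2 != 0) && (f == pq.1%:F / pq.2%:F).
Proof. by have [pq h ->] := fracE f; exists pq; rewrite h eqxx. Qed.

(** This is d/dx on K(x), computed on a chosen representation as a quotient; [dfracE] makes the
    choice irrelevant. *)
Definition dfrac f : ratfun K :=
  let: (p, q) := xchoose (fracP f) in
  (p^`()%:F * q%:F - p%:F * q^`()%:F) / q%:F ^+ 2.

Lemma dfracE p q : q != 0 ->
  dfrac (p%:F / q%:F) = (p^`()%:F * q%:F - p%:F * q^`()%:F) / q%:F ^+ 2.
Proof.
move=> q0; rewrite /dfrac; move: (xchooseP (fracP (p%:F / q%:F))).
case: xchoose => r s /= /andP[s0 /eqP e0].
have e : p * s = r * q.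
  by apply/eqP; rewrite -tofrac_eq !tofracM -eqr_div ?tofrac_eq0 // e0.
symmetry; apply: quotient_rule_eq; rewrite ?tofrac_eq0 //; rewrite -!tofracM -?tofracD.
  by rewrite e.
by have := congr1 (fun r => (deriv r)%:F) e; rewrite !derivM.
Qed.

Lemma dfrac_poly p : dfrac p%:F = p^`()%:F.
Proof.
have d1 : deriv (1 : {poly K}) = 0 := derivC 1.
have := dfracE p (oner_neq0 {poly K}).
by rewrite d1 tofrac1 !divr1 tofrac0 mulr0 subr0 mulr1 expr1n divr1.
Qed.

Lemma dfracD f h : dfrac (f + h) = dfrac f + dfrac h.
Proof.
have [[p q] /= q0 ->] := fracE f; have [[r s] /= s0 ->] := fracE h.
rewrite addf_div ?tofrac_eq0 // -!tofracM -tofracD !dfracE ?mulf_neq0 //.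
rewrite derivD !derivM !(tofracD, tofracM).
by rewrite quotient_ruleD ?tofrac_eq0.
Qed.

Lemma dfracM f h : dfrac (f * h) = dfrac f * h + f * dfrac h.
Proof.
have [[p q] /= q0 ->] := fracE f; have [[r s] /= s0 ->] := fracE h.
rewrite mulf_div -!tofracM !dfracE ?mulf_neq0 //.
rewrite !derivM !(tofracD, tofracM).
by rewrite quotient_ruleM ?tofrac_eq0.
Qed.

Lemma dfracC (c : K) : dfrac c%:P%:F = 0.
Proof. by rewrite dfrac_poly derivC tofrac0. Qed.

End Derivation.

(* The local ring [reg] of a smooth point with uniformizer [z] and residue field
   [K]; [d] is the derivation d/dz. *)
Record is_local (K F : fieldType) (cst : K -> F) (reg : F -> Prop) (v : F -> K)
    (d : F -> F) (z : F) : Prop := IsLocal {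
  cst1 : cst 1 = 1;
  cst0 : cst 0 = 0;
  cstD : forall a b, cst (a + b) = cst a + cst b;
  cstM : forall a b, cst (a * b) = cst a * cst b;
  reg_cst : forall c, reg (cst c);
  val_cst : forall c, v (cst c) = c;
  reg_add : forall f h, reg f -> reg h -> reg (f + h);
  val_add : forall f h, reg f -> reg h -> v (f + h) = v f + v h;
  reg_mul : forall f h, reg f -> reg h -> reg (f * h);
  val_mul : forall f h, reg f -> reg h -> v (f * h) = v f * v h;
  reg_inv : forall f, reg f -> v f != 0 -> reg f^-1;
  unif_n0 : z != 0;
  reg_unif : reg z;
  val_unif : v z = 0;
  der_add : forall f h, d (f + h) = d f + d h;
  der_mul : forall f h, d (f * h) = d f * h + f * d h;
  der_cst : forall c, d (cst c) = 0;
  der_unif : d z = 1;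
  local_ind : forall S : F -> Prop,
    (forall c, S (cst c)) -> S z ->
    (forall f h, reg f -> reg h -> S f -> S h -> S (f + h)) ->
    (forall f h, reg f -> reg h -> S f -> S h -> S (f * h)) ->
    (forall f, reg f -> v f != 0 -> S f -> S f^-1) ->
    forall f, reg f -> S f }.

Section LocalRing.
Variables (K F : fieldType) (cst : K -> F) (reg : F -> Prop) (v : F -> K).
Variables (d : F -> F) (z : F).
Hypothesis loc : is_local cst reg v d z.
Implicit Types f h k : F.

Let r_cst := reg_cst loc.
Let r_add := reg_add loc.
Let r_mul := reg_mul loc.
Let r_inv := reg_inv loc.

Lemma cstN c : cst (- c) = - cst c.
Proof. by apply/eqP; rewrite -addr_eq0 -(cstD loc) addNr (cst0 loc). Qed.

Lemma reg0 : reg 0.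
Proof. by rewrite -(cst0 loc). Qed.

Lemma reg1 : reg 1.
Proof. by rewrite -(cst1 loc). Qed.

Lemma reg_opp f : reg f -> reg (- f).
Proof. by move=> rf; rewrite -mulN1r -(cst1 loc) -cstN; apply: r_mul. Qed.

Lemma val_zero : v 0 = 0.
Proof. by rewrite -(cst0 loc) (val_cst loc). Qed.

Lemma val_one : v 1 = 1.
Proof. by rewrite -(cst1 loc) (val_cst loc). Qed.

Lemma val_opp f : reg f -> v (- f) = - v f.
Proof.
move=> rf; apply/eqP; rewrite -addr_eq0 -(val_add loc) ?addNr ?val_zero //.
exact: reg_opp.
Qed.

Lemma val_neq0 f : v f != 0 -> f != 0.
Proof. by apply: contraNneq => ->; rewrite val_zero. Qed.

Lemma val_inv f : reg f -> v f != 0 -> v f^-1 = (v f)^-1.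
Proof.
move=> rf f0; apply: (mulIf f0); rewrite -(val_mul loc) ?mulVf ?val_one //.
  exact: val_neq0.
exact: r_inv.
Qed.

Lemma der0 : d 0 = 0.
Proof. by rewrite -[in LHS](cst0 loc) (der_cst loc). Qed.

Lemma der1 : d 1 = 0.
Proof. by rewrite -(cst1 loc) (der_cst loc). Qed.

Lemma der_opp f : d (- f) = - d f.
Proof. by apply/eqP; rewrite -addr_eq0 -(der_add loc) addNr der0. Qed.

Lemma der_cstM c f : d (cst c * f) = cst c * d f.
Proof. by rewrite (der_mul loc) (der_cst loc) mul0r add0r. Qed.

Lemma der_inv f : f != 0 -> d f^-1 = - (d f * f ^- 2).
Proof.
move=> f0; apply: (mulIf f0).
have : d (f^-1 * f) = 0 by rewrite mulVf // der1.
rewrite (der_mul loc) => /eqP; rewrite addr_eq0 => /eqP ->.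
by field; rewrite f0.
Qed.

Lemma reg_der f : reg f -> reg (d f).
Proof.
apply: (local_ind loc (S := fun f => reg (d f))) => {f}.
- by move=> c; rewrite (der_cst loc); apply: reg0.
- by rewrite (der_unif loc); apply: reg1.
- by move=> f h _ _ rf rh; rewrite (der_add loc); apply: r_add.
- move=> f h rf rh rdf rdh; rewrite (der_mul loc).
  by apply: r_add; apply: r_mul.
move=> f rf f0 rdf; rewrite der_inv ?val_neq0 //; apply: reg_opp.
by rewrite expr2 invfM; apply: r_mul => //; apply: r_mul; apply: r_inv.
Qed.

Lemma val_der_mul f h : reg f -> reg h -> v (d (f * h)) = v (d f) * v h + v f * v (d h).
Proof.
move=> rf rh; have rdf := reg_der rf; have rdh := reg_der rh.
by rewrite (der_mul loc) (val_add loc) ?(val_mul loc) //; apply: r_mul.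
Qed.

Lemma val_der_unifM k : reg k -> v (d (z * k)) = v k.
Proof.
move=> rk; rewrite val_der_mul //; last exact: reg_unif loc.
by rewrite (der_unif loc) val_one (val_unif loc) mul0r mul1r addr0.
Qed.

Lemma val_der2_unifM k : reg k -> v (d (d (z * k))) = 2 * v (d k).
Proof.
move=> rk; rewrite (der_mul loc) (der_unif loc) mul1r (der_add loc).
have rz := reg_unif loc; have rdk := reg_der rk.
rewrite (val_add loc); first by rewrite val_der_unifM //; ring.
  exact: reg_der.
by apply: reg_der; apply: r_mul.
Qed.

(** First-order Taylor expansion, by induction on the way [f] is built from constants and [z]
    ([local_ind]). *)
Lemma unif_expand f : reg f -> exists2 k, reg k & f = cst (v f) + z * k.
Proof.
apply: (local_ind loc (S := fun f => exists2 k, reg k & f = cst (v f) + z * k)) => {f}.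
- move=> c; exists 0; first exact: reg0.
  by rewrite (val_cst loc) mulr0 addr0.
- by exists 1; [exact: reg1 | rewrite (val_unif loc) (cst0 loc) mulr1 add0r].
- move=> f h rf rh [k rk ek] [l rl el]; exists (k + l); first exact: r_add.
  by rewrite (val_add loc) // (cstD loc) mulrDr addrACA -ek -el.
- move=> f h rf rh [k rk ek] [l rl el].
  exists (cst (v f) * l + k * h).
    by apply: r_add; apply: r_mul.
  rewrite (val_mul loc) // (cstM loc).
  have -> : f * h = cst (v f) * (cst (v h) + z * l) + z * k * h.
    by rewrite -el -mulrDl -ek.
  by ring.
move=> f rf f0 [k rk ek]; have f0' := val_neq0 f0.
have c0 : cst (v f) != 0.
  by apply: contraNneq f0 => /(congr1 v); rewrite (val_cst loc) val_zero => ->.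
have civ : cst (v f)^-1 = (cst (v f))^-1.
  by apply: (mulIf c0); rewrite -(cstM loc) !mulVf // (cst1 loc).
(* From [1/f - 1/c = (c - f)/(c f)] with [c = v f] and [f - c = z k]. *)
exists (- (k * cst (v f)^-1 * f^-1)).
  by apply: reg_opp; apply: r_mul; [apply: r_mul | apply: r_inv].
rewrite val_inv // civ; apply: (mulIf f0'); apply: (mulfI c0).
rewrite mulVf // mulr1 mulrDl mulrDr mulVKf //.
have -> : cst (v f) * (z * - (k * (cst (v f))^-1 / f) * f) = - (z * k).
  by field; rewrite c0 f0'.
by rewrite {2}ek addrK.
Qed.

Lemma val0_unif f : reg f -> v f = 0 -> exists2 k, reg k & f = z * k.
Proof.
move=> rf f0; have [k rk ek] := unif_expand rf; exists k => //.
by rewrite {1}ek f0 (cst0 loc) add0r.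
Qed.

Lemma val_der0_unif2 f : reg f -> v f = 0 -> v (d f) = 0 ->
  exists2 k, reg k & f = z ^+ 2 * k.
Proof.
move=> rf f0 df0; have [k rk ek] := val0_unif rf f0.
move: df0; rewrite ek val_der_unifM // => /(val0_unif rk)[l rl ->].
by exists l; rewrite // mulrA expr2.
Qed.

End LocalRing.

Section Places.
Variable K : fieldType.
Implicit Types (f h : ratfun K) (p q : {poly K}) (P : option K).

Let sizeE q : q != 0 -> size q = (size q).-1.+1.
Proof. by move=> q0; rewrite prednK // lt0n size_poly_eq0. Qed.

Lemma has_value_unique f P v w : has_value f P v -> has_value f P w -> v = w.
Proof.
case: P => [c|] [p [q]].
  move=> [q0 -> ->] [r [s [s0 e ->]]].
  have nz (t : {poly K}) : t.[c] != 0 -> t != 0.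
    by apply: contraNneq => ->; rewrite horner0.
  move/eqP: e; rewrite eqr_div ?tofrac_eq0 ?nz // -!tofracM tofrac_eq => /eqP e.
  by apply/eqP; rewrite eqr_div // -!hornerM e.
move=> [q0 sp -> ->] [r [s [s0 sr e ->]]].
move/eqP: e; rewrite eqr_div ?tofrac_eq0 // -!tofracM tofrac_eq => /eqP e.
apply/eqP; rewrite eqr_div ?lead_coef_eq0 // /lead_coef.
rewrite -coefM_top -?sizeE //; apply/eqP.
by rewrite -[RHS]coefM_top -?sizeE // addnC e.
Qed.

Definition place_val P f : K := xget 0 [set v | has_value f P v]%classic.

(** Chain rule: for the uniformizer z at [P], d/dz is d/dx divided by dz/dx. *)
Definition place_der P f : ratfun K := dfrac f / dunif P.

Lemma place_valE f P v : has_value f P v -> place_val P f = v.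
Proof. by move=> h; apply: (has_value_unique _ h); apply: xgetPex; exists v. Qed.

Lemma place_valP f P : regular P f -> has_value f P (place_val P f).
Proof. by move=> [v h]; rewrite (place_valE h). Qed.

Lemma has_valueV f P v : has_value f P v -> v != 0 -> has_value f^-1 P v^-1.
Proof.
case: P => [c|] [p [q]].
  move=> [q0 -> ->]; rewrite mulf_eq0 invr_eq0 negb_or => /andP[p0 _].
  by exists q, p; rewrite !invf_div.
move=> [q0 sp -> ->]; rewrite mulf_eq0 invr_eq0 negb_or => /andP[p0 _].
have sz : size p = size q.
  apply/eqP; rewrite eqn_leq sp /= leqNgt; apply: contraNN p0 => lt.
  by rewrite nth_default // -ltnS -sizeE.
exists q, p; rewrite -size_poly_eq0 sz size_poly_eq0 leqnn !invf_div.
by rewrite /lead_coef sz.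
Qed.

Lemma has_value_unif P : has_value (unif P) P 0.
Proof.
case: P => [c|].
  exists ('X - c%:P), 1; rewrite !hornerE oner_neq0 subrr mul0r /=.
  by rewrite tofrac1 divr1.
exists 1, 'X; rewrite polyX_eq0 size_poly1 size_polyX lead_coefX coefC /= mul0r.
by rewrite tofrac1 div1r.
Qed.

Lemma dfrac_unif P : dfrac (unif P) = dunif P.
Proof.
case: P => [c|] /=; first by rewrite dfrac_poly derivXsubC tofrac1.
have d1 : deriv (1 : {poly K}) = 0 := derivC 1.
have X0 : 'X != 0 :> {poly K} by rewrite polyX_eq0.
have := dfracE 1 X0; rewrite tofrac1 div1r => ->.
by rewrite d1 tofrac0 mul0r derivX tofrac1 mul1r sub0r mulNr div1r.
Qed.

(* At the point at infinity, [p / q] is a quotient of polynomials in [1/x] after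
   dividing [p] and [q] by [x ^ deg q]. *)
Lemma place_local_ind P (S : ratfun K -> Prop) :
  (forall c : K, S c%:P%:F) -> S (unif P) ->
  (forall f h, regular P f -> regular P h -> S f -> S h -> S (f + h)) ->
  (forall f h, regular P f -> regular P h -> S f -> S h -> S (f * h)) ->
  (forall f, regular P f -> place_val P f != 0 -> S f -> S f^-1) ->
  forall f, regular P f -> S f.
Proof.
move=> Sc Sz SD SM SV.
(* Regularity is carried along because the closure hypotheses on [S] ask for it. *)
pose S' f := S f /\ regular P f.
have rD f h : regular P f -> regular P h -> regular P (f + h).
  by move=> [v hv] [w hw]; exists (v + w); apply: has_valueD.
have rM f h : regular P f -> regular P h -> regular P (f * h).
  by move=> [v hv] [w hw]; exists (v * w); apply: has_valueM.
have Sc' c : S' c%:P%:F by split=> //; exists c; apply: has_value_const.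
have Sz' : S' (unif P) by split=> //; exists 0; apply: has_value_unif.
have SD' f h : S' f -> S' h -> S' (f + h).
  by move=> [? ?] [? ?]; split; [apply: SD | apply: rD].
have SM' f h : S' f -> S' h -> S' (f * h).
  by move=> [? ?] [? ?]; split; [apply: SM | apply: rM].
have SV' f v : has_value f P v -> v != 0 -> S' f -> S' f^-1.
  move=> h v0 [? ?]; split; last by exists v^-1; apply: has_valueV.
  by apply: SV => //; rewrite (place_valE h).
case: P Sz SD SM SV @S' rD rM Sc' Sz' SD' SM' SV' => [c|] _ _ _ _ S' _ _ Sc' Sz' SD' SM' SV' f [v].
  have Sp p : S' p%:F.
    elim/poly_ind: p => [|p b IH]; first exact: (Sc' 0).
    rewrite tofracD tofracM; apply: (SD' _ _ _ (Sc' b)); apply: (SM' _ _ IH).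
    by have := SD' _ _ Sz' (Sc' c); rewrite -tofracD subrK.
  move=> [p [q [q0 -> _]]]; suff: S' (p%:F / q%:F) by case.
  apply: (SM' _ _ (Sp p)); apply: (SV' _ q.[c]) => //.
  by exists q, 1; rewrite hornerC oner_neq0 tofrac1 !divr1.
move=> [p [q [q0 sp -> _]]].
have X0 : 'X%:F != 0 :> ratfun K by rewrite tofrac_eq0 polyX_eq0.
pose N := (size q).-1.
have Sp (r : {poly K}) : (size r <= size q)%N -> S' (r%:F * ('X%:F)^-1 ^+ N).
  move=> sr; rewrite -[r]coefK poly_def rmorph_sum mulr_suml /=.
  have Sz0 : S' 0 by exact: (Sc' 0).
  elim/big_ind: _ => // i _; rewrite -mul_polyC tofracM tofracXn -mulrA.
  apply: (SM' _ _ (Sc' _)).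
  have iN : (i <= N)%N.
    by rewrite -ltnS -sizeE //; apply: leq_trans sr.
  have -> : ('X%:F)^-1 ^+ N = ('X%:F)^-1 ^+ (N - i) * ('X%:F)^-1 ^+ i :> ratfun K.
    by rewrite -exprD subnK.
  rewrite mulrCA -exprMn divff // expr1n mulr1.
  elim: (N - i)%N => [|m IH]; first exact: (Sc' 1).
  by rewrite exprS; apply: SM'.
suff: S' (p%:F / q%:F) by case.
have XN0 : ('X%:F)^-1 ^+ N != 0 :> ratfun K by rewrite expf_neq0 ?invr_neq0.
set Y := _ ^+ N in Sp XN0.
have -> : p%:F / q%:F = (p%:F * Y) * (q%:F * Y)^-1 by rewrite -mulf_div divff ?mulr1.
apply: (SM' _ _ (Sp _ sp)).
apply: (SV' _ (lead_coef q)); rewrite ?lead_coef_eq0 //.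
  exists q, 'X^N; rewrite size_polyXn lead_coefXn divr1 monic_neq0 ?monicXn //.
  by rewrite -sizeE // /Y exprVn tofracXn.
exact: Sp.
Qed.

Lemma place_local P :
  is_local (fun c : K => c%:P%:F) (regular P) (place_val P) (place_der P) (unif P).
Proof.
have V := place_valE.
split.
- by rewrite polyC1 tofrac1.
- by rewrite polyC0 tofrac0.
- by move=> a b; rewrite polyCD tofracD.
- by move=> a b; rewrite polyCM tofracM.
- by move=> c; exists c; apply: has_value_const.
- by move=> c; apply: V; apply: has_value_const.
- by move=> f h [v hv] [w hw]; exists (v + w); apply: has_valueD.
- by move=> f h /place_valP hv /place_valP hw; apply: V; apply: has_valueD.
- by move=> f h [v hv] [w hw]; exists (v * w); apply: has_valueM.
- by move=> f h /place_valP hv /place_valP hw; apply: V; apply: has_valueM.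
- by move=> f /place_valP hf f0; exists (place_val P f)^-1; apply: has_valueV.
- exact: unif_neq0.
- by exists 0; apply: has_value_unif.
- by apply: V; apply: has_value_unif.
- by move=> f h; rewrite /place_der dfracD mulrDl.
- by move=> f h; rewrite /place_der dfracM mulrDl mulrA mulrAC.
- by move=> c; rewrite /place_der dfracC mul0r.
- by rewrite /place_der dfrac_unif divff // dunif_neq0.
- exact: place_local_ind.
Qed.

End Places.

(** * Differentials on a node *)

Section Pairing.
Variables (K : fieldType) (T : comNzRingType) (cst : K -> T) (O M : T -> Prop).
Variables (G : zmodType) (b : T -> T -> G).
Hypothesis pb : kahler_pairing cst O M b.
Hypothesis M0 : M 0.
Hypothesis MD : forall w w', M w -> M w' -> M (w + w').

Lemma pairingDl w w' f : M w -> M w' -> O f -> b (w + w') f = b w f + b w' f.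
Proof. by case: pb => h _ _ _; apply: h. Qed.

Lemma pairingDr w f f' : M w -> O f -> O f' -> b w (f + f') = b w f + b w f'.
Proof. by case: pb => _ h _ _; apply: h. Qed.

Lemma pairingM w f f' : M w -> O f -> O f' ->
  b w (f * f') = b (f * w) f' + b (f' * w) f.
Proof. by case: pb => _ _ h _; apply: h. Qed.

Lemma pairing_cst w c : M w -> b w (cst c) = 0.
Proof. by case: pb => _ _ _; apply. Qed.

Lemma pairing0l f : O f -> b 0 f = 0.
Proof.
by move=> Of; apply: (addrI (b 0 f)); rewrite -pairingDl // !addr0.
Qed.

Lemma pairingNl w f : M w -> M (- w) -> O f -> b (- w) f = - b w f.
Proof.
move=> Mw Mw' Of; apply/eqP.
by rewrite -addr_eq0 -pairingDl // addNr pairing0l.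
Qed.

Lemma pairing_suml (I : eqType) (r : seq I) (w : I -> T) f : O f ->
  (forall i, i \in r -> M (w i)) ->
  M (\sum_(i <- r) w i) /\ \sum_(i <- r) b (w i) f = b (\sum_(i <- r) w i) f.
Proof.
move=> Of; elim: r => [|i r IH] Mw; first by rewrite !big_nil pairing0l.
have [|Mr e] := IH; first by move=> k kr; apply: Mw; rewrite inE kr orbT.
have Mi : M (w i) by apply: Mw; rewrite inE eqxx.
by rewrite !big_cons e pairingDl //; split=> //; apply: MD.
Qed.

(* If [z1 z2 = 0], then [z2 q] pairs to [0] with [z1] for every [q] killed by
   [z1]: apply the Leibniz rule to [z1 z2]. *)
Lemma pairing_branch z1 z2 e p q c : cst 0 = 0 -> O z1 -> O z2 -> z1 * z2 = 0 ->
  z1 * q = 0 -> M (p * e) -> M (cst c * z2 * e) -> M (q * e) -> M (z2 * q * e) ->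
  b ((p + cst c * z2 + z2 * q) * e) z1 = b (p * e) z1 + b (cst c * z2 * e) z1.
Proof.
move=> c0 O1 O2 z12 z1q Mp Mc Mq Mz.
have h : b (z2 * q * e) z1 = 0.
  have := pairingM Mq O1 O2; rewrite z12 -c0 pairing_cst //.
  by rewrite mulrA z1q mul0r pairing0l // add0r mulrA => <-.
by rewrite !mulrDl pairingDl ?h ?addr0 ?pairingDl //; apply: MD.
Qed.

(** The Leibniz rule for [z1 * z2 = 0]. It identifies, up to sign, the two candidates [z1 dz2] and
    [z2 dz1] for the torsion of a node. *)
Lemma pairing_swap z1 z2 w : cst 0 = 0 -> O z1 -> O z2 -> z1 * z2 = 0 -> M w ->
  b (z1 * w) z2 = - b (z2 * w) z1.
Proof.
move=> c0 O1 O2 z12 Mw; apply/eqP; rewrite -addr_eq0 -pairingM // z12 -c0.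
by rewrite pairing_cst.
Qed.

Variables (F : fieldType) (cstF : K -> F) (reg : F -> Prop) (v : F -> K).
Variables (d : F -> F) (z : F) (phi : F -> T).
Hypothesis loc : is_local cstF reg v d z.
Hypothesis phiC : forall c, phi (cstF c) = cst c.
Hypothesis phiD : forall f h, reg f -> reg h -> phi (f + h) = phi f + phi h.
Hypothesis phiM : forall f h, reg f -> reg h -> phi (f * h) = phi f * phi h.
Hypothesis phi1 : phi 1 = 1.
Hypothesis Ophi : forall f, reg f -> O (phi f).
Hypothesis Mphi : forall f w, reg f -> M w -> M (phi f * w).

(** Constants, [z], ring operations and inverses of units produce every regular function, so the
    relations alone force [df = f' dz]. The map [phi] carries the local ring of a smooth point into
    [T]: it is the identity at smooth points, and the extension by a constant to the other branch at
    nodes. *)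
Lemma pairing_der f : reg f -> forall w, M w -> b w (phi f) = b (phi (d f) * w) (phi z).
Proof.
have [rA rM] := (reg_add loc, reg_mul loc).
have phi0 : phi 0 = 0.
  by apply: (addrI (phi 0)); rewrite -phiD ?addr0 //; exact: reg0 loc.
have phiN h : reg h -> phi (- h) = - phi h.
  move=> rf; apply/eqP; rewrite -addr_eq0 -phiD ?addNr ?phi0 //.
  exact: (reg_opp loc).
have rz := reg_unif loc.
have rd := reg_der loc.
move: f; apply: (local_ind loc).
- move=> c w Mw; rewrite phiC pairing_cst // (der_cst loc) phi0 mul0r.
  by rewrite pairing0l //; apply: Ophi.
- by move=> w Mw; rewrite (der_unif loc) phi1 mul1r.
- move=> f h rf rh IHf IHh w Mw; rewrite (der_add loc) !phiD ?mulrDl //; try exact: rd.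
  by rewrite !(pairingDl, pairingDr) ?IHf ?IHh //; by [apply: Ophi | apply: Mphi => //; apply: rd].
- move=> f h rf rh IHf IHh w Mw; rewrite (der_mul loc) phiM //.
  have rdf := rd _ rf; have rdh := rd _ rh.
  rewrite pairingM ?IHf ?IHh //; try by [apply: Ophi | apply: Mphi].
  rewrite -pairingDl; try by [apply: Ophi | apply: Mphi => //; apply: Mphi].
  rewrite phiD ?phiM //; try exact: rM.
  by congr (b _ _); ring.
move=> f rf f0 IH w Mw.
have f0' : f != 0 := val_neq0 loc f0.
have rif := reg_inv loc rf f0; have rdf := rd _ rf.
have fif : phi f * phi f^-1 = 1 by rewrite -phiM // divff.
set u := phi f^-1 in fif *.
(* Leibniz for [f * f^-1 = 1], whose differential vanishes, with weight [u * w]. *)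
have e : b w u = - b (u * u * w) (phi f).
  have := pairingM (Mphi rif Mw) (Ophi rf) (Ophi rif).
  rewrite -/u fif -{1}phi1 -(cst1 loc) phiC pairing_cst; last exact: Mphi.
  rewrite mulrA fif mul1r mulrA => /esym/eqP.
  by rewrite addr_eq0 => /eqP.
have Muw : M (u * u * w) by rewrite -mulrA; apply: Mphi => //; apply: Mphi.
have M1 : M (phi (d f) * (u * u * w)) by apply: Mphi.
rewrite e IH // (der_inv loc) // phiN; last first.
  by rewrite expr2 invfM; apply: (rM) => //; apply: (rM).
rewrite expr2 invfM !phiM //; last exact: rM.
rewrite -pairingNl //; last exact: Ophi.
  by congr (b _ _); rewrite -/u; ring.
have -> : - (phi (d f) * (u * u * w)) = phi (- d f) * (u * u * w).
  by rewrite phiN // mulNr.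
by apply: Mphi => //; exact: (reg_opp loc).
Qed.

End Pairing.

Section SmoothStalk.
Variables (K F : fieldType) (cst : K -> F) (reg : F -> Prop) (v : F -> K).
Variables (d : F -> F) (z u : F).
Hypothesis loc : is_local cst reg v d z.

Let M w := reg (w / u).

(** Every [w df] reduces to [(w f') dz], so the coefficient of [dz] decides equality. *)
Lemma kahler_eq_smooth (s s' : seq (F * F)) :
  kahler_wf reg M s -> kahler_wf reg M s' ->
  \sum_(x <- s) x.1 * d x.2 = \sum_(x <- s') x.1 * d x.2 ->
  kahler_eq cst reg M s s'.
Proof.
move=> ws ws' e G b pb.
have M0 : M 0 by rewrite /M mul0r; apply: reg0 loc.
have MD w w' : M w -> M w' -> M (w + w').
  by rewrite /M mulrDl; apply: (reg_add loc).
have MM f w : reg f -> M w -> M (f * w).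
  by rewrite /M -mulrA; apply: (reg_mul loc).
have Oz := reg_unif loc.
have N t : kahler_wf reg M t ->
    \sum_(x <- t) b x.1 x.2 = b (\sum_(x <- t) x.1 * d x.2) z.
  move=> wt.
  have [|_ <-] := pairing_suml pb M0 MD (r := t) (w := fun x => x.1 * d x.2) Oz.
    by move=> x /wt [Mx Ox]; rewrite mulrC; apply: MM => //; apply: (reg_der loc).
  apply: eq_big_seq => x /wt [Mx Ox]; rewrite [x.1 * _]mulrC.
  by have := pairing_der pb M0 loc (phi := id) (fun _ => erefl) (fun _ _ _ _ => erefl)
      (fun _ _ _ _ => erefl) erefl (fun _ => id) MM Ox Mx.
by rewrite !N // e.
Qed.

End SmoothStalk.

Section NodeStalk.
Variables (K F : fieldType) (cst : K -> F).
Variables (reg1 reg2 : F -> Prop) (v1 v2 : F -> K) (d1 d2 : F -> F) (z1 z2 : F).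
Variables (e1 e2 : F).
Hypothesis loc1 : is_local cst reg1 v1 d1 z1.
Hypothesis loc2 : is_local cst reg2 v2 d2 z2.
Hypotheses (e10 : e1 != 0) (e20 : e2 != 0).

Local Notation T := (F * F)%type.

Definition nodeO (f : T) : Prop := [/\ reg1 f.1, reg2 f.2 & v1 f.1 = v2 f.2].
Definition nodeM (w : T) : Prop := nodeO (w.1 / e1, w.2 / e2).

(* The coefficient of [z2 dz1 = - z1 dz2], which generates the torsion. *)
Definition node_torsion (w f : T) : K :=
  v2 (d2 (w.2 / e2)) * v1 (d1 f.1) - v1 (d1 (w.1 / e1)) * v2 (d2 f.2).

Let Z1 : T := (z1, 0).
Let Z2 : T := (0, z2).
Let e : T := (e1, e2).
Let cstT c : T := (cst c, cst c).
Let phi1 f : T := (f, cst (v1 f)).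
Let phi2 f : T := (cst (v2 f), f).

Let O_add f h : nodeO f -> nodeO h -> nodeO (f + h).
Proof.
move=> [r1 r2 ef] [s1 s2 eh]; split=> /=; [exact: (reg_add loc1) | exact: (reg_add loc2) |].
by rewrite (val_add loc1) // (val_add loc2) // ef eh.
Qed.

Let O_mul f h : nodeO f -> nodeO h -> nodeO (f * h).
Proof.
move=> [r1 r2 ef] [s1 s2 eh]; split=> /=; [exact: (reg_mul loc1) | exact: (reg_mul loc2) |].
by rewrite (val_mul loc1) // (val_mul loc2) // ef eh.
Qed.

Let O_cst c : nodeO (cstT c).
Proof.
split=> /=; [exact: (reg_cst loc1) | exact: (reg_cst loc2) |].
by rewrite (val_cst loc1) (val_cst loc2).
Qed.

Let O_phi1 f : reg1 f -> nodeO (phi1 f).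
Proof. by split=> //=; [exact: (reg_cst loc2) | rewrite (val_cst loc2)]. Qed.

Let O_phi2 f : reg2 f -> nodeO (phi2 f).
Proof. by split=> //=; [exact: (reg_cst loc1) | rewrite (val_cst loc1)]. Qed.

Let pairE (f h : T) : f.1 = h.1 -> f.2 = h.2 -> f = h.
Proof. by case: f h => [? ?] [? ?] /= -> ->. Qed.

Let M_e m : nodeO m -> nodeM (m * e).
Proof. by case: m => m1 m2; rewrite /nodeM /= !mulfK. Qed.

Let M_Ee w : nodeM w -> exists2 m, nodeO m & w = m * e.
Proof.
move=> Ow; exists (w.1 / e1, w.2 / e2) => //; apply: pairE => /=.
  by rewrite divfK.
by rewrite divfK.
Qed.

Let M_mul f w : nodeO f -> nodeM w -> nodeM (f * w).
Proof. by move=> Of /M_Ee[m Om ->]; rewrite mulrA; apply/M_e/O_mul. Qed.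

Let M_add w w' : nodeM w -> nodeM w' -> nodeM (w + w').
Proof.
by move=> /M_Ee[m Om ->] /M_Ee[m' Om' ->]; rewrite -mulrDl; apply/M_e/O_add.
Qed.

Let c0 : cstT 0 = 0.
Proof. by rewrite /cstT (cst0 loc1). Qed.

Let M_0 : nodeM 0.
Proof. by rewrite -(mul0r e) -c0; apply: M_e. Qed.

Let phi1z : phi1 z1 = Z1.
Proof. by rewrite /phi1 (val_unif loc1) (cst0 loc1). Qed.

Let phi2z : phi2 z2 = Z2.
Proof. by rewrite /phi2 (val_unif loc2) (cst0 loc2). Qed.

Let O_Z1 : nodeO Z1.
Proof. by rewrite -phi1z; apply/O_phi1/(reg_unif loc1). Qed.

Let O_Z2 : nodeO Z2.
Proof. by rewrite -phi2z; apply/O_phi2/(reg_unif loc2). Qed.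

Let Z12 : Z1 * Z2 = 0.
Proof. by apply: pairE; rewrite /= ?mulr0 ?mul0r. Qed.

Let Z21 : Z2 * Z1 = 0.
Proof. by rewrite mulrC. Qed.

Section Form.
Variables (G : zmodType) (b : T -> T -> G).
Hypothesis pb : kahler_pairing cstT nodeO nodeM b.

(** The normal form of an element of the stalk: a multiple of [dz1] from the first branch, a
    multiple of [dz2] from the second, and [t] times the torsion element [z2 dz1]. *)
Definition node_form (x1 x2 : F) (t : K) : G :=
  b (phi1 x1 * e) Z1 + b (phi2 x2 * e) Z2 + b (cstT t * Z2 * e) Z1.

Let node_formD x1 x2 t y1 y2 r : reg1 x1 -> reg1 y1 -> reg2 x2 -> reg2 y2 ->
  node_form x1 x2 t + node_form y1 y2 r = node_form (x1 + y1) (x2 + y2) (t + r).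
Proof.
move=> rx1 ry1 rx2 ry2; rewrite /node_form.
have -> : phi1 (x1 + y1) = phi1 x1 + phi1 y1.
  by rewrite /phi1 (val_add loc1) // (cstD loc1).
have -> : phi2 (x2 + y2) = phi2 x2 + phi2 y2.
  by rewrite /phi2 (val_add loc2) // (cstD loc1).
have -> : cstT (t + r) = cstT t + cstT r by rewrite /cstT (cstD loc1).
rewrite !mulrDl !(pairingDl pb) //.
- by rewrite [LHS]addrACA [X in X + _ = _]addrACA.
- exact/M_e/O_mul.
- exact/M_e/O_mul.
- exact/M_e/O_phi2.
- exact/M_e/O_phi2.
- exact/M_e/O_phi1.
- exact/M_e/O_phi1.
Qed.

Let node_form0 : node_form 0 0 0 = 0.
Proof.
apply: (addrI (node_form 0 0 0)); rewrite node_formD ?addr0 //;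
  by [apply: reg0 loc1 | apply: reg0 loc2].
Qed.

(** [m] differs from [phi1 m.1] by its part on the second branch, [c z2 + l z2^2]. Here
    [z2^2 dz1 = - z1 z2 dz2 = 0], so only the linear coefficient [c] survives, as torsion. *)
Let pairing_Z1 m : nodeO m ->
  b (m * e) Z1 = b (phi1 m.1 * e) Z1 + b (cstT (v2 (d2 m.2)) * Z2 * e) Z1.
Proof.
move=> [r1 r2 em]; have [k rk ek] := unif_expand loc2 r2.
have [l rl el] := unif_expand loc2 rk.
have -> : v2 (d2 m.2) = v2 k.
  rewrite {1}ek (der_add loc2) (der_cst loc2) add0r; exact: (val_der_unifM loc2).
have Oq : nodeO (0, z2 * l).
  split=> /=; first exact: reg0 loc1.
    by apply: (reg_mul loc2) => //; exact: reg_unif loc2.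
  rewrite (val_zero loc1) (val_mul loc2) ?(val_unif loc2) ?mul0r //.
  exact: reg_unif loc2.
have -> : m = phi1 m.1 + cstT (v2 k) * Z2 + Z2 * (0, z2 * l).
  apply: pairE => /=; first by rewrite mulr0 mul0r !addr0.
  by rewrite em {1}ek {1}el; ring.
rewrite (pairing_branch pb M_0 M_add c0 O_Z1 O_Z2 Z12) //.
- by congr (b (phi1 _ * e) _ + _) => /=; rewrite mulr0 mul0r !addr0.
- by apply: pairE; rewrite /= ?mulr0 ?mul0r.
- exact/M_e/O_phi1.
- exact/M_e/O_mul.
- exact: M_e.
- exact/M_e/O_mul.
Qed.

Let pairing_Z2 m : nodeO m ->
  b (m * e) Z2 = b (phi2 m.2 * e) Z2 - b (cstT (v1 (d1 m.1)) * Z2 * e) Z1.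
Proof.
move=> [r1 r2 em]; have [k rk ek] := unif_expand loc1 r1.
have [l rl el] := unif_expand loc1 rk.
have -> : v1 (d1 m.1) = v1 k.
  rewrite {1}ek (der_add loc1) (der_cst loc1) add0r; exact: (val_der_unifM loc1).
have Oq : nodeO (z1 * l, 0).
  split=> /=; last 1 first.
  - rewrite (val_zero loc2) (val_mul loc1) ?(val_unif loc1) ?mul0r //.
    exact: reg_unif loc1.
  - by apply: (reg_mul loc1) => //; exact: reg_unif loc1.
  - exact: reg0 loc2.
have -> : m = phi2 m.2 + cstT (v1 k) * Z1 + Z1 * (z1 * l, 0).
  apply: pairE => /=; last by rewrite mulr0 mul0r !addr0.
  by rewrite -em {1}ek {1}el; ring.
rewrite (pairing_branch pb M_0 M_add c0 O_Z2 O_Z1 Z21) //.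
- have -> : cstT (v1 k) * Z1 * e = Z1 * (cstT (v1 k) * e) by rewrite mulrCA mulrA.
  rewrite (pairing_swap pb c0 O_Z1 O_Z2 Z12); last exact/M_e.
  congr (b (phi2 _ * e) _ - b _ _) => /=; first by rewrite mulr0 mul0r !addr0.
  by rewrite mulrCA mulrA.
- by apply: pairE; rewrite /= ?mulr0 ?mul0r.
- exact/M_e/O_phi2.
- exact/M_e/O_mul.
- exact: M_e.
- exact/M_e/O_mul.
Qed.

Let pairing_form w f : nodeM w -> nodeO f ->
  b w f = node_form (w.1 / e1 * d1 f.1) (w.2 / e2 * d2 f.2) (node_torsion w f).
Proof.
move=> /M_Ee[m Om ->] [r1 r2 ef].
have [rm1 rm2 em] := Om.
have rd1 := reg_der loc1 r1; have rd2 := reg_der loc2 r2.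
have -> : b (m * e) f = b (m * e) (phi1 f.1) + b (m * e) (phi2 f.2).
  rewrite -(pairingDr pb); [|exact: M_e|exact: O_phi1|exact: O_phi2].
  (* Extending both branches by their value at the node counts this common value twice; being
     constant, it has differential zero. *)
  have -> : phi1 f.1 + phi2 f.2 = f + cstT (v1 f.1).
    by apply: pairE => //=; rewrite ?ef // addrC.
  rewrite (pairingDr pb) //; first by rewrite (pairing_cst pb) ?addr0 //; apply: M_e.
  exact: M_e.
have Mme := M_e Om.
have phi1D x y : reg1 x -> reg1 y -> phi1 (x + y) = phi1 x + phi1 y.
  by move=> rx ry; rewrite /phi1 (val_add loc1) // (cstD loc1).
have phi1M x y : reg1 x -> reg1 y -> phi1 (x * y) = phi1 x * phi1 y.
  by move=> rx ry; rewrite /phi1 (val_mul loc1) // (cstM loc1).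
have phi2D x y : reg2 x -> reg2 y -> phi2 (x + y) = phi2 x + phi2 y.
  by move=> rx ry; rewrite /phi2 (val_add loc2) // (cstD loc1).
have phi2M x y : reg2 x -> reg2 y -> phi2 (x * y) = phi2 x * phi2 y.
  by move=> rx ry; rewrite /phi2 (val_mul loc2) // (cstM loc1).
have phi1C c : phi1 (cst c) = cstT c by rewrite /phi1 (val_cst loc1).
have phi2C c : phi2 (cst c) = cstT c by rewrite /phi2 (val_cst loc2).
have phi11 : phi1 1 = 1 by rewrite /phi1 (val_one loc1) (cst1 loc1).
have phi21 : phi2 1 = 1 by rewrite /phi2 (val_one loc2) (cst1 loc1).
rewrite (pairing_der pb M_0 loc1 phi1C phi1D phi1M phi11 O_phi1) //; last first.
  by move=> x y rx; apply/M_mul/O_phi1.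
rewrite (pairing_der pb M_0 loc2 phi2C phi2D phi2M phi21 O_phi2) //; last first.
  by move=> x y rx; apply/M_mul/O_phi2.
have O1 : nodeO (phi1 (d1 f.1) * m) by apply: O_mul => //; exact: O_phi1.
have O2 : nodeO (phi2 (d2 f.2) * m) by apply: O_mul => //; exact: O_phi2.
rewrite phi1z phi2z (mulrA (phi1 _) m e) (mulrA (phi2 _) m e).
rewrite (pairing_Z1 O1) (pairing_Z2 O2).
have t1 : v2 (d2 (phi1 (d1 f.1) * m).2) = v2 (d2 m.2) * v1 (d1 f.1).
  rewrite /= (der_cstM loc2) (val_mul loc2) ?(val_cst loc2) 1?mulrC //.
    exact: reg_cst loc2 _.
  exact: reg_der loc2 _ rm2.
have t2 : v1 (d1 (phi2 (d2 f.2) * m).1) = v1 (d1 m.1) * v2 (d2 f.2).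
  rewrite /= (der_cstM loc1) (val_mul loc1) ?(val_cst loc1) 1?mulrC //.
    exact: reg_cst loc1 _.
  exact: reg_der loc1 _ rm1.
rewrite t1 t2 addrACA /node_form /= !mulfK // [d1 f.1 * _]mulrC [d2 f.2 * _]mulrC.
congr (_ + _ + _).
have MZ c : nodeM (cstT c * Z2 * e) by apply/M_e/O_mul.
rewrite /node_torsion /= !mulfK //; apply/eqP; rewrite subr_eq; apply/eqP.
rewrite -(pairingDl pb) // -!mulrDl.
have cB x y : cstT (x - y) + cstT y = cstT x.
  by apply: pairE; rewrite /= -(cstD loc1) subrK.
by rewrite cB.
Qed.

Lemma pairing_node (s : seq (T * T)) : kahler_wf nodeO nodeM s ->
  \sum_(x <- s) b x.1 x.2 = node_form (\sum_(x <- s) x.1.1 / e1 * d1 x.2.1)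
    (\sum_(x <- s) x.1.2 / e2 * d2 x.2.2) (\sum_(x <- s) node_torsion x.1 x.2).
Proof.
move=> ws.
suff: [/\ reg1 (\sum_(x <- s) x.1.1 / e1 * d1 x.2.1),
  reg2 (\sum_(x <- s) x.1.2 / e2 * d2 x.2.2) &
  \sum_(x <- s) b x.1 x.2 = node_form (\sum_(x <- s) x.1.1 / e1 * d1 x.2.1)
    (\sum_(x <- s) x.1.2 / e2 * d2 x.2.2) (\sum_(x <- s) node_torsion x.1 x.2)].
  by case.
elim: s ws => [|x s IH] ws.
  by rewrite !big_nil node_form0; split=> //; [exact: reg0 loc1 | exact: reg0 loc2].
have [|rs1 rs2 es] := IH; first by move=> y ys; apply: ws; rewrite inE ys orbT.
have [Mx Ox] : nodeM x.1 /\ nodeO x.2 by apply: ws; rewrite inE eqxx.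
have r1 : reg1 (x.1.1 / e1 * d1 x.2.1).
  by case: Mx Ox => [? _ _] [? _ _]; apply: (reg_mul loc1) => //; apply: (reg_der loc1).
have r2 : reg2 (x.1.2 / e2 * d2 x.2.2).
  by case: Mx Ox => [_ ? _] [_ ? _]; apply: (reg_mul loc2) => //; apply: (reg_der loc2).
rewrite !big_cons es pairing_form //; split; [exact: (reg_add loc1)|exact: (reg_add loc2)|].
exact: node_formD.
Qed.

End Form.

(** By [pairing_node] both sides have the same normal form: restriction to each branch, and
    torsion. *)
Lemma kahler_eq_node (s s' : seq (T * T)) :
  kahler_wf nodeO nodeM s -> kahler_wf nodeO nodeM s' ->
  \sum_(x <- s) x.1.1 * d1 x.2.1 = \sum_(x <- s') x.1.1 * d1 x.2.1 ->
  \sum_(x <- s) x.1.2 * d2 x.2.2 = \sum_(x <- s') x.1.2 * d2 x.2.2 ->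
  \sum_(x <- s) node_torsion x.1 x.2 = \sum_(x <- s') node_torsion x.1 x.2 ->
  kahler_eq cstT nodeO nodeM s s'.
Proof.
move=> ws ws' h1 h2 ht G b pb; rewrite !(pairing_node pb) // ht.
have E (t : seq (T * T)) (i : T -> F) (e' : F) (d : F -> F) :
    \sum_(x <- t) i x.1 / e' * d (i x.2) = (\sum_(x <- t) i x.1 * d (i x.2)) / e'.
  by rewrite mulr_suml; apply: eq_bigr => x _; rewrite mulrAC.
by rewrite !(E _ fst) !(E _ snd) h1 h2.
Qed.

End NodeStalk.

(** * Coordinates of the Gaussian map *)

Section Coordinates.
Variables (K : fieldType) (n : nat) (a : 'I_2 -> 'I_n -> K) (m : 'I_n -> bool).
Variable i0 : 'I_n.

(** The 2-form [f /\ h] on the bivector with coefficients [X]. The matrix is not assumed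
    antisymmetric; only [X i k - X k i] matters, see [wedge_form_antisym]. *)
Definition wedge_form (f h : 'I_n -> K) (X : 'M[K]_n) : K :=
  \sum_i \sum_k X i k * (f i * h k - f k * h i).

Definition sec_sign (j : 'I_2) (i : 'I_n) : K := if (j == 0) || m i then 1 else -1.

(* The Taylor coefficients at the nodes of the sections
   [+- (1 / (x - a_i) - m_i / x)], times the local equation of the node; in
   [lin_coef] and [quad_coef] the value [0^-1 = 0] is used for [i = l]. *)
Definition res_coef j l i : K := sec_sign j i * (i == l)%:R.
Definition lin_coef j l i : K :=
  sec_sign j i * ((a j l - a j i)^-1 - (m i)%:R / a j l).
Definition quad_coef j l i : K :=
  sec_sign j i * ((m i)%:R * (a j l ^+ 2)^-1 - ((a j l - a j i) ^+ 2)^-1).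
Definition zero_coef j i : K := sec_sign j i / a j i.
Definition inf_coef j i : K := sec_sign j i * a j i.

(* On each component two polar coefficients at each node [a_l], except that only
   one is kept at [a_i0] and none at [0] and [1,0], and the torsion at all nodes. *)
Definition gauss_pair (l : 'I_n) (t : 'I_5) : ('I_n -> K) * ('I_n -> K) :=
  match val t with
  | 0 => (res_coef 0 l, lin_coef 0 l)
  | 1 => if l == i0 then (zero_coef 0, zero_coef 1) else (res_coef 0 l, quad_coef 0 l)
  | 2 => (res_coef 1 l, lin_coef 1 l)
  | 3 => if l == i0 then (inf_coef 0, inf_coef 1) else (res_coef 1 l, quad_coef 1 l)
  | _ => (lin_coef 0 l, lin_coef 1 l)
  end.

Definition gauss_coord (l : 'I_n) (t : 'I_5) (X : 'M[K]_n) : K :=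
  wedge_form (gauss_pair l t).1 (gauss_pair l t).2 X.

Definition gauss_coord_surj : Prop := forall c : 'I_n -> 'I_5 -> K,
  exists X, forall l t, gauss_coord l t X = c l t.

End Coordinates.

(** * Sections of the cube of the cotangent sheaf *)

Lemma ord2P (j : 'I_2) : j = 0 \/ j = 1.
Proof. by case: j => -[|[|//]] i; [left | right]; apply: val_inj. Qed.

Lemma leibniz_pairing (L : comPzRingType) (w f f' df df' : L) :
  w * (df * f' + f * df') = f * w * df' + f' * w * df.
Proof. by ring. Qed.

Lemma form_scale (L : fieldType) (w f z d : L) : z != 0 -> d != 0 ->
  w * f * z ^+ 2 / d ^+ 3 = (w / (d / z) ^+ 2) * (f / d).
Proof. by move=> z0 d0; field; rewrite z0 d0. Qed.

Lemma mul_gen2 (L : fieldType) (f h k x : L) : x != 0 ->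
  f * (h * x) * (k * x) / x ^+ 2 = f * h * k.
Proof. by move=> x0; field. Qed.

Section Stalks.
Variables (K : fieldType) (g : nat) (a : 'M[K]_(2, g.-1)).
Local Notation F := (ratfun K).
Local Notation V j l := (place_val (node a j l)).
Local Notation D j l := (place_der (node a j l)).
Local Notation nd j l := (node a j l).

(** The generator (dz/z)^2 of omega^2 at a node, as a coefficient of dx^2. The opposite signs of the
    generator of omega on the two branches disappear in the square. *)
Definition gen2 (P : option K) : F := (dunif P / unif P) ^+ 2.

Definition node_O l := nodeO (regular (nd 0 l)) (regular (nd 1 l)) (V 0 l) (V 1 l).
Definition node_M l := nodeM (regular (nd 0 l)) (regular (nd 1 l)) (V 0 l) (V 1 l)
  (gen2 (nd 0 l)) (gen2 (nd 1 l)).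
Definition torsion l := node_torsion (V 0 l) (V 1 l) (D 0 l) (D 1 l)
  (gen2 (nd 0 l)) (gen2 (nd 1 l)).

Lemma stO_node l : stO (s := stalk_node a l) = node_O l.
Proof.
apply/funext => f; apply/propext; split=> [[v h1 h2]|[[v1 h1] [v2 h2]]].
  by split; [exists v | exists v | rewrite (place_valE h1) (place_valE h2)].
by rewrite (place_valE h1) (place_valE h2) => e; exists v1 => //; rewrite e.
Qed.

Lemma stO_inl l : stO (s := at_pt (inl l : Defs.point a)) = node_O l.
Proof. exact: stO_node. Qed.

Lemma form_gen_neq0 (P : option K) : dunif P / unif P != 0.
Proof. exact: (mulf_neq0 (dunif_neq0 P) (invr_neq0 (unif_neq0 P))). Qed.

Lemma gen2_neq0 P : gen2 P != 0.
Proof. exact: expf_neq0 (form_gen_neq0 P). Qed.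

Lemma stw2_node l : @stw2 K g a (inl l) = node_M l.
Proof.
have [G0 G1] := generator_node_w a l.
apply/funext => w; apply/propext; split=> [[xi [xi' [f [[Lx _] [Lx' _] Of ->]]]]|Mw].
  have [h Oh ->] := G1 _ Lx; have [k Ok ->] := G1 _ Lx'.
  have OM (f1 f2 : F * F) : node_O l f1 -> node_O l f2 -> node_O l (f1 * f2).
    rewrite -stO_node => -[v h1 h2] [v' h1' h2'].
    by exists (v * v'); apply: has_valueM.
  have OE f' : stO (s := stalk_node a l) f' -> node_O l f' by rewrite stO_node.
  have := OM _ _ (OM _ _ (OE _ Of) (OE _ Oh)) (OE _ Ok); rewrite /node_M /nodeM /gen2 /=.
  rewrite -[X in node_O l X]/((f.1 * h.1 * k.1), (f.2 * h.2 * k.2)).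
  rewrite -(mul_gen2 f.1 h.1 k.1 (form_gen_neq0 (nd 0 l))).
  have x1 : - (dunif (nd 1 l) / unif (nd 1 l)) != 0 by rewrite oppr_eq0 form_gen_neq0.
  by rewrite -(mul_gen2 f.2 h.2 k.2 x1) sqrrN.
exists (dunif (nd 0 l) / unif (nd 0 l), - (dunif (nd 1 l) / unif (nd 1 l))).
exists (dunif (nd 0 l) / unif (nd 0 l), - (dunif (nd 1 l) / unif (nd 1 l))).
exists (w.1 / gen2 (nd 0 l), w.2 / gen2 (nd 1 l)); split.
- exact: generator_node_w.
- exact: generator_node_w.
- by change (stO (s := stalk_node a l) (w.1 / gen2 (nd 0 l), w.2 / gen2 (nd 1 l))); rewrite stO_node.
case: w Mw => w1 w2 _; congr pair => /=.
  by rewrite -mulrA -expr2 divfK ?gen2_neq0.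
by rewrite -mulrA mulrNN -expr2 divfK ?gen2_neq0.
Qed.

Lemma stw2_smooth (x : {x | smooth_pt a x}) :
  @stw2 K g a (inr x) = fun w => regular (val x).2 (w / dunif (val x).2 ^+ 2).
Proof.
have d0 := dunif_neq0 (val x).2.
have [G0 G1] := generator_smooth_w (val x).
have RM f h : regular (val x).2 f -> regular (val x).2 h -> regular (val x).2 (f * h).
  exact: (reg_mul (place_local _)).
apply/funext => w; apply/propext; split=> [[xi [xi' [f [[Lx _] [Lx' _] Of ->]]]]|Mw].
  have [h Oh ->] := G1 _ Lx; have [k Ok ->] := G1 _ Lx'.
  have := RM _ _ (RM _ _ Of Oh) Ok.
  by rewrite -(mul_gen2 f h k d0).
exists (dunif (val x).2), (dunif (val x).2), (w / dunif (val x).2 ^+ 2).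
by split=> //; rewrite -mulrA -expr2 divfK ?expf_neq0.
Qed.

Lemma component_cst j (c : K) : component j (c%:P%:F, c%:P%:F) = c%:P%:F.
Proof. by rewrite /component; case: ifP. Qed.

Definition on_component (p : Defs.point a) (j : 'I_2) : Prop :=
  if p is inr x then (val x).1 = j else True.

(* The rational section [sum_i w_i f_i'] of the third power of the cotangent
   bundle of the j-th component. *)
Definition wronsk (j : 'I_2) (s : seq (F * F * (F * F))) : F :=
  \sum_(x <- s) component j x.1 * dfrac (component j x.2).

Definition wronsk_at (p : Defs.point a) :
    seq (amb (at_pt p) * amb (at_pt p)) -> 'I_2 -> F :=
  match p with
  | inl l => fun s j => wronsk j s
  | inr x => fun s _ => \sum_(y <- s) y.1 * dfrac y.2
  end.

Lemma wronsk_at_germ p sigma j : on_component p j ->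
  wronsk_at (map (germ2 p) sigma) j = wronsk j sigma.
Proof.
case: p => [l _|x /= <-]; first by rewrite /wronsk_at /wronsk big_map.
by rewrite /wronsk big_map.
Qed.

(** [w df |-> w f'] respects the relations, so it is one of the pairings over which [kahler_eq]
    quantifies. *)
Lemma wronsk_at_eq p (s s' : seq (amb (at_pt p) * amb (at_pt p))) j :
  st_eq s s' -> wronsk_at s j = wronsk_at s' j.
Proof.
case: p s s' => [l|x] s s' e.
  apply: (e _ (fun w f => component j w * dfrac (component j f))).
  have cD (x y : F * F) : component j (x + y) = component j x + component j y.
    by rewrite /component; case: ifP.
  have cM (x y : F * F) : component j (x * y) = component j x * component j y.
    by rewrite /component; case: ifP.
  split.
  - by move=> w w' f _ _ _; rewrite cD mulrDl.
  - by move=> w f f' _ _ _; rewrite cD dfracD mulrDr.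
  - by move=> w f f' _ _ _; rewrite !cM dfracM leibniz_pairing.
  - by move=> w c _; rewrite component_cst dfracC mulr0.
apply: (e _ (fun w f => w * dfrac f)); split.
- by move=> w w' f _ _ _; rewrite mulrDl.
- by move=> w f f' _ _ _; rewrite dfracD mulrDr.
- by move=> w f f' _ _ _; rewrite dfracM leibniz_pairing.
- by move=> w c _; rewrite /stcst /= component_cst dfracC mulr0.
Qed.

Lemma st_eq_smooth (x : {x | smooth_pt a x}) (s s' : seq (F * F)) :
  st_wf (p := inr x) s -> st_wf (p := inr x) s' ->
  wronsk_at (p := inr x) s (val x).1 = wronsk_at (p := inr x) s' (val x).1 ->
  st_eq (p := inr x) s s'.
Proof.
rewrite /st_wf /st_eq stw2_smooth => ws ws' e.
have -> : @stcst K g a (inr x) = fun c => c%:P%:F.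
  by apply/funext => c; rewrite /stcst /= component_cst.
apply: (kahler_eq_smooth (place_local (val x).2)) => //.
have E (t : seq (F * F)) : \sum_(y <- t) y.1 * place_der (val x).2 y.2 =
    (\sum_(y <- t) y.1 * dfrac y.2) / dunif (val x).2.
  by rewrite mulr_suml; apply: eq_bigr => y _; rewrite mulrA.
by rewrite !E; congr (_ / _).
Qed.

Lemma st_eq_node l (s s' : seq (F * F * (F * F))) :
  st_wf (p := (inl l : Defs.point a)) s -> st_wf (p := (inl l : Defs.point a)) s' ->
  wronsk 0 s = wronsk 0 s' -> wronsk 1 s = wronsk 1 s' ->
  \sum_(x <- s) torsion l x.1 x.2 = \sum_(x <- s') torsion l x.1 x.2 ->
  st_eq (p := (inl l : Defs.point a)) s s'.
Proof.
rewrite /st_wf /st_eq stw2_node stO_inl => ws ws' e1 e2 et.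
have E j (t : seq (F * F * (F * F))) :
    \sum_(y <- t) component j y.1 * D j l (component j y.2) = wronsk j t / dunif (nd j l).
  by rewrite mulr_suml; apply: eq_bigr => y _; rewrite mulrA.
apply: (kahler_eq_node (place_local (nd 0 l)) (place_local (nd 1 l)) _ _ ws ws').
- exact: gen2_neq0.
- exact: gen2_neq0.
- by rewrite !(E 0) e1.
- by rewrite !(E 1) e2.
- exact: et.
Qed.

Lemma regular_sum (I : eqType) (r : seq I) P (f : I -> F) :
  (forall i, i \in r -> regular P (f i)) -> regular P (\sum_(i <- r) f i).
Proof.
move=> h; rewrite big_seq; elim/big_ind: _ => //.
  exact: reg0 (place_local P).
exact: (reg_add (place_local P)).
Qed.

(** The rational function [E] encodes [E dx^3], which is [E / (dz/dx)^3] times dz^3; hence the third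
    power of [dunif]. *)
Lemma wronsk_smooth_regular (x : {x | smooth_pt a x}) (s : seq (F * F)) :
  st_wf (p := inr x) s ->
  regular (val x).2 (wronsk_at (p := inr x) s (val x).1 / dunif (val x).2 ^+ 3).
Proof.
rewrite /st_wf stw2_smooth => ws; rewrite /wronsk_at mulr_suml.
apply: regular_sum => y /ws [My Oy].
have -> : y.1 * dfrac y.2 / dunif (val x).2 ^+ 3 =
    (y.1 / dunif (val x).2 ^+ 2) * place_der (val x).2 y.2.
  by rewrite /place_der mulrACA -invfM -exprSr.
apply: (reg_mul (place_local _)) => //.
exact: (reg_der (place_local _)).
Qed.

(** The two factors omega contribute a double pole and the exact differential none. *)
Lemma wronsk_node_regular l j (s : seq (F * F * (F * F))) :
  st_wf (p := (inl l : Defs.point a)) s ->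
  regular (nd j l) (wronsk j s * unif (nd j l) ^+ 2 / dunif (nd j l) ^+ 3).
Proof.
rewrite /st_wf stw2_node stO_inl => ws; rewrite /wronsk !mulr_suml.
apply: regular_sum => y /ws [[M1 M2 _] [O1 O2 _]].
have -> : component j y.1 * dfrac (component j y.2) * unif (nd j l) ^+ 2
    / dunif (nd j l) ^+ 3 =
    (component j y.1 / gen2 (nd j l)) * D j l (component j y.2).
  exact: form_scale (unif_neq0 _) (dunif_neq0 _).
apply: (reg_mul (place_local _)).
  by move: M1 M2; have [->|->] := ord2P j.
apply: (reg_der (place_local _)).
by move: O1 O2; have [->|->] := ord2P j.
Qed.

End Stalks.

Section LocalRingMore.
Variables (K F : fieldType) (cst : K -> F) (reg : F -> Prop) (v : F -> K).
Variables (d : F -> F) (z : F).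
Hypothesis loc : is_local cst reg v d z.

Lemma val_lin (I : finType) (c : I -> K) (f : I -> F) : (forall i, reg (f i)) ->
  [/\ reg (\sum_i cst (c i) * f i), v (\sum_i cst (c i) * f i) = \sum_i c i * v (f i)
    & v (d (\sum_i cst (c i) * f i)) = \sum_i c i * v (d (f i))].
Proof.
move=> rf; elim: (index_enum I) => [|i r [r1 r2 r3]].
  by rewrite !big_nil (der0 loc) (val_zero loc); split=> //; exact: reg0 loc.
have rd := reg_der loc.
have ri := rf i; have rci := reg_cst loc (c i).
rewrite !big_cons (der_add loc) (der_cstM loc) !(val_add loc) ?r2 ?r3 //.
- split; first by apply: (reg_add loc) => //; exact: (reg_mul loc).
    by rewrite (val_mul loc) // (val_cst loc).
  by rewrite (val_mul loc) ?(val_cst loc) //; exact: rd.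
all: by [exact: rd | apply: (reg_mul loc) | apply: (reg_mul loc) => //; exact: rd].
Qed.

Lemma val_wronsk f h : reg f -> reg h ->
  [/\ reg (f * d h - h * d f),
      v (f * d h - h * d f) = v f * v (d h) - v h * v (d f)
    & v (d (f * d h - h * d f)) = v f * v (d (d h)) - v h * v (d (d f))].
Proof.
move=> rf rh; have rd := reg_der loc; have rM := reg_mul loc; have rN := reg_opp loc.
have rdf := rd _ rf; have rdh := rd _ rh; have rddf := rd _ rdf; have rddh := rd _ rdh.
have E (x y p q : F) : reg x -> reg y -> reg p -> reg q ->
    reg (x * y - p * q) /\ v (x * y - p * q) = v x * v y - v p * v q.
  move=> rx ry rp rq; split; first by apply: (reg_add loc); [apply: rM | apply: rN; apply: rM].
  rewrite (val_add loc) ?(val_opp loc) ?(val_mul loc) //; try exact: rM.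
  by apply: rN; apply: rM.
have [r1 ->] := E _ _ _ _ rf rdh rh rdf; split=> //.
have -> : d (f * d h - h * d f) = f * d (d h) - h * d (d f).
  by rewrite (der_add loc) (der_opp loc) !(der_mul loc); ring.
by have [_ ->] := E _ _ _ _ rf rddh rh rddf.
Qed.

End LocalRingMore.

(** * Rational functions over a closed field and the vanishing of cubic differentials *)

Section ClosedField.
Variable K : closedFieldType.

Lemma exists_notin (s : seq K) : exists c, c \notin s.
Proof.
(* Euclid's trick: [p] is 1 on [s], and the factor 'X keeps it nonconstant even for empty [s]. *)
pose p : {poly K} := 'X * \prod_(x <- s) ('X - x%:P) + 1.
have nz : \prod_(x <- s) ('X - x%:P) != 0.
  by apply: monic_neq0; exact: monic_prod_XsubC.
have /closed_rootP[c] : size p != 1%N.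
  by rewrite /p mulrC size_polyDl ?size_poly1 size_mulX ?size_prod_XsubC.
rewrite /root /p hornerD hornerM hornerX hornerC => cr; exists c.
apply: contraTN cr => cs.
have -> : (\prod_(x <- s) ('X - x%:P)).[c] = 0.
  by apply/rootP; rewrite root_prod_XsubC.
by rewrite mulr0 add0r oner_neq0.
Qed.

Lemma regular_poly (f : ratfun K) :
  (forall c, regular (Some c) f) -> exists p : {poly K}, f = p%:F.
Proof.
move=> rf; have [[p q] /= q0 ef] := fracE f.
pose r := gcdp p q; have r0 : r != 0 by rewrite gcdp_eq0 negb_and q0 orbT.
have ep : p = (p %/ r) * r by rewrite divpK ?dvdp_gcdl.
have eq : q = (q %/ r) * r by rewrite divpK ?dvdp_gcdr.
have {}ef : f = (p %/ r)%:F / (q %/ r)%:F.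
  by rewrite ef {1}ep {1}eq !tofracM -mulf_div divff ?mulr1 // tofrac_eq0.
have cop : coprimep (p %/ r) (q %/ r) by apply: coprimep_div_gcd; rewrite q0 orbT.
have s0 : q %/ r != 0 by apply: contraNneq q0; rewrite {2}eq => ->; rewrite mul0r.
move: (p %/ r) (q %/ r) cop s0 ef => {q0 ep eq}p' s cop s0 ef.
have /eqP ss : size s == 1%N.
  apply/negP => /negP /closed_rootP[c sc].
  have [w [t [u [uc e _]]]] := rf c.
  have u0 : u != 0 by apply: contraNneq uc => ->; rewrite horner0.
  move/eqP: e; rewrite ef eqr_div ?tofrac_eq0 // -!tofracM tofrac_eq => /eqP e.
  have : s %| p' * u by rewrite e dvdp_mull.
  rewrite Gauss_dvdpr 1?coprimep_sym // => /dvdpP[x ex].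
  by move: uc; rewrite ex hornerM (rootP sc) mulr0 eqxx.
have [b b0 eb] : exists2 b : K, b != 0 & s = b%:P.
  by have /size_poly1P := introT eqP ss.
exists (b^-1 *: p'); rewrite ef eb -mul_polyC tofracM mulrC; congr (_ * _).
apply: (mulfI (x := b%:P%:F)); first by rewrite tofrac_eq0 polyC_eq0.
by rewrite divff ?tofrac_eq0 ?polyC_eq0 // -tofracM -polyCM divff // polyC1 tofrac1.
Qed.

Lemma regular_inf_poly (p : {poly K}) : has_value p%:F None 0 -> p = 0.
Proof.
move=> h; case: (h) => r [s [s0 sr e _]].
have es : p * s = r.
  by apply/eqP; rewrite -tofrac_eq tofracM e divfK // tofrac_eq0.
have sp : (size p <= 1)%N.
  have [->|p0] := eqVneq p 0; first by rewrite size_poly0.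
  move: sr; rewrite -es size_mul // => sr.
  by move: s0; rewrite -size_poly_gt0; move: (size p) (size s) sr => m k; lia.
move: h; rewrite (size1_polyC sp) => /(has_value_unique (has_value_const None _)) ->.
by [].
Qed.

End ClosedField.

Section Nodes.
Variables (K : fieldType) (g : nat) (a : 'M[K]_(2, g.-1)).
Hypothesis hg : (1 < g)%N.

Definition fin_node (i : 'I_g.-1) : 'I_g.+1 := inord i.
Definition zero_node : 'I_g.+1 := inord g.-1.

Let g1 : (g.-1 < g)%N.
Proof. by lia. Qed.

Lemma val_fin_node i : val (fin_node i) = i.
Proof. by apply: inordK; have := ltn_ord i; lia. Qed.

Lemma val_zero_node : val zero_node = g.-1.
Proof. by apply: inordK; lia. Qed.

Lemma node_fin j i : node a j (fin_node i) = Some (a j i).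
Proof.
rewrite /node val_fin_node; case: insubP => [r _ /val_inj -> //|].
by rewrite ltn_ord.
Qed.

Lemma node_zero j : node a j zero_node = Some 0.
Proof. by rewrite /node val_zero_node insubF ?ltnn // eqxx. Qed.

Lemma node_inf j : node a j ord_max = None.
Proof. by rewrite /node insubF /= ?ltnNge ?(ltnW g1) // gtn_eqF. Qed.

Lemma node_ind (Q : 'I_g.+1 -> Prop) :
  (forall i, Q (fin_node i)) -> Q zero_node -> Q ord_max -> forall l, Q l.
Proof.
move=> Qf Q0 QI l; case: (ltnP l g.-1) => lg.
  suff -> : l = fin_node (Ordinal lg) by [].
  by apply: val_inj; rewrite val_fin_node.
case: (eqVneq (val l) g.-1) => e.
  suff -> : l = zero_node by [].
  by apply: val_inj; rewrite val_zero_node.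
suff -> : l = ord_max by [].
by apply: val_inj => /=; have := ltn_ord l; move: e => /= e; lia.
Qed.

End Nodes.

Lemma inf_chart (L : fieldType) (e x y : L) : x != 0 ->
  e * (x ^+ 2 * y) = - (e * x^-1 ^+ 2 / (- x ^- 2) ^+ 3 * (y / x ^+ 2)).
Proof. by move=> x0; field; rewrite oppr_eq0 oner_eq0 x0. Qed.

Section Vanishing.
Variables (K : closedFieldType) (g : nat) (a : 'M[K]_(2, g.-1)).
Hypothesis hg : (1 < g)%N.
Hypothesis adm : admissible a.
Local Notation F := (ratfun K).

(* A section of the third power of the cotangent bundle of P^1, with poles of order
   at most 2, 2, 1 at infinity, 0, a_{i0}, vanishes since -6 + 5 < 0. *)
Lemma wronsk_eq0 (j : 'I_2) (i0 : 'I_g.-1) (E : F) :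
  (forall P, (forall l, node a j l != P) -> regular P (E / dunif P ^+ 3)) ->
  (forall l, regular (node a j l)
               (E * unif (node a j l) ^+ 2 / dunif (node a j l) ^+ 3)) ->
  (forall i, place_val (Some (a j i)) (E * unif (Some (a j i)) ^+ 2) = 0) ->
  (forall i, i != i0 -> place_val (Some (a j i))
     (place_der (Some (a j i)) (E * unif (Some (a j i)) ^+ 2)) = 0) ->
  E = 0.
Proof.
move=> rE rN v0 d0.
have [nz inj] := adm j.
have polyR c (p : {poly K}) : regular (Some c) p%:F.
  by exists p.[c]; exists p, 1; rewrite hornerC oner_neq0 tofrac1 !divr1.
have rM c := reg_mul (place_local (Some c)).
have rfin c : c != 0 -> (forall i, i != i0 -> a j i != c) -> c != a j i0 ->
    regular (Some c) E.
  move=> c0 ci ci0; have := rE (Some c); rewrite /dunif expr1n divr1; apply.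
  apply: (node_ind hg) => [i||].
  - rewrite node_fin //; have [->|ii0] := eqVneq i i0; first by apply: contraNneq ci0 => -[->].
    by apply: contraNneq (ci _ ii0) => -[->].
  - by rewrite node_zero //; apply: contraNneq c0 => -[<-].
  - by rewrite node_inf.
have rfi i : regular (Some (a j i)) (E * unif (Some (a j i)) ^+ 2).
  by have := rN (fin_node i); rewrite node_fin // /dunif expr1n divr1.
pose q : {poly K} := 'X ^+ 2 * ('X - (a j i0)%:P).
have [p ep] : exists p : {poly K}, E * q%:F = p%:F.
  apply: regular_poly => c.
  have [->|c0] := eqVneq c 0.
    have := rN (zero_node g); rewrite node_zero // /dunif expr1n divr1 /unif polyC0 subr0.
    by move=> h; rewrite /q tofracM tofracXn mulrA; apply: rM.
  have [->|ci0] := eqVneq c (a j i0).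
    have [k rk ek] := val0_unif (place_local _) (rfi i0) (v0 i0).
    rewrite /q mulrC tofracM -mulrA [_%:F * E]mulrC; apply: rM => //.
    move: ek; rewrite expr2 mulrA [_ * unif _]mulrC => /(mulfI (unif_neq0 _)).
    by rewrite /unif => ->.
  have [/existsP[i /andP[ii0 /eqP ei]]|/existsPn h] := boolP [exists i, (i != i0) && (a j i == c)].
    rewrite -ei; apply: rM => //.
    have [k rk ek] := val_der0_unif2 (place_local _) (rfi i) (v0 i) (d0 _ ii0).
    move: ek; rewrite mulrC => /mulfI ->; first by [].
    exact: expf_neq0 (unif_neq0 _).
  apply: rM => //; apply: rfin => // i ii0.
  by have := h i; rewrite ii0.
have q0 : q%:F != 0.
  by rewrite tofrac_eq0 mulf_neq0 ?expf_neq0 ?polyX_eq0 // polyXsubC_eq0.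
suff p0 : p = 0 by apply: (mulIf q0); rewrite ep p0 mul0r.
(* At infinity z = 1/x and dz/dx = -1/x^2, so the hypothesis says that [E] is O(x^-4). As [q] has
   degree 3, the polynomial [p] vanishes at infinity. *)
apply: regular_inf_poly.
have lI := place_local (None : option K).
have [w hw] := rN ord_max; rewrite node_inf // in hw.
have h : has_value ('X - (a j i0)%:P : {poly K})%:F^-1 None 0.
  exists 1, ('X - (a j i0)%:P); rewrite polyXsubC_eq0 size_poly1 size_XsubC.
  by rewrite tofrac1 div1r /= coefC /= mul0r.
have h2 : has_value (('X - (a j i0)%:P)%:F / ('X ^+ 2)%:F) None 0.
  exists ('X - (a j i0)%:P), ('X^2).
  rewrite expf_neq0 ?polyX_eq0 // size_XsubC size_polyXn; split=> //=.
  by rewrite nth_default ?mul0r // size_XsubC.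
have := has_valueN (has_valueM hw h2); rewrite mulr0 oppr0.
rewrite /unif /dunif tofracXn -inf_chart -?ep ?polyX_neq0 //.
by rewrite /q tofracM tofracXn.
Qed.

End Vanishing.

(** * Taylor coefficients of the sections *)

Section LinearCoefficients.
Variables (K F : fieldType) (cst : K -> F) (reg : F -> Prop) (v : F -> K).
Variables (d : F -> F) (z : F).
Hypothesis loc : is_local cst reg v d z.

Lemma val_section (s m : K) (p q : F) : reg p -> reg q ->
  let f := cst s * (p - cst m * q) in
  [/\ reg f, v f = s * (v p - m * v q), v (d f) = s * (v (d p) - m * v (d q))
    & v (d (d f)) = s * (v (d (d p)) - m * v (d (d q)))].
Proof.
move=> rp rq; have rd := reg_der loc; have rM := reg_mul loc; have rc := reg_cst loc.
have L x y : reg x -> reg y ->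
    reg (cst s * (x - cst m * y)) /\ v (cst s * (x - cst m * y)) = s * (v x - m * v y).
  move=> rx ry; have rmy : reg (cst m * y) by exact: rM.
  have rN : reg (- (cst m * y)) := reg_opp loc rmy.
  split; first by apply: rM => //; exact: (reg_add loc).
  rewrite (val_mul loc) // ?(val_add loc) ?(val_opp loc) ?(val_mul loc) ?(val_cst loc) //.
  exact: (reg_add loc).
have D x y : d (cst s * (x - cst m * y)) = cst s * (d x - cst m * d y).
  by rewrite (der_cstM loc) (der_add loc) (der_opp loc) (der_cstM loc).
have [r1 v1] := L _ _ rp rq; have [_ v2] := L _ _ (rd _ rp) (rd _ rq).
have [_ v3] := L _ _ (rd _ (rd _ rp)) (rd _ (rd _ rq)).
by split=> //; rewrite !D.
Qed.

Lemma val_section_eq (s m : K) (p q : F) vp dp ep vq dq eq :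
  [/\ reg p, v p = vp, v (d p) = dp & v (d (d p)) = ep] ->
  [/\ reg q, v q = vq, v (d q) = dq & v (d (d q)) = eq] ->
  let f := cst s * (p - cst m * q) in
  [/\ reg f, v f = s * (vp - m * vq), v (d f) = s * (dp - m * dq)
    & v (d (d f)) = s * (ep - m * eq)].
Proof. by move=> [rp <- <- <-] [rq <- <- <-]; apply: val_section. Qed.

End LinearCoefficients.

Section Poles.
Variable K : fieldType.
Local Notation F := (ratfun K).

Definition pole (c : K) : F := (('X - c%:P)%:F)^-1.

(* The local expression of the differential [f dx] with respect to [dz / z]. *)
Definition log_coef (P : option K) (f : F) : F := f * unif P / dunif P.

Lemma pole_fin (b c : K) : let u := log_coef (Some b) (pole c) in
  let v := place_val (Some b) in let d := place_der (Some b) in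
  [/\ regular (Some b) u, v u = (b == c)%:R, v (d u) = (b - c)^-1
    & v (d (d u)) = - (2 * ((b - c) ^+ 2)^-1)].
Proof.
rewrite /log_coef /dunif divr1; have loc := place_local (Some b).
have [<-|bc] := eqVneq b c.
  (* For [b = c] the local expression is the constant 1, and the stated Taylor coefficients are
     right because [0^-1 = 0]. *)
  rewrite mulVf ?polyXsubC_neq0 // !(der1 loc) (der0 loc).
  rewrite subrr expr0n invr0 mulr0 oppr0 (val_one loc) (val_zero loc).
  by split=> //; exact: reg1 loc.
have hq : has_value ('X - c%:P)%:F (Some b) (b - c).
  by exists ('X - c%:P), 1; rewrite !hornerE tofrac1 !divr1 oner_neq0.
have bc0 : b - c != 0 by rewrite subr_eq0.
have rk : regular (Some b) (pole c) by exists (b - c)^-1; exact: has_valueV hq _.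
have vk : place_val (Some b) (pole c) = (b - c)^-1 by apply: place_valE (has_valueV hq _).
have dk : place_der (Some b) (pole c) = - (pole c * pole c).
  rewrite (der_inv loc) ?polyXsubC_neq0 // /place_der dfrac_poly derivXsubC tofrac1.
  by rewrite /dunif divr1 mul1r expr2 invfM.
have rz := reg_unif loc.
have vdk : place_val (Some b) (place_der (Some b) (pole c)) = - ((b - c) ^+ 2)^-1.
  by rewrite dk (val_opp loc (reg_mul loc rk rk)) (val_mul loc rk rk) vk expr2 invfM.
rewrite mulrC; split.
- exact: (reg_mul loc rz rk).
- by rewrite (val_mul loc rz rk) (val_unif loc) mul0r.
- by rewrite (val_der_unifM loc rk).
- by rewrite (val_der2_unifM loc rk) vdk mulrN.
Qed.

Lemma pole_inf_der (L : fieldType) (x y c : L) : x != 0 -> y != 0 -> y = x - c ->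
  (-1 * y - (- x) * 1) / y ^+ 2 / (- x ^- 2) = - c * x ^+ 2 / y ^+ 2.
Proof. by move=> x0 y0 e; rewrite e in y0 *; field; rewrite y0 oppr_eq0 oner_eq0 x0. Qed.

Lemma pole_inf_form (L : fieldType) (x y : L) : x != 0 ->
  y^-1 * x^-1 / (- x ^- 2) = - x / y.
Proof. by move=> x0; have [->|y0] := eqVneq y 0; rewrite ?invr0 ?mulr0 ?mul0r //; field; rewrite y0 oppr_eq0 oner_eq0 x0. Qed.

Lemma pole_inf (c : K) : let u := log_coef None (pole c) in
  regular None u /\ place_val None (place_der None u) = - c.
Proof.
split; first by exists (-1); exact: residue_pole_inf.
have X0 := @polyX_neq0 K; have Y0 := polyXsubC_neq0 c.
have Y1 : 'X - c%:P != 0 by rewrite polyXsubC_eq0.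
have -> : log_coef None (pole c) = (- 'X)%:F / ('X - c%:P)%:F.
  by rewrite tofracN; exact: (pole_inf_form _ X0).
rewrite /place_der (dfracE _ Y1).
have -> : deriv (- 'X : {poly K}) = -1 by rewrite derivN derivX.
rewrite derivXsubC !tofracN tofrac1.
have e : ('X - c%:P)%:F = 'X%:F - c%:P%:F :> F by rewrite tofracB.
rewrite [X in place_val _ X](pole_inf_der X0 Y0 e).
apply: place_valE; exists (- c *: 'X^2), (('X - c%:P) ^+ 2).
have sz : size (('X - c%:P) ^+ 2) = 3 by rewrite size_exp_XsubC.
have mon : ('X - c%:P) ^+ 2 \is monic by rewrite monic_exp ?monicXsubC.
rewrite monic_neq0 // sz (monicP mon) divr1 coefZ coefXn mulr1; split=> //.
  by rewrite (leq_trans (size_scale_leq _ _)) // size_polyXn.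
by rewrite -mul_polyC tofracXn tofracM polyCN tofracN tofracXn.
Qed.

End Poles.

Section Sections.
Variables (K : fieldType) (g : nat) (a : 'M[K]_(2, g.-1)).
Hypothesis adm : admissible a.
Local Notation F := (ratfun K).
Local Notation n := g.-1.
Local Notation am := (fun_of_matrix a).

Definition minus_node (i : 'I_n) : bool := ~~ (i < g./2)%N.

(** A choice of the constants with d_1 = - d_2 A_1 / A_2 that makes d_j / A_j equal to -1 and 1, so
    that every section becomes 1/(x - a_i) - m_i/x up to sign. *)
Definition sec_const (j : 'I_2) : K :=
  if j == 0 then - \prod_r a 0 r else \prod_r a 1 r.

Definition sec (i : 'I_n) : F * F := phi_section a sec_const i.

Let prod_neq0 j : \prod_r a j r != 0.
Proof. by apply/prodf_neq0 => r _; case: (adm j). Qed.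

Lemma sec_H0 i : H0_wA a (sec i).
Proof.
apply: phi_section_H0 => //; rewrite /sec_const /=.
by rewrite mulrAC divff ?mul1r.
Qed.

Lemma component_sec j i : component j (sec i) =
  (sec_sign K minus_node j i)%:P%:F *
    (pole (a j i) - (minus_node i)%:R%:P%:F * pole 0).
Proof.
rewrite /component /sec /phi_section /= !phi_den_quot // /sec_sign /minus_node /sec_const.
have [->|->] := ord2P j; rewrite /= -/(pole _) -/(pole _); case: ifP => _ /=.
- by rewrite polyC0 polyC1 tofrac0 tofrac1 mul0r subr0 mul1r.
- rewrite mulNr divff // polyC1 polyCN polyC1 tofracN tofrac1 !mulN1r opprD opprK mul1r mul1r.
  by rewrite addrC.
- by rewrite polyC0 tofrac0 mul0r subr0 polyCN polyC1 tofracN tofrac1 mulN1r.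
- rewrite divff // polyC1 polyCN polyC1 tofracN tofrac1 !mul1r mulN1r opprD opprK.
  by rewrite addrC.
Qed.

Let section_coef P (i : 'I_n) j : log_coef P (component j (sec i)) =
  (sec_sign K minus_node j i)%:P%:F * (log_coef P (pole (a j i))
    - (minus_node i)%:R%:P%:F * log_coef P (pole 0)).
Proof. by rewrite component_sec /log_coef -!mulrA mulrBl -!mulrA. Qed.

Lemma sec_coef_fin j l i : let P := Some (a j l) in
  let f := log_coef P (component j (sec i)) in
  let v := place_val P in let d := place_der P in
  [/\ regular P f, v f = res_coef K minus_node j l i,
      v (d f) = lin_coef am minus_node j l i
    & v (d (d f)) = 2 * quad_coef am minus_node j l i].
Proof.
have [nz inj] := adm j; rewrite /= section_coef.
have [r vf df ef] := val_section_eq (place_local (Some (a j l)))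
  (sec_sign K minus_node j i) (minus_node i)%:R
  (pole_fin (a j l) (a j i)) (pole_fin (a j l) 0).
split; first exact: r.
- apply: (etrans vf); rewrite (negPf (nz l)) mulr0 subr0 /res_coef.
  by congr (_ * (nat_of_bool _)%:R); rewrite eq_sym; apply/eqP/eqP => [/inj|->].
- by apply: (etrans df); rewrite subr0.
apply: (etrans ef); rewrite subr0 /quad_coef; move: (sec_sign _ _ _ _) => s'.
by ring.
Qed.

Lemma sec_coef_zero j i : let P := Some 0 in
  let f := log_coef P (component j (sec i)) in
  regular P f /\ place_val P (place_der P f) = - zero_coef am minus_node j i.
Proof.
rewrite /= section_coef.
have [r _ df _] := val_section_eq (place_local (Some 0))
  (sec_sign K minus_node j i) (minus_node i)%:R (pole_fin 0 (a j i)) (pole_fin 0 0).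
split; first exact: r.
by apply: (etrans df); rewrite subrr invr0 mulr0 subr0 sub0r invrN mulrN.
Qed.

Lemma sec_coef_inf j i : let f := log_coef None (component j (sec i)) in
  regular None f /\ place_val None (place_der None f) = - inf_coef am minus_node j i.
Proof.
rewrite /= section_coef.
have [r1 d1] := pole_inf (a j i); have [r2 d2] := pole_inf (0 : K).
have [r _ df _] := val_section_eq (place_local None) (sec_sign K minus_node j i)
  (minus_node i)%:R (And4 r1 erefl d1 erefl) (And4 r2 erefl d2 erefl).
split; first exact: r.
by apply: (etrans df); rewrite oppr0 mulr0 subr0 mulrN.
Qed.

End Sections.

(** * Surjectivity from independent coordinates *)

Section GlobalWronskian.
Variables (K : closedFieldType) (g : nat) (a : 'M[K]_(2, g.-1)).
Local Notation F := (ratfun K).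

Lemma exists_smooth (j : 'I_2) (Z : seq (Defs.point a)) :
  exists x : {x | smooth_pt a x}, (val x).1 = j /\ (inr x : Defs.point a) \notin Z.
Proof.
pose bad := pmap id [seq node a j l | l <- enum 'I_g.+1]
  ++ pmap (fun p : Defs.point a => if p is inr x then (val x).2 else None) Z.
have [c] := exists_notin bad; rewrite mem_cat negb_or => /andP[c1 c2].
have sx : smooth_pt a (j, Some c).
  apply/forallP => l /=; apply: contraNneq c1 => e.
  by rewrite mem_pmap map_id -e; apply: map_f; rewrite mem_enum.
exists (exist _ (j, Some c) sx); split=> //; apply: contraNN c2 => xZ.
by rewrite mem_pmap; apply/mapP; exists (inr (exist _ (j, Some c) sx)).
Qed.

(** Two local representatives are compared at a smooth point of the component outside both
    exceptional sets; equality of germs there is already equality of rational functions. *)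
Lemma global_wronsk (s : germs a) : H0_w2Omega s ->
  exists W : 'I_2 -> F, forall p j, on_component p j -> wronsk_at (s p) j = W j.
Proof.
move=> Hs; have [_ [Z0 [sig0 [_ h0]]]] := Hs (inl ord0).
exists (fun j => wronsk j sig0) => p j pj.
have [_ [Z [sig [pZ h]]]] := Hs p.
have [x [xj]] := exists_smooth j (Z ++ Z0); rewrite mem_cat negb_or => /andP[xZ xZ0].
have qj : on_component (inr x : Defs.point a) j := xj.
rewrite (wronsk_at_eq j (h p pZ).2) wronsk_at_germ //.
rewrite -(wronsk_at_germ sig qj) -(wronsk_at_eq j (h _ xZ).2).
by rewrite (wronsk_at_eq j (h0 _ xZ0).2) wronsk_at_germ.
Qed.

End GlobalWronskian.

Section GaussGerms.
Variables (K : fieldType) (g : nat) (a : 'M[K]_(2, g.-1)).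
Local Notation F := (ratfun K).
Local Notation V j l := (place_val (node a j l)).
Local Notation D j l := (place_der (node a j l)).

Definition gauss_wronsk (j : 'I_2) (r : seq (F * F * (F * F))) : F :=
  \sum_(x <- r) (component j x.1 * dfrac (component j x.2)
                 - component j x.2 * dfrac (component j x.1)).

Definition node_coef (l : 'I_g.+1) (j : 'I_2) (f : F * F) : K :=
  V j l (D j l (log_coef (node a j l) (component j f))).

(** The terms with [d u] cancel, so the Wronskian is multiplied by [u^2] when both functions are
    multiplied by [u]. Local generators can therefore be forgotten and the Gaussian map computed on
    rational sections. *)
Lemma wronsk_scale (L : fieldType) (d : L -> L) (f1 f2 s1 s2 u e : L) :
  (forall x y, d (x * y) = d x * y + x * d y) ->
  s1 = f1 * u -> s2 = f2 * u -> e = u ^+ 2 ->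
  f1 * e * d f2 + (- (f2 * e) * d f1) = s1 * d s2 - s2 * d s1.
Proof. by move=> dM -> -> ->; rewrite !dM; ring. Qed.

Lemma involution_conj (L : comPzRingType) (h x y : L) :
  h * h = 1 -> h * x * y * h = x * y.
Proof. by move=> hh; rewrite -[RHS]mul1r -hh; ring. Qed.

Lemma sum_flatten_gauss (T : comNzRingType) (G : zmodType) (I : Type) (r : seq I)
    (f : I -> T * T) (e : T) (b : T -> T -> G) :
  \sum_(x <- flatten [seq gauss e y.1 y.2 | y <- [seq f i | i <- r]]) b x.1 x.2
  = \sum_(i <- r) (b ((f i).1 * e) (f i).2 + b (- ((f i).2 * e)) (f i).1).
Proof.
by rewrite big_flatten !big_map; apply: eq_bigr => i _; rewrite /gauss !big_cons big_nil /= addr0.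
Qed.

Lemma wf_flatten_gauss (T : comNzRingType) (O M : T -> Prop) (I : eqType) (r : seq I)
    (f : I -> T * T) (e : T) :
  (forall i, i \in r -> [/\ O (f i).1, O (f i).2, M ((f i).1 * e) & M (- ((f i).2 * e))]) ->
  kahler_wf O M (flatten [seq gauss e y.1 y.2 | y <- [seq f i | i <- r]]).
Proof.
move=> h x /flattenP[t /mapP[y /mapP[i ir ->] ->]].
by have [? ? ? ?] := h _ ir; rewrite !inE => /orP[] /eqP ->.
Qed.

Section Smooth.
Variables (x : {x | smooth_pt a x}) (r : seq (F * F * (F * F))).
Hypothesis wr : wedge_wA a r.
Let P := (val x).2.
Let j := (val x).1.
Local Notation pt := (inr x : Defs.point a).

Lemma gauss_germ_smooth : exists xi l fs,
  let G := flatten [seq gauss (xi ^+ 2 * l ^+ 2) y.1 y.2 | y <- fs] in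
  [/\ is_generator (stO (s:=at_pt pt)) (stw (s:=at_pt pt)) xi,
      is_generator (stO (s:=at_pt pt)) (stA (s:=at_pt pt)) l,
      forall y, y \in fs -> stO (s:=at_pt pt) y.1 /\ stO (s:=at_pt pt) y.2,
      map (germ2 pt) r = [seq (y.1 * xi * l, y.2 * xi * l) | y <- fs]
    & st_wf (p := pt) G /\ wronsk_at (p := pt) G j = gauss_wronsk j r].
Proof.
have d0 := dunif_neq0 P.
have reg y : y \in r -> regular P (component j y.1 / dunif P)
    /\ regular P (component j y.2 / dunif P).
  by move=> /wr [/H0_wAP[_ h1] /H0_wAP[_ h2]]; split; [apply: h1 | apply: h2]; exact: (valP x).
exists (dunif P), 1, [seq (component j y.1 / dunif P, component j y.2 / dunif P) | y <- r].
split.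
- exact: generator_smooth_w.
- exact: generator_smooth_A.
- by move=> y /mapP[z zr ->]; apply: reg.
- rewrite -map_comp; apply: eq_map => y; rewrite /= !mulr1.
  by rewrite /germ2 /=; congr pair; rewrite divfK.
rewrite expr1n mulr1; split.
  rewrite /st_wf stw2_smooth; apply: wf_flatten_gauss => y yr.
  have EM w : regular P w -> regular P (w * dunif P ^+ 2 / dunif P ^+ 2).
    by move=> rw; rewrite (mulfK (expf_neq0 2 d0)).
  have [r1 r2] := reg _ yr; split; [exact: r1 | exact: r2 | exact: EM r1 |].
  rewrite -mulNr; exact: EM (reg_opp (place_local _) r2).
apply: (etrans (sum_flatten_gauss r _ _ (fun w f => w * dfrac f))).
apply: eq_bigr => y _; apply: (wronsk_scale (u := dunif P)) => //; first exact: dfracM.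
  by rewrite /= divfK.
by rewrite /= divfK.
Qed.

End Smooth.

Section Node.
Variables (l : 'I_g.+1) (r : seq (F * F * (F * F))).
Hypothesis wr : wedge_wA a r.
Local Notation P j := (node a j l).
Local Notation pt := (inl l : Defs.point a).

(** The coordinate of a section in the frame (dz1/z1, - dz2/z2) of omega times the frame (h, 1) of
    A; h is its own inverse. *)
Definition node_triv (f : F * F) : F * F :=
  ((hA K l)%:P%:F * log_coef (P 0) f.1, - log_coef (P 1) f.2).

Let loc j := place_local (P j).

Let hA2F : (hA K l)%:P%:F * (hA K l)%:P%:F = 1 :> F.
Proof. by rewrite -tofracM -polyCM hA2 polyC1 tofrac1. Qed.

Lemma log_coef_form Q (f : F) : log_coef Q f * (dunif Q / unif Q) = f.
Proof.
rewrite /log_coef mulrA divfK ?dunif_neq0 //; apply: mulfK; exact: unif_neq0.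
Qed.

Lemma node_triv_O f : H0_wA a f -> node_O a l (node_triv f).
Proof.
move=> /H0_wAP[h _]; have [v h1 h2] := h l.
rewrite -stO_node; exists (- v).
  have -> : - v = hA K l * - (hA K l * v) by rewrite mulrN mulrA hA2 mul1r.
  exact: has_valueZ h1.
exact: has_valueN h2.
Qed.

Lemma node_triv_coef f : H0_wA a f ->
  V 0 l (D 0 l (node_triv f).1) = hA K l * node_coef l 0 f /\
  V 1 l (D 1 l (node_triv f).2) = - node_coef l 1 f.
Proof.
move=> /H0_wAP[h _]; have [v h1 h2] := h l.
have r0 : regular (P 0) (log_coef (P 0) f.1) by exists (- (hA K l * v)).
have r1 : regular (P 1) (log_coef (P 1) f.2) by exists v.
split; rewrite /node_triv /=.
  rewrite (der_cstM (loc 0)) (val_mul (loc 0)); last exact: (reg_der (loc 0)).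
    by rewrite (val_cst (loc 0)).
  exact: (reg_cst (loc 0)).
by rewrite (der_opp (loc 1)) (val_opp (loc 1)) //; exact: (reg_der (loc 1)).
Qed.

(** The two terms [f1 df2] and [- f2 df1] have the same torsion, hence the factor 2. *)
Lemma torsion_gauss (f1 f2 e : F * F) :
  H0_wA a f1 -> H0_wA a f2 -> e.1 = gen2 (P 0) -> e.2 = gen2 (P 1) ->
  torsion a l (node_triv f1 * e) (node_triv f2) +
    torsion a l (- (node_triv f2 * e)) (node_triv f1) =
  2 * hA K l * (node_coef l 0 f1 * node_coef l 1 f2 - node_coef l 0 f2 * node_coef l 1 f1).
Proof.
move=> H1 H2 e1 e2.
have [c10 c11] := node_triv_coef H1; have [c20 c21] := node_triv_coef H2.
have [r10 r11 _] := node_triv_O H1; have [r20 r21 _] := node_triv_O H2.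
have tE f h : torsion a l (f * e) h =
    V 1 l (D 1 l f.2) * V 0 l (D 0 l h.1) - V 0 l (D 0 l f.1) * V 1 l (D 1 l h.2).
  rewrite /torsion /node_torsion -e1 -e2.
  rewrite -[(f * e).1]/(f.1 * e.1) -[(f * e).2]/(f.2 * e.2) !mulfK // ?e1 ?e2;
    exact: gen2_neq0.
have -> : - (node_triv f2 * e) = - node_triv f2 * e by rewrite mulNr.
have o20 : V 0 l (D 0 l (- node_triv f2).1) = - (hA K l * node_coef l 0 f2).
  apply: (etrans (congr1 (V 0 l) (der_opp (loc 0) (node_triv f2).1))).
  by apply: (etrans (val_opp (loc 0) (reg_der (loc 0) r20))); exact: congr1 c20.
have o21 : V 1 l (D 1 l (- node_triv f2).2) = - - node_coef l 1 f2.
  apply: (etrans (congr1 (V 1 l) (der_opp (loc 1) (node_triv f2).2))).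
  by apply: (etrans (val_opp (loc 1) (reg_der (loc 1) r21))); exact: congr1 c21.
have t1 : torsion a l (node_triv f1 * e) (node_triv f2) =
    - node_coef l 1 f1 * (hA K l * node_coef l 0 f2)
    - hA K l * node_coef l 0 f1 * - node_coef l 1 f2.
  apply: (etrans (tE _ _)); congr (_ * _ - _ * _);
    [exact: c11 | exact: c20 | exact: c10 | exact: c21].
have t2 : torsion a l (- node_triv f2 * e) (node_triv f1) =
    - - node_coef l 1 f2 * (hA K l * node_coef l 0 f1)
    - - (hA K l * node_coef l 0 f2) * - node_coef l 1 f1.
  apply: (etrans (tE _ _)); congr (_ * _ - _ * _);
    [exact: o21 | exact: c10 | exact: o20 | exact: c11].
apply: (etrans (congr2 +%R t1 t2)).
by move: (node_coef _ _ _) (node_coef _ _ _) (node_coef _ _ _) (node_coef _ _ _)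
  (hA _ _) => x1 x2 x3 x4 h; ring.
Qed.

Lemma gauss_germ_node : exists xi k fs,
  let G := flatten [seq gauss (xi ^+ 2 * k ^+ 2) y.1 y.2 | y <- fs] in
  [/\ is_generator (stO (s:=at_pt pt)) (stw (s:=at_pt pt)) xi,
      is_generator (stO (s:=at_pt pt)) (stA (s:=at_pt pt)) k,
      forall y, y \in fs -> stO (s:=at_pt pt) y.1 /\ stO (s:=at_pt pt) y.2,
      map (germ2 pt) r = [seq (y.1 * xi * k, y.2 * xi * k) | y <- fs]
    & [/\ st_wf (p := pt) G, forall j, wronsk j G = gauss_wronsk j r
        & \sum_(x <- G) torsion a l x.1 x.2 =
          \sum_(x <- r) 2 * hA K l * (node_coef l 0 x.1 * node_coef l 1 x.2
                                      - node_coef l 0 x.2 * node_coef l 1 x.1)]].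
Proof.
pose xi : F * F := (dunif (P 0) / unif (P 0), - (dunif (P 1) / unif (P 1))).
pose k : F * F := ((hA K l)%:P%:F, 1).
pose e : F * F := xi ^+ 2 * k ^+ 2.
have ee1 : e.1 = gen2 (P 0).
  by rewrite -[e.1]/(xi.1 ^+ 2 * (k.1 * k.1)) hA2F mulr1.
have ee2 : e.2 = gen2 (P 1).
  by rewrite -[e.2]/((- (dunif (P 1) / unif (P 1))) ^+ 2 * 1 ^+ 2) sqrrN expr1n mulr1.
have tr f : f = node_triv f * xi * k.
  have E1 : (node_triv f * xi * k).1 = f.1.
    rewrite -[LHS]/((hA K l)%:P%:F * log_coef (P 0) f.1 * (dunif (P 0) / unif (P 0)) * (hA K l)%:P%:F).
    by apply: (etrans (involution_conj _ _ hA2F)); exact: log_coef_form.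
  have E2 : (node_triv f * xi * k).2 = f.2.
    rewrite -[LHS]/(- log_coef (P 1) f.2 * - (dunif (P 1) / unif (P 1)) * 1).
    by rewrite mulr1 mulrNN log_coef_form.
  by case: f (node_triv f * xi * k) E1 E2 => [? ?] [? ?] /= -> ->.
have rO y : y \in r -> node_O a l (node_triv y.1) /\ node_O a l (node_triv y.2).
  by move=> /wr [h1 h2]; split; apply: node_triv_O.
exists xi, k, [seq (node_triv y.1, node_triv y.2) | y <- r]; split.
- exact: generator_node_w.
- exact: generator_node_A.
- by move=> y /mapP[z zr ->]; rewrite stO_inl; apply: rO.
- rewrite -map_comp; apply: eq_map => y; rewrite /germ2 /=; congr pair; exact: tr.
rewrite -/e; split.
- rewrite /st_wf stw2_node stO_inl; apply: wf_flatten_gauss => y yr.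
  have [r1 r2] := rO _ yr.
  have ME m : node_O a l m -> node_M a l (m * e).
    move=> Om; rewrite /node_M /nodeM -[(m * e).1]/(m.1 * e.1) -[(m * e).2]/(m.2 * e.2).
    by rewrite ee1 ee2 !mulfK ?gen2_neq0.
  split=> //; first exact: ME.
  rewrite -mulNr; apply: ME; case: r2 => [ra rb rc].
  split; [exact: (reg_opp (loc 0))|exact: (reg_opp (loc 1))|].
  rewrite -[(- _).1]/(- (node_triv y.2).1) -[(- _).2]/(- (node_triv y.2).2).
  by rewrite (val_opp (loc 0)) // (val_opp (loc 1)) // rc.
- move=> j; apply: (etrans (sum_flatten_gauss r _ _
    (fun w f => component j w * dfrac (component j f)))).
  apply: eq_bigr => y _.
  have -> : component j (node_triv y.1 * e) = component j (node_triv y.1) * component j e.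
    by rewrite /component; case: ifP.
  have -> : component j (- (node_triv y.2 * e)) = - (component j (node_triv y.2) * component j e).
    by rewrite /component; case: ifP.
  have tj f : component j f = component j (node_triv f) * (component j xi * component j k).
    by rewrite mulrA [in LHS](tr f) /component; case: ifP.
  apply: (wronsk_scale (d := @dfrac K)); [exact: dfracM|exact: tj|exact: tj|].
  by rewrite exprMn /component; case: ifP.
apply: (etrans (sum_flatten_gauss r _ _ (torsion a l))).
apply: eq_big_seq => y /wr [h1 h2].
by rewrite torsion_gauss.
Qed.

End Node.
End GaussGerms.

Section GaussianSurjective.
Variables (K : closedFieldType) (g : nat) (a : 'M[K]_(2, g.-1)).
Hypothesis hg : (1 < g)%N.
Hypothesis two_neq0 : 2 != 0 :> K.
Hypothesis adm : admissible a.
Local Notation F := (ratfun K).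
Local Notation n := g.-1.
Local Notation am := (fun_of_matrix a).
Local Notation mn := (@minus_node g).

Definition scale_pair (x : K) (f : F * F) : F * F := (x%:P%:F * f.1, x%:P%:F * f.2).

Lemma component_scale j x f : component j (scale_pair x f) = x%:P%:F * component j f.
Proof. by rewrite /component; case: ifP. Qed.

Lemma H0_scale x f : H0_wA a f -> H0_wA a (scale_pair x f).
Proof.
move=> /H0_wAP[h1 h2]; apply/H0_wAP; split=> [l|y sy].
  have [r r1 r2] := h1 l; exists (x * r); last exact: has_residueZ.
  by rewrite mulrCA -mulrN; exact: has_residueZ.
by rewrite component_scale; apply: regularZ; apply: h2.
Qed.

Lemma node_coef_scale l j x f : H0_wA a f ->
  node_coef a l j (scale_pair x f) = x * node_coef a l j f.
Proof.
move=> /H0_wAP[h _]; have loc := place_local (node a j l); have rx := reg_cst loc x.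
have rf : regular (node a j l) (log_coef (node a j l) (component j f)).
  have [r r1 r2] := h l.
  by have [->|->] := ord2P j; [exists (- (hA K l * r)) | exists r].
rewrite /node_coef component_scale.
have -> : log_coef (node a j l) (x%:P%:F * component j f)
    = x%:P%:F * log_coef (node a j l) (component j f) by rewrite /log_coef !mulrA.
rewrite (der_cstM loc) (val_mul loc rx (reg_der loc rf)).
by congr (_ * _); exact: (val_cst loc).
Qed.

Definition wedge_of (X : 'M[K]_n) : seq (F * F * (F * F)) :=
  [seq (scale_pair (X p.1 p.2) (sec a p.1), sec a p.2) | p <- index_enum ('I_n * 'I_n)%type].

Lemma wedge_ofP X : wedge_wA a (wedge_of X).
Proof.
by move=> x /mapP[p _ ->]; split; [apply: H0_scale|]; apply: sec_H0.
Qed.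

Lemma wronsk_const (L : fieldType) (d : L -> L) (c s1 s2 : L) :
  (forall x y, d (x * y) = d x * y + x * d y) -> d c = 0 ->
  c * s1 * d s2 - s2 * d (c * s1) = c * (s1 * d s2 - s2 * d s1).
Proof. by move=> dM dc; rewrite dM dc; ring. Qed.

Lemma wronsk_local (L : fieldType) (d : L -> L) (z s1 s2 : L) :
  (forall x y, d (x * y) = d x * y + x * d y) ->
  (s1 * d s2 - s2 * d s1) * z ^+ 2 = s1 * z * d (s2 * z) - s2 * z * d (s1 * z).
Proof. by move=> dM; rewrite !dM; ring. Qed.

Lemma wedge_form_pair (f h : 'I_n -> K) (X : 'M[K]_n) :
  wedge_form f h X = \sum_(p : 'I_n * 'I_n) X p.1 p.2 * (f p.1 * h p.2 - f p.2 * h p.1).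
Proof. by rewrite /wedge_form pair_bigA. Qed.

(** A section is [f dz/z] with [f] regular, and the Wronskian of [f/z], [h/z] is
    [z^-2 (f h' - h f')]. The derivative of [f h' - h f'] is [f h'' - h f''], and the second
    derivatives are twice [quad_coef]. *)
Lemma wedge_wronsk j l X :
  let E := gauss_wronsk j (wedge_of X) * unif (Some (a j l)) ^+ 2 in
  place_val (Some (a j l)) E =
    wedge_form (res_coef K mn j l) (lin_coef am mn j l) X /\
  place_val (Some (a j l)) (place_der (Some (a j l)) E) =
    2 * wedge_form (res_coef K mn j l) (quad_coef am mn j l) X.
Proof.
set P := Some (a j l); have loc := place_local P; move=> E.
pose f i := log_coef P (component j (sec a i)).
have dE (x : F) : place_der P x = dfrac x by rewrite /place_der /dunif divr1.
have dM := der_mul loc.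
have S i := sec_coef_fin adm j l i.
pose t (p : 'I_n * 'I_n) := f p.1 * place_der P (f p.2) - f p.2 * place_der P (f p.1).
have -> : E = \sum_p (X p.1 p.2)%:P%:F * t p.
  rewrite /E /gauss_wronsk /wedge_of big_map mulr_suml; apply: eq_bigr => p _.
  rewrite component_scale (wronsk_const _ _ (@dfracM K) (dfracC _)) -mulrA; congr (_ * _).
  rewrite /t /f /log_coef /dunif !divr1 !dE; exact: wronsk_local (@dfracM K).
have W p : [/\ regular P (t p),
    place_val P (t p) = place_val P (f p.1) * place_val P (place_der P (f p.2))
      - place_val P (f p.2) * place_val P (place_der P (f p.1)) &
    place_val P (place_der P (t p)) =
      place_val P (f p.1) * place_val P (place_der P (place_der P (f p.2)))
      - place_val P (f p.2) * place_val P (place_der P (place_der P (f p.1)))].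
  by apply: (val_wronsk loc); [case: (S p.1) | case: (S p.2)].
have rt p : regular P (t p) by case: (W p).
have [_ e1 e2] := val_lin loc (fun p => X p.1 p.2) rt.
rewrite !wedge_form_pair; split.
  apply: (etrans e1); apply: eq_bigr => p _; congr (_ * _).
  have [_ w _] := W p; apply: (etrans w).
  have [_ s1 s1' _] := S p.1; have [_ s2 s2' _] := S p.2.
  by congr (_ * _ - _ * _); [exact: s1 | exact: s2' | exact: s2 | exact: s1'].
apply: (etrans e2); rewrite mulr_sumr; apply: eq_bigr => p _; rewrite [RHS]mulrCA; congr (_ * _).
have [_ _ w] := W p; apply: (etrans w).
have [_ s1 _ s1'] := S p.1; have [_ s2 _ s2'] := S p.2.
transitivity (res_coef K mn j l p.1 * (2 * quad_coef am mn j l p.2)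
            - res_coef K mn j l p.2 * (2 * quad_coef am mn j l p.1)).
  by congr (_ * _ - _ * _); [exact: s1 | exact: s2' | exact: s2 | exact: s1'].
by rewrite mulrBr; congr (_ - _); rewrite mulrCA.
Qed.

(** The sign [e] absorbs the -1 by which [zero_coef] and [inf_coef] differ from the true Taylor
    coefficients; it enters squared. *)
Lemma wedge_torsion l X (f h : 'I_n -> K) (e : K) : e * e = 1 ->
  (forall i, node_coef a l 0 (sec a i) = e * f i) ->
  (forall i, node_coef a l 1 (sec a i) = e * h i) ->
  \sum_(x <- wedge_of X) 2 * hA K l * (node_coef a l 0 x.1 * node_coef a l 1 x.2
     - node_coef a l 0 x.2 * node_coef a l 1 x.1) = 2 * hA K l * wedge_form f h X.
Proof.
move=> ee cf ch; rewrite /wedge_of big_map wedge_form_pair mulr_sumr.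
apply: eq_bigr => p _; have H i := sec_H0 adm i.
rewrite !node_coef_scale // !cf !ch; congr (_ * _).
transitivity (e * e * (X p.1 p.2 * (f p.1 * h p.2 - f p.2 * h p.1))); first by ring.
by rewrite ee mul1r.
Qed.

Lemma hA_neq0 (l : 'I_g.+1) : hA K l != 0.
Proof. by rewrite /hA; case: ifP; rewrite ?oppr_eq0 oner_neq0. Qed.

Lemma regular_sub P (f h : F) : regular P f -> regular P h -> regular P (f - h).
Proof.
move=> rf rh; apply: (reg_add (place_local P)) => //.
exact: (reg_opp (place_local P)).
Qed.

Theorem gauss_coord_surj_gaussian i0 : gauss_coord_surj am mn i0 -> gaussian_map_surjective a.
Proof.
move=> surj s Hs; have [W HW] := global_wronsk Hs.
pose tau l := \sum_(x <- s (inl l : Defs.point a)) torsion a l x.1 x.2.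
pose t l := tau l / (2 * hA K l).
pose q j l := W j * unif (Some (a j l)) ^+ 2.
pose v j l := place_val (Some (a j l)) (q j l).
pose w j l := place_val (Some (a j l)) (place_der (Some (a j l)) (q j l)) / 2.
(* All coordinates are prescribed at once, after removing the factor 2 of [wedge_wronsk] in [w] and
   the factor [2 * hA K l] of [wedge_torsion] in [t]. *)
have [X HX] := surj (fun l m => match val m with
  | 0 => v 0 l
  | 1 => if l == i0 then t (zero_node g) else w 0 l
  | 2 => v 1 l
  | 3 => if l == i0 then t ord_max else w 1 l
  | _ => t (fin_node l) end).
pose r := wedge_of X; have wr : wedge_wA a r := @wedge_ofP X.
have wfs p : st_wf (s p) by case: (Hs p).
have Rs j l : regular (node a j l) (W j * unif (node a j l) ^+ 2 / dunif (node a j l) ^+ 3).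
  by rewrite -(HW (inl l) j) //; exact: wronsk_node_regular (wfs (inl l)).
have Rg j l : regular (node a j l)
    (gauss_wronsk j r * unif (node a j l) ^+ 2 / dunif (node a j l) ^+ 3).
  have [xi [k [fs [_ _ _ _ [G1 G2 _]]]]] := gauss_germ_node l wr.
  by rewrite -(G2 j); exact: wronsk_node_regular G1.
have Rfs j l : regular (Some (a j l)) (q j l).
  by have := Rs j (fin_node l); rewrite node_fin // /dunif expr1n divr1.
have Rfg j l : regular (Some (a j l)) (gauss_wronsk j r * unif (Some (a j l)) ^+ 2).
  by have := Rg j (fin_node l); rewrite node_fin // /dunif expr1n divr1.
have val_sub (P : option K) f h : regular P f -> regular P h ->
    place_val P (f - h) = place_val P f - place_val P h.
  move=> rf rh; rewrite (val_add (place_local P) rf (reg_opp (place_local P) rh)).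
  by rewrite (val_opp (place_local P) rh).
have X0 l := HX l (@Ordinal 5 0 isT); have X1 l := HX l (@Ordinal 5 1 isT).
have X2 l := HX l (@Ordinal 5 2 isT); have X3 l := HX l (@Ordinal 5 3 isT).
have X4 l := HX l (@Ordinal 5 4 isT).
rewrite /gauss_coord /gauss_pair /= in X0 X1 X2 X3 X4.
(* The difference of the two cubic differentials has lost enough poles for [wronsk_eq0]. *)
have WE j : W j = gauss_wronsk j r.
  apply/eqP; rewrite -subr_eq0; apply/eqP.
  apply: (wronsk_eq0 (a := a) hg adm (j := j) (i0 := i0)).
  - move=> P HP; rewrite mulrBl; pose x := exist (smooth_pt a) (j, P) (introT forallP HP).
    apply: regular_sub.
      rewrite -(HW (inr x) j) //; exact: (@wronsk_smooth_regular _ _ _ x _ (wfs (inr x))).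
    have [xi [l [fs [_ _ _ _ [G1 G2]]]]] := gauss_germ_smooth x wr.
    by rewrite -[gauss_wronsk j r]G2; exact: wronsk_smooth_regular G1.
  - move=> l; rewrite mulrBl mulrBl; apply: regular_sub; [exact: Rs | exact: Rg].
  - move=> l; have [e1 _] := wedge_wronsk j l X.
    rewrite mulrBl (val_sub _ _ _ (Rfs j l) (Rfg j l)); apply/eqP; rewrite subr_eq0; apply/eqP.
    apply: etrans (esym e1); have [->|->] := ord2P j; first exact: esym (X0 l).
    exact: esym (X2 l).
  move=> l li0; have [_ e1] := wedge_wronsk j l X; have loc := place_local (Some (a j l)).
  have rd := reg_der loc.
  rewrite mulrBl (der_add loc) (der_opp loc) (val_sub _ _ _ (rd _ (Rfs j l)) (rd _ (Rfg j l))).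
  apply/eqP; rewrite subr_eq0; apply/eqP; apply: etrans (esym e1).
  have -> : wedge_form (res_coef K mn j l) (quad_coef am mn j l) X = w j l.
    by have [->|->] := ord2P j; [have := X1 l | have := X3 l]; rewrite (negPf li0).
  by rewrite /w mulrC divfK.
have tE l : 2 * hA K l * t l = tau l.
  by rewrite mulrC divfK // mulf_neq0 // hA_neq0.
have TE l : tau l = \sum_(x <- r) 2 * hA K l * (node_coef a l 0 x.1 * node_coef a l 1 x.2
     - node_coef a l 0 x.2 * node_coef a l 1 x.1).
  move: l; apply: (node_ind hg) => [l||].
  - rewrite (wedge_torsion (e := 1) X (f := lin_coef am mn 0 l) (h := lin_coef am mn 1 l)).
    + by rewrite -tE X4.
    + by rewrite mulr1.
    + by move=> i; rewrite mul1r /node_coef node_fin //; case: (sec_coef_fin adm 0 l i).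
    + by move=> i; rewrite mul1r /node_coef node_fin //; case: (sec_coef_fin adm 1 l i).
  - rewrite (wedge_torsion (e := -1) X (f := zero_coef am mn 0) (h := zero_coef am mn 1)).
    + by rewrite -tE; have := X1 i0; rewrite eqxx => ->.
    + by rewrite mulrNN mulr1.
    + by move=> i; rewrite mulN1r /node_coef node_zero //; case: (sec_coef_zero adm 0 i).
    + by move=> i; rewrite mulN1r /node_coef node_zero //; case: (sec_coef_zero adm 1 i).
  rewrite (wedge_torsion (e := -1) X (f := inf_coef am mn 0) (h := inf_coef am mn 1)).
  + by rewrite -tE; have := X3 i0; rewrite eqxx => ->.
  + by rewrite mulrNN mulr1.
  + by move=> i; rewrite mulN1r /node_coef node_inf //; case: (sec_coef_inf adm 0 i).
  + by move=> i; rewrite mulN1r /node_coef node_inf //; case: (sec_coef_inf adm 1 i).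
exists r => // -[l|x].
  have [xi [k [fs [g1 g2 g3 g4 [G1 G2 G3]]]]] := gauss_germ_node l wr.
  exists xi, k, fs; split=> //; apply: st_eq_node => //.
  - by rewrite G2 -WE; apply: (HW (inl l)).
  - by rewrite G2 -WE; apply: (HW (inl l)).
  by rewrite [RHS]G3; exact: TE.
have [xi [k [fs [g1 g2 g3 g4 [G1 G2]]]]] := gauss_germ_smooth x wr.
exists xi, k, fs; split=> //; apply: st_eq_smooth => //.
rewrite [RHS]G2 -WE; exact: (HW (inr x)).
Qed.

End GaussianSurjective.

(** * Adding a general node *)

Section WedgeForm.
Variables (K : fieldType) (n : nat).
Implicit Types (f h : 'I_n -> K) (X Y : 'M[K]_n).

Lemma wedge_formD f h X Y : wedge_form f h (X + Y) = wedge_form f h X + wedge_form f h Y.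
Proof.
rewrite -big_split; apply: eq_bigr => i _; rewrite -big_split; apply: eq_bigr => k _.
by rewrite mxE mulrDl.
Qed.

Lemma wedge_formZ f h c X : wedge_form f h (c *: X) = c * wedge_form f h X.
Proof.
rewrite mulr_sumr; apply: eq_bigr => i _; rewrite mulr_sumr; apply: eq_bigr => k _.
by rewrite mxE mulrA.
Qed.

Lemma wedge_form_antisym f h X :
  wedge_form f h X = \sum_i f i * \sum_k (X i k - X k i) * h k.
Proof.
rewrite /wedge_form; transitivity (\sum_i \sum_k X i k * (f i * h k)
    - \sum_k \sum_i X i k * (f k * h i)).
  rewrite [X in _ - X]exchange_big /= -sumrB; apply: eq_bigr => i _.
  by rewrite -sumrB; apply: eq_bigr => k _; rewrite mulrBr.
rewrite -sumrB; apply: eq_bigr => i _; rewrite -sumrB mulr_sumr; apply: eq_bigr => k _.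
by ring.
Qed.

Lemma nonzero_solution (I J : finType) (M : I -> J -> K) : (#|J| < #|I|)%N ->
  exists2 x : I -> K, exists i, x i != 0 & forall j, \sum_i x i * M i j = 0.
Proof.
move=> lt; pose A : 'M[K]_(#|I|, #|J|) := \matrix_(i, j) M (enum_val i) (enum_val j).
have : kermx A != 0.
  rewrite -mxrank_eq0 mxrank_ker subn_eq0 -ltnNge.
  exact: leq_ltn_trans (rank_leq_col A) lt.
move=> /rowV0Pn[u /sub_kermxP uA u0].
exists (fun i => u 0 (enum_rank i)).
  have /rV0Pn[i ui] := u0; exists (enum_val i); by rewrite enum_valK.
move=> j; have := congr1 (fun B : 'rV_ _ => B 0 (enum_rank j)) uA; rewrite !mxE; apply: etrans.
rewrite (reindex (@enum_val I I)) /=; last first.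
  by exists enum_rank => i _; rewrite ?enum_rankK ?enum_valK.
by apply: eq_bigr => i _; rewrite mxE enum_valK enum_rankK.
Qed.

Lemma card_ltn_pairs : #|[pred p : 'I_n * 'I_n | (p.1 < p.2)%N]| = 'C(n, 2).
Proof.
rewrite -sum1_card -(pair_big_dep xpredT (fun i k : 'I_n => (i < k)%N) (fun _ _ => 1%N)) /=.
rewrite (exchange_big_dep xpredT) //= -bin2_sum big_mkord; apply: eq_bigr => k _.
rewrite (big_ord_narrow_cond (P := xpredT) (ltnW (ltn_ord k))) /=.
by rewrite sum_nat_const card_ord muln1.
Qed.

(** The unknowns are the entries above the diagonal only, so a nonzero solution is still nonzero as
    an alternating form. *)
Lemma antisym_solution (J : finType) (F : J -> ('I_n -> K) * ('I_n -> K)) :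
  (#|J| < 'C(n, 2))%N ->
  exists2 X : 'M[K]_n, exists i k, X i k - X k i != 0
    & forall j, wedge_form (F j).1 (F j).2 X = 0.
Proof.
rewrite -card_ltn_pairs => lt.
pose A := [pred p : 'I_n * 'I_n | (p.1 < p.2)%N].
have [|x [[[i k] ik] xi] xM] := @nonzero_solution {p in A} J
  (fun p j => (F j).1 (val p).1 * (F j).2 (val p).2
              - (F j).1 (val p).2 * (F j).2 (val p).1).
  by rewrite card_sig.
pose y (p : 'I_n * 'I_n) : K := if insub p is Some q then x q else 0.
have yE p (pA : p \in A) : y p = x (exist _ p pA).
  by rewrite /y insubT; congr x; apply: val_inj.
have y0 p : p \notin A -> y p = 0 by move=> pA; rewrite /y insubF //; apply/negbTE.
exists (\matrix_(i, k) y (i, k)).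
  exists i, k; rewrite !mxE yE y0 ?subr0 //.
  by have := ik; rewrite !inE /= -leqNgt => /ltnW.
move=> j; rewrite -[RHS](xM j) /wedge_form pair_bigA /= (bigID (mem A)) /= addrC.
rewrite big1 ?add0r; last by move=> [r t] rA; rewrite mxE y0 ?mul0r.
rewrite big_sub; apply: eq_bigr => -[[r t] rt] _ /=.
by rewrite mxE yE.
Qed.

End WedgeForm.

Section CofinitelyMany.
Variable K : closedFieldType.

(** A general pair of points is expressed by nesting: for almost all [y], for almost all [x]. This
    keeps every genericity argument in one variable. *)
Definition cofinitely (P : K -> Prop) : Prop := exists s : seq K, forall c, c \notin s -> P c.

Lemma cofinitely_and P Q : cofinitely P -> cofinitely Q -> cofinitely (fun c => P c /\ Q c).
Proof.
move=> [s Ps] [t Qt]; exists (s ++ t) => c; rewrite mem_cat negb_or => /andP[cs ct].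
by split; [apply: Ps | apply: Qt].
Qed.

Lemma cofinitely_imp (P Q : K -> Prop) : (forall c, P c -> Q c) -> cofinitely P -> cofinitely Q.
Proof. by move=> PQ [s Ps]; exists s => c /Ps /PQ. Qed.

Lemma cofinitely_ex P : cofinitely P -> exists c, P c.
Proof. by move=> [s Ps]; have [c /Ps] := exists_notin s; exists c. Qed.

Lemma cofinitely_neq (T : finType) (f : T -> K) : cofinitely (fun c => forall i, c != f i).
Proof.
by exists [seq f i | i : T] => c cf i; apply: contraNneq cf => ->; apply: map_f; rewrite mem_enum.
Qed.

Lemma cofinitely_horner (p : {poly K}) b : p.[b] != 0 -> cofinitely (fun c => p.[c] != 0).
Proof.
move=> pb; have p0 : p != 0 by apply: contraNneq pb => ->; rewrite horner0.
have [s es] := closed_field_poly_normal p; exists s => c cs.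
by rewrite es hornerZ mulf_neq0 ?lead_coef_eq0 // -[_ == 0]/(root _ _) root_prod_XsubC.
Qed.

End CofinitelyMany.

(** * General position of the new pair of points *)

Section NewNode.
Variables (K : closedFieldType) (n : nat) (a : 'I_2 -> 'I_n -> K) (m : 'I_n -> bool).
Hypothesis adm : forall j, (forall i, a j i != 0) /\ injective (a j).

(** Value and derivative of an old section at [x]. Multiplied by a local equation of a node at [x],
    the section has Taylor coefficients 0, [sec_val], [sec_der], so these are its [lin_coef] and
    [quad_coef] at the new node. *)
Definition sec_val j x i : K := sec_sign K m j i * ((x - a j i)^-1 - (m i)%:R / x).
Definition sec_der j x i : K :=
  sec_sign K m j i * ((m i)%:R * (x ^+ 2)^-1 - ((x - a j i) ^+ 2)^-1).

Lemma sec_sign_neq0 j i : sec_sign K m j i != 0.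
Proof. by rewrite /sec_sign; case: ifP; rewrite ?oppr_eq0 oner_neq0. Qed.

(** The combination has a genuine pole at [a j i]. With denominators cleared, every term but the
    i-th vanishes there. *)
Lemma sec_val_generic j (c : 'I_n -> K) i : c i != 0 ->
  cofinitely (fun x => \sum_k c k * sec_val j x k != 0).
Proof.
move=> ci; have [nz inj] := adm j.
pose N k : {poly K} := \prod_(l | l != k) ('X - (a j l)%:P).
pose q : {poly K} := \sum_k (c k * sec_sign K m j k) *:
  ('X * N k - (m k)%:R *: (('X - (a j k)%:P) * N k)).
have hN k x : (N k).[x] = \prod_(l | l != k) (x - a j l).
  by rewrite horner_prod; apply: eq_bigr => l _; rewrite !hornerE.
have hq x : q.[x] = \sum_k (c k * sec_sign K m j k) *
    (x * (N k).[x] - (m k)%:R * ((x - a j k) * (N k).[x])).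
  by rewrite horner_sum; apply: eq_bigr => k _; rewrite !hornerE.
have qi : q.[a j i] != 0.
  rewrite hq (bigD1 i) //= big1 ?addr0 => [|k ki].
    rewrite subrr mul0r mulr0 subr0 !mulf_neq0 ?sec_sign_neq0 //.
    rewrite hN; apply/prodf_neq0 => l li.
    by rewrite subr_eq0 (inj_eq inj) eq_sym.
  by rewrite hN (bigD1 i) 1?eq_sym //= subrr mul0r !mulr0 subrr mulr0.
apply: cofinitely_imp (cofinitely_and (cofinitely_horner qi)
  (cofinitely_and (cofinitely_neq (a j)) (cofinitely_neq (fun _ : 'I_1 => 0)))).
move=> x [qx [xa x0]]; have {}x0 := x0 ord0; apply: contraNneq qx => e; rewrite hq.
apply/eqP; transitivity ((\sum_k c k * sec_val j x k) * (x * \prod_l (x - a j l))); last first.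
  by rewrite e mul0r.
rewrite mulr_suml; apply: eq_bigr => k _.
have -> : \prod_l (x - a j l) = (x - a j k) * (N k).[x] by rewrite hN (bigD1 k).
have : x - a j k != 0 by rewrite subr_eq0.
rewrite /sec_val; move: (x - a j k) (N k).[x] => y p y0.
by field; rewrite x0 y0.
Qed.

(** [sec_val_generic] is used twice: contracting the antisymmetric part of [X] with the values at a
    general [y] leaves a vector with nonzero i-th entry, which a general [x] does not annihilate. *)
Lemma wedge_generic (X : 'M[K]_n) i k : X i k - X k i != 0 ->
  cofinitely (fun y => cofinitely (fun x =>
    wedge_form (sec_val 0 x) (sec_val 1 y) X != 0)).
Proof.
move=> Xik; apply: cofinitely_imp (@sec_val_generic 1
  ( fun l => X i l - X l i) k Xik) => y ny.
apply: cofinitely_imp (@sec_val_generic 0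
  ( fun i => \sum_l (X i l - X l i) * sec_val 1 y l) i ny) => x.
by rewrite wedge_form_antisym; under eq_bigr do rewrite mulrC.
Qed.

Lemma cofinitely_det r (A : 'M[{poly K}]_r) b :
  \det (map_mx (horner_eval b) A) != 0 ->
  cofinitely (fun c => \det (map_mx (horner_eval c) A) != 0).
Proof.
rewrite det_map_mx => nb; apply: cofinitely_imp (cofinitely_horner nb) => c.
by rewrite det_map_mx.
Qed.

(* [four_nodes p] makes the sections at the four nodes [p t] separate the 1-jets
   on both components at a general pair of points. *)
Definition four_nodes (p : 'I_4 -> 'I_n) : Prop :=
  [/\ injective p, forall t, m (p t) = false &
    let al t := a 0 (p t) in let be t := a 1 (p t) in
    (be 1 - be 2%:R) * (al 0 - al 3%:R) != (be 1 - be 3%:R) * (al 0 - al 2%:R)].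

Section Jets.
Variable p : 'I_4 -> 'I_n.
Hypothesis hp : four_nodes p.
Let al t := a 0 (p t).
Let be t := a 1 (p t).

(** The jets 1/X, 1/X^2, 1/Y, 1/Y^2 of simple poles, multiplied by X^2 Y^2; signs are restored in
    [jets_surjective]. *)
Definition jet_entry (R : comNzRingType) (X Y : R) (s : 'I_4) : R :=
  match val s with
  | 0 => X * Y ^+ 2 | 1 => Y ^+ 2 | 2 => X ^+ 2 * Y | _ => X ^+ 2
  end.

Definition jet_matrix x y : 'M[K]_4 := \matrix_(s, t) jet_entry (x - al t) (y - be t) s.

Let p_inj : injective p. Proof. by case: hp. Qed.

Let al_neq s t : s != t -> al s - al t != 0.
Proof.
have [_ inj] := adm 0.
by move=> st; rewrite subr_eq0 /al (inj_eq inj) (inj_eq p_inj).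
Qed.

Let be_neq s t : s != t -> be s - be t != 0.
Proof.
have [_ inj] := adm 1.
by move=> st; rewrite subr_eq0 /be (inj_eq inj) (inj_eq p_inj).
Qed.

(** At this point column 0 is zero outside row 1 and column 1 outside row 3. What remains is the
    minor of rows 0, 2 and columns 2, 3, which up to nonzero factors is the difference excluded by
    [four_nodes]. *)
Lemma jet_matrix_special : \det (jet_matrix (al 0) (be 1)) != 0.
Proof.
have [_ _ hne] := hp.
apply/negP => /det0P[v v0 vA]; case/negP: v0; apply/eqP/rowP => s; rewrite mxE.
have E t : \sum_s v 0 s * jet_entry (al 0 - al t) (be 1 - be t) s = 0.
  have := congr1 (fun B : 'rV_4 => B 0 t) vA; rewrite !mxE; apply: etrans.
  by apply: eq_bigr => s' _; rewrite mxE.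
have {}E t : v 0 0 * ((al 0 - al t) * (be 1 - be t) ^+ 2) + v 0 1 * (be 1 - be t) ^+ 2
  + v 0 2%:R * ((al 0 - al t) ^+ 2 * (be 1 - be t)) + v 0 3%:R * (al 0 - al t) ^+ 2 = 0.
  by rewrite -[RHS](E t) !big_ord_recr big_ord0 /= add0r; congr (_ + _ + _ + _);
    rewrite /jet_entry /=; congr (v 0 _ * _); apply: val_inj.
have v1 : v 0 1 = 0.
  have := E 0; rewrite subrr mul0r expr0n /= mul0r !mulr0 !addr0 add0r => /eqP.
  by rewrite mulf_eq0 expf_eq0 /= (negPf (be_neq _)) // orbF => /eqP.
have v3 : v 0 3%:R = 0.
  have := E 1; rewrite subrr expr0n /= !mulr0 !add0r => /eqP.
  by rewrite mulf_eq0 expf_eq0 /= (negPf (al_neq _)) // orbF => /eqP.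
have E2 t : t != 0 -> t != 1 -> v 0 0 * (be 1 - be t) + v 0 2%:R * (al 0 - al t) = 0.
  move=> t0 t1; have x0 : al 0 - al t != 0 by apply: al_neq; rewrite eq_sym.
  have y0 : be 1 - be t != 0 by apply: be_neq; rewrite eq_sym.
  apply: (mulfI (mulf_neq0 x0 y0)); rewrite mulr0 -[RHS](E t) v1 v3; ring.
have e2 := E2 2%:R isT isT; have e3 := E2 3%:R isT isT.
have v0 : v 0 0 = 0.
  have : v 0 0 * ((be 1 - be 2%:R) * (al 0 - al 3%:R) - (be 1 - be 3%:R) * (al 0 - al 2%:R)) = 0.
    transitivity ((v 0 0 * (be 1 - be 2%:R) + v 0 2%:R * (al 0 - al 2%:R)) * (al 0 - al 3%:R)
      - (v 0 0 * (be 1 - be 3%:R) + v 0 2%:R * (al 0 - al 3%:R)) * (al 0 - al 2%:R)).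
      by ring.
    by rewrite e2 e3 !mul0r subrr.
  by move/eqP; rewrite mulf_eq0 subr_eq0 (negPf hne) orbF => /eqP.
have v2 : v 0 2%:R = 0.
  move/eqP: e2; rewrite v0 mul0r add0r mulf_eq0 (negPf (al_neq _)) // orbF.
  by move/eqP.
case: s => -[|[|[|[|//]]]] i.
- by rewrite -[RHS]v0; congr (v 0 _); apply: val_inj.
- by rewrite -[RHS]v1; congr (v 0 _); apply: val_inj.
- by rewrite -[RHS]v2; congr (v 0 _); apply: val_inj.
- by rewrite -[RHS]v3; congr (v 0 _); apply: val_inj.
Qed.

Lemma jet_entry_morph (R S : comNzRingType) (f : {rmorphism R -> S}) X Y s :
  f (jet_entry X Y s) = jet_entry (f X) (f Y) s.
Proof. by rewrite /jet_entry; case: (val s) => [|[|[|?]]]; rewrite ?rmorphM ?rmorphXn. Qed.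

Lemma jet_matrix_generic :
  cofinitely (fun y => cofinitely (fun x => \det (jet_matrix x y) != 0)).
Proof.
have hX (c b : K) : horner_eval c ('X - b%:P) = c - b by rewrite /horner_eval !hornerE.
have hC (c b : K) : horner_eval c b%:P = b by rewrite /horner_eval hornerC.
pose A : 'M[{poly K}]_4 := \matrix_(s, t) jet_entry ((al 0 - al t)%:P) ('X - (be t)%:P) s.
have eA y : map_mx (horner_eval y) A = jet_matrix (al 0) y.
  by apply/matrixP => s t; rewrite !mxE [LHS]jet_entry_morph /= hX hC.
have := jet_matrix_special; rewrite -eA => /cofinitely_det.
apply: cofinitely_imp => y; rewrite eA.
pose B : 'M[{poly K}]_4 := \matrix_(s, t) jet_entry ('X - (al t)%:P) ((y - be t)%:P) s.
have eB x : map_mx (horner_eval x) B = jet_matrix x y.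
  by apply/matrixP => s t; rewrite !mxE [LHS]jet_entry_morph /= hX hC.
rewrite -eB => /cofinitely_det; apply: cofinitely_imp => x.
by rewrite eB.
Qed.

Lemma jets_surjective x y : \det (jet_matrix x y) != 0 ->
  (forall i, x != a 0 i) -> (forall i, y != a 1 i) ->
  forall c0 c1 c2 c3 : K, exists v : 'I_n -> K,
    [/\ \sum_i v i * sec_val 0 x i = c0, \sum_i v i * sec_der 0 x i = c1,
        \sum_i v i * sec_val 1 y i = c2 & \sum_i v i * sec_der 1 y i = c3].
Proof.
move=> dJ xa ya c0 c1 c2 c3; have [_ hm _] := hp.
(* The derivative of 1/X is -1/X^2, and on the second component [sec_sign] is -1 at these four
   nodes: the signs are +, -, -, +. *)
pose c : 'cV[K]_4 := \col_s match val s with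
  | 0 => c0 | 1 => - c1 | 2 => - c2 | _ => c3 end.
have uJ : jet_matrix x y \in unitmx by rewrite unitmxE unitfE.
pose w := invmx (jet_matrix x y) *m c.
have Jw s : \sum_t jet_entry (x - al t) (y - be t) s * w t 0 = c s 0.
  have := congr1 (fun B : 'cV_4 => B s 0) (mulKVmx uJ c); rewrite [LHS]mxE => <-.
  by apply: eq_bigr => t _; rewrite !mxE.
(* Undoes the clearing of denominators, column by column. *)
pose u t := w t 0 * ((x - al t) ^+ 2 * (y - be t) ^+ 2).
exists (fun i => \sum_t (p t == i)%:R * u t).
have S (f : 'I_n -> K) : \sum_i (\sum_t (p t == i)%:R * u t) * f i = \sum_t u t * f (p t).
  under eq_bigr do rewrite mulr_suml; rewrite exchange_big; apply: eq_bigr => t _.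
  rewrite (bigD1 (p t)) //= eqxx mul1r big1 ?addr0 // => i ip.
  by rewrite eq_sym (negPf ip) !mul0r.
have J0 := Jw 0; have J1 := Jw 1; have J2 := Jw 2%:R; have J3 := Jw 3%:R.
rewrite !mxE /jet_entry /= in J0 J1 J2 J3.
have X0 t : x - al t != 0 by rewrite subr_eq0; exact: xa.
have Y0 t : y - be t != 0 by rewrite subr_eq0; exact: ya.
rewrite !S; split.
- rewrite -J0; apply: eq_bigr => t _.
  rewrite /u /sec_val /sec_sign hm /= -/(al t) mul0r subr0.
  by move: (x - al t) (X0 t) => X X1; field.
- rewrite -[RHS]opprK -J1 -sumrN; apply: eq_bigr => t _.
  rewrite /u /sec_der /sec_sign hm /= -/(al t) mul0r sub0r.
  by move: (x - al t) (X0 t) => X X1; field.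
- rewrite -[RHS]opprK -J2 -sumrN; apply: eq_bigr => t _.
  rewrite /u /sec_val /sec_sign hm /= -/(be t) mul0r subr0.
  by move: (y - be t) (Y0 t) => Y Y1; field.
rewrite -J3; apply: eq_bigr => t _.
rewrite /u /sec_der /sec_sign hm /= -/(be t) mul0r sub0r.
by move: (y - be t) (Y0 t) => Y Y1; field.
Qed.

End Jets.
End NewNode.

(** * The induction step *)

Section InsertNode.
Variables (K : closedFieldType) (n : nat) (h : 'I_n.+1).

Definition insert_node (x y : K) (a : 'I_2 -> 'I_n -> K) (j : 'I_2) (i : 'I_n.+1) : K :=
  if unlift h i is Some i' then a j i' else if j == 0 then x else y.

Definition extend_mx (X : 'M[K]_n) : 'M[K]_n.+1 := \matrix_(i, k)
  if (unlift h i, unlift h k) is (Some i', Some k') then X i' k' else 0.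

(** Encodes the wedge of the new section with the combination [v] of the old ones. *)
Definition row_at_mx (v : 'I_n -> K) : 'M[K]_n.+1 := \matrix_(i, k)
  if (unlift h i, unlift h k) is (None, Some k') then v k' else 0.

Lemma wedge_form_extend f g X :
  wedge_form f g (extend_mx X) = wedge_form (f \o lift h) (g \o lift h) X.
Proof.
rewrite /wedge_form (bigD1_ord h) //= big1 ?add0r => [|k _].
  apply: eq_bigr => i _; rewrite (bigD1_ord h) //= !mxE liftK unlift_none mul0r add0r.
  by apply: eq_bigr => k _; rewrite !mxE !liftK.
by rewrite !mxE unlift_none mul0r.
Qed.

Lemma wedge_form_row_at f g v : wedge_form f g (row_at_mx v) =
  \sum_k v k * (f h * g (lift h k) - f (lift h k) * g h).
Proof.
rewrite /wedge_form (bigD1_ord h) //= addrC big1 ?add0r => [|i _].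
  rewrite (bigD1_ord h) //= !mxE unlift_none mul0r add0r.
  by apply: eq_bigr => k _; rewrite !mxE unlift_none liftK.
by rewrite big1 // => k _; rewrite !mxE liftK mul0r.
Qed.

Variables (a : 'I_2 -> 'I_n -> K) (m : 'I_n -> bool) (m' : 'I_n.+1 -> bool).
Variables (i0 : 'I_n) (x y : K).
Hypothesis mm' : forall i, m' (lift h i) = m i.
Local Notation a' := (insert_node x y a).
Local Notation z j := (if j == 0 then x else y : K).

Let aL j i : a' j (lift h i) = a j i.
Proof. by rewrite /insert_node liftK. Qed.

Let aN j : a' j h = z j.
Proof. by rewrite /insert_node unlift_none. Qed.

Let sL j i : sec_sign K m' j (lift h i) = sec_sign K m j i.
Proof. by rewrite /sec_sign mm'. Qed.

Lemma gauss_coord_extend l t X : gauss_coord a' m' (lift h i0) (lift h l) t (extend_mx X)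
  = gauss_coord a m i0 l t X.
Proof.
have rE j : res_coef K m' j (lift h l) \o lift h = res_coef K m j l.
  by apply/funext => i; rewrite /res_coef /= sL (inj_eq lift_inj).
have lE j : lin_coef a' m' j (lift h l) \o lift h = lin_coef a m j l.
  by apply/funext => i; rewrite /lin_coef /= sL mm' !aL.
have qE j : quad_coef a' m' j (lift h l) \o lift h = quad_coef a m j l.
  by apply/funext => i; rewrite /quad_coef /= sL mm' !aL.
have zE j : zero_coef a' m' j \o lift h = zero_coef a m j.
  by apply/funext => i; rewrite /zero_coef /= sL !aL.
have iE j : inf_coef a' m' j \o lift h = inf_coef a m j.
  by apply/funext => i; rewrite /inf_coef /= sL !aL.
rewrite /gauss_coord wedge_form_extend /gauss_pair (inj_eq lift_inj).
by case: (val t) => [|[|[|[|?]]]] /=; (try case: ifP => _ /=);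
  rewrite ?rE ?lE ?qE ?zE ?iE.
Qed.

Let res0 j : res_coef K m' j h \o lift h = fun _ => 0.
Proof. by apply/funext => i; rewrite /res_coef /= eq_sym (negPf (neq_lift _ _)) mulr0. Qed.

Let linE j : lin_coef a' m' j h \o lift h = sec_val a m j (z j).
Proof. by apply/funext => i; rewrite /lin_coef /= sL mm' aL aN. Qed.

Let quadE j : quad_coef a' m' j h \o lift h = sec_der a m j (z j).
Proof. by apply/funext => i; rewrite /quad_coef /= sL mm' aL aN. Qed.

(** Old sections have no residue at the new node, so their wedges contribute no polar coefficient
    there, only torsion. *)
Lemma gauss_coord_new_extend t X : gauss_coord a' m' (lift h i0) h t (extend_mx X) =
  if val t == 4 then wedge_form (sec_val a m 0 x) (sec_val a m 1 y) X else 0.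
Proof.
have W0 f : wedge_form (fun _ => 0) f X = 0.
  by rewrite /wedge_form big1 // => i _; rewrite big1 // => k _; rewrite !mul0r subrr mulr0.
rewrite /gauss_coord wedge_form_extend /gauss_pair (negPf (neq_lift _ _)).
case: t => -[|[|[|[|[|//]]]]] ti /=; rewrite ?res0 ?W0 //.
by rewrite !linE.
Qed.

(** The new section has residue [sec_sign] at the new node and the old ones have none; the polar
    coefficients then see just the 1-jets of the old sections, and not the higher coefficients of
    the new one. *)
Lemma gauss_coord_new_row t v : (val t < 4)%N ->
  gauss_coord a' m' (lift h i0) h t (row_at_mx v) =
  match val t with
  | 0 => sec_sign K m' 0 h * \sum_k v k * sec_val a m 0 x k
  | 1 => sec_sign K m' 0 h * \sum_k v k * sec_der a m 0 x k
  | 2 => sec_sign K m' 1 h * \sum_k v k * sec_val a m 1 y k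
  | _ => sec_sign K m' 1 h * \sum_k v k * sec_der a m 1 y k
  end.
Proof.
have R (j : 'I_2) f : wedge_form (res_coef K m' j h) f (row_at_mx v) =
    sec_sign K m' j h * \sum_k v k * (f \o lift h) k.
  rewrite wedge_form_row_at mulr_sumr; apply: eq_bigr => k _.
  have -> : res_coef K m' j h (lift h k) = 0 by rewrite -[LHS]/((res_coef K m' j h \o lift h) k) res0.
  by rewrite /res_coef eqxx mulr1 mul0r subr0 mulrCA.
rewrite /gauss_coord /gauss_pair (negPf (neq_lift _ _)).
by case: t => -[|[|[|[|//]]]] ti _ /=; rewrite R ?linE ?quadE.
Qed.

Lemma insert_node_admissible :
  (forall j, (forall i, a j i != 0) /\ injective (a j)) ->
  x != 0 -> y != 0 -> (forall i, x != a 0 i) -> (forall i, y != a 1 i) ->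
  forall j, (forall i, a' j i != 0) /\ injective (a' j).
Proof.
move=> adm x0 y0 xa ya j; have [nz inj] := adm j.
have zj : z j != 0 by case: ifP.
have za i : z j != a j i by have [->|->] := ord2P j; rewrite ?xa ?ya.
split=> [i|i k].
  by case: (unliftP h i) => [i' ->|->]; rewrite ?aL ?aN.
case: (unliftP h i) => [i' ->|->]; case: (unliftP h k) => [k' ->|->] //; rewrite ?aL ?aN.
- by move/inj ->.
- by move/eqP; rewrite eq_sym (negPf (za _)).
- by move/eqP; rewrite (negPf (za _)).
Qed.

End InsertNode.

(** A block triangular solution. [Y] gives the four polar coefficients at the new node, [X] repairs
    the old coordinates that [Y] disturbs, and a multiple of [Z], which the old coordinates do not
    see, sets the new torsion. *)
Lemma insert_node_surj (K : closedFieldType) (n : nat) (h : 'I_n.+1)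
    (a : 'I_2 -> 'I_n -> K) (m : 'I_n -> bool) (m' : 'I_n.+1 -> bool) (i0 : 'I_n)
    (p : 'I_4 -> 'I_n) :
  (12 <= n)%N -> (forall i, m' (lift h i) = m i) ->
  (forall j, (forall i, a j i != 0) /\ injective (a j)) ->
  four_nodes a m p -> gauss_coord_surj a m i0 ->
  exists x y, let a' := insert_node h x y a in
  [/\ forall j, (forall i, a' j i != 0) /\ injective (a' j),
      four_nodes a' m' (lift h \o p) & gauss_coord_surj a' m' (lift h i0)].
Proof.
move=> n12 mm' adm hp surj.
have [|Z [i [k Zik]] HZ] := @antisym_solution K n ('I_n * 'I_5)%type
    (fun lt => gauss_pair a m i0 lt.1 lt.2).
  (* [5 n < n (n - 1) / 2] holds from [n = 12] on. *)
  rewrite card_prod !card_ord bin2; move: n12; clear; nia.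
have [y [[y1 y2] [ya y0]]] := cofinitely_ex (cofinitely_and
  (cofinitely_and (wedge_generic m adm Zik) (jet_matrix_generic adm hp))
  (cofinitely_and (cofinitely_neq (a 1)) (cofinitely_neq (fun _ : 'I_1 => 0)))).
have [x [[x1 x2] [xa x0]]] := cofinitely_ex (cofinitely_and
  (cofinitely_and y1 y2)
  (cofinitely_and (cofinitely_neq (a 0)) (cofinitely_neq (fun _ : 'I_1 => 0)))).
exists x, y => a'; split.
- exact: (insert_node_admissible h adm (x0 ord0) (y0 ord0) xa ya).
- case: hp => pinj pm hne; split; first by apply: inj_comp pinj; exact: lift_inj.
    by move=> t /=; rewrite mm'.
  by rewrite /= /a' /insert_node !liftK.
move=> c.
have s_n0 := sec_sign_neq0 K m'.
have [v [v0 v1 v2 v3]] := jets_surjective hp x2 xa ya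
  (c h (@Ordinal 5 0 isT) / sec_sign K m' 0 h) (c h (@Ordinal 5 1 isT) / sec_sign K m' 0 h)
  (c h (@Ordinal 5 2 isT) / sec_sign K m' 1 h) (c h (@Ordinal 5 3 isT) / sec_sign K m' 1 h).
pose Y := row_at_mx h v.
have [X HX] := surj (fun l t => c (lift h l) t - gauss_coord a' m' (lift h i0) (lift h l) t Y).
pose tau := wedge_form (sec_val a m 0 x) (sec_val a m 1 y).
pose t4 := @Ordinal 5 4 isT.
(* [tau Z] is nonzero by the choice of [y] and [x] in [wedge_generic]. *)
pose d := (c h t4 - gauss_coord a' m' (lift h i0) h t4 Y - tau X) / tau Z.
exists (Y + extend_mx h (X + d *: Z)) => l t.
have GD l' t' A B : gauss_coord a' m' (lift h i0) l' t' (A + B) =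
    gauss_coord a' m' (lift h i0) l' t' A + gauss_coord a' m' (lift h i0) l' t' B.
  exact: wedge_formD.
rewrite GD; case: (unliftP h l) => [l' ->|->].
  rewrite (@gauss_coord_extend K n h a m m' i0 x y mm') /gauss_coord wedge_formD wedge_formZ.
  by rewrite (HZ (l', t)) mulr0 addr0 [X in _ + X]HX addrC subrK.
rewrite (@gauss_coord_new_extend K n h a m m' i0 x y mm').
case: eqP => [t4E|tn4].
  have -> : t = t4 by apply: val_inj.
  rewrite wedge_formD wedge_formZ -/(tau X) -/(tau Z) /d divfK //.
  by ring.
have tl : (val t < 4)%N by rewrite ltn_neqAle -ltnS ltn_ord andbT; apply/eqP.
rewrite addr0 (@gauss_coord_new_row K n h a m m' i0 x y mm') // v0 v1 v2 v3.
case: t tl {tn4} => -[|[|[|[|//]]]] ti _ /=; rewrite mulrC divfK //; congr (c h _); exact: val_inj.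
Qed.

(** * Openness *)

Section Openness.
Variables (K : fieldType) (n : nat).
Implicit Types (a : 'M[K]_(2, n)) (f h : 'M[K]_(2, n) -> K).

Definition adm_matrix a : Prop := forall j : 'I_2, (forall i, a j i != 0) /\ injective (a j).

Definition poly_fun f : Prop :=
  exists P : {mpoly K[2 * n]}, forall a, f a = P.@[mxvec a 0].

(** Diagonal pairs contribute the node itself, so that one product encodes both nonvanishing and
    distinctness. *)
Definition disc_factor a (q : 'I_2 * ('I_n * 'I_n)) : K :=
  if q.2.1 == q.2.2 then a q.1 q.2.1 else a q.1 q.2.1 - a q.1 q.2.2.

Definition disc a : K := \prod_q disc_factor a q.

(** A quotient of a polynomial by a power of [disc]; the values where [disc] vanishes are left
    free. *)
Definition regular_fun f : Prop :=
  exists k, exists2 h, poly_fun h & forall a, disc a != 0 -> f a * disc a ^+ k = h a.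

Lemma disc_adm a : disc a != 0 <-> adm_matrix a.
Proof.
split=> [/prodf_neq0 H j|adm]; last first.
  apply/prodf_neq0 => -[j [i l]] _; rewrite /disc_factor /=; have [nz inj] := adm j.
  have [_|il] := eqVneq i l; first exact: nz.
  by rewrite subr_eq0 (inj_eq inj).
split=> [i|i l ail]; first by have := H (j, (i, i)) isT; rewrite /disc_factor eqxx.
apply/eqP; apply: contraT => il; have := H (j, (i, l)) isT.
by rewrite /disc_factor /= (negPf il) ail subrr eqxx.
Qed.

Lemma poly_fun_const c : poly_fun (fun _ => c).
Proof. by exists c%:MP => a; rewrite mevalC. Qed.

Lemma poly_funD f h : poly_fun f -> poly_fun h -> poly_fun (fun a => f a + h a).
Proof. by move=> [P eP] [Q eQ]; exists (P + Q) => a; rewrite mevalD eP eQ. Qed.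

Lemma poly_funM f h : poly_fun f -> poly_fun h -> poly_fun (fun a => f a * h a).
Proof. by move=> [P eP] [Q eQ]; exists (P * Q) => a; rewrite mevalM eP eQ. Qed.

Lemma poly_fun_entry j i : poly_fun (fun a => a j i).
Proof. by exists 'X_(mxvec_index j i) => a; rewrite mevalXU mxvecE. Qed.

Lemma poly_fun_prod (I : Type) (r : seq I) (P : pred I) (f : I -> 'M[K]_(2, n) -> K) :
  (forall i, poly_fun (f i)) -> poly_fun (fun a => \prod_(i <- r | P i) f i a).
Proof.
move=> pf; elim: r => [|i r [Q eQ]].
  by have [Q eQ] := poly_fun_const 1; exists Q => a; rewrite big_nil -eQ.
have [S eS] := pf i; exists (if P i then S * Q else Q) => a; rewrite big_cons.
by case: ifP => _; rewrite ?mevalM -?eS eQ.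
Qed.

Lemma poly_fun_factor q : poly_fun (disc_factor^~ q).
Proof.
rewrite /disc_factor; case: (q.2.1 == q.2.2); first exact: poly_fun_entry.
apply: poly_funD; first exact: poly_fun_entry.
have [P eP] := poly_funM (poly_fun_const (-1)) (poly_fun_entry q.1 q.2.2).
by exists P => a; rewrite -eP mulN1r.
Qed.

Lemma poly_fun_disc : poly_fun disc.
Proof. by apply: poly_fun_prod => q; apply: poly_fun_factor. Qed.

Lemma poly_fun_discX k : poly_fun (fun a => disc a ^+ k).
Proof.
elim: k => [|k IH]; first exact: poly_fun_const.
by have [P eP] := poly_funM poly_fun_disc IH; exists P => a; rewrite exprS eP.
Qed.

Lemma poly_regular_fun f : poly_fun f -> regular_fun f.
Proof. by move=> pf; exists 0, f => // a _; rewrite mulr1. Qed.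

Lemma regular_funD f h : regular_fun f -> regular_fun h -> regular_fun (fun a => f a + h a).
Proof.
move=> [k [f' pf ef]] [l [h' ph eh]]; exists (k + l)%N.
exists (fun a => f' a * disc a ^+ l + h' a * disc a ^+ k) => [|a da].
  by apply: poly_funD; apply: poly_funM => //; exact: poly_fun_discX.
by rewrite -ef // -eh // exprD; ring.
Qed.

Lemma regular_funM f h : regular_fun f -> regular_fun h -> regular_fun (fun a => f a * h a).
Proof.
move=> [k [f' pf ef]] [l [h' ph eh]]; exists (k + l)%N, (fun a => f' a * h' a) => [|a da].
  exact: poly_funM.
by rewrite -ef // -eh // exprD; ring.
Qed.

Lemma regular_fun_factorV q : regular_fun (fun a => (disc_factor a q)^-1).
Proof.
exists 1, (fun a => \prod_(r | r != q) disc_factor a r) => [|a da].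
  by apply: poly_fun_prod => r; apply: poly_fun_factor.
have := da; rewrite expr1 /disc (bigD1 q) //= mulf_eq0 negb_or => /andP[q0 _].
by rewrite mulKf.
Qed.

Lemma regular_fun_ext f h : f =1 h -> regular_fun f -> regular_fun h.
Proof. by move=> fh [k [p pp e]]; exists k, p => // a da; rewrite -fh e. Qed.

Lemma regular_fun_const c : regular_fun (fun _ => c).
Proof. exact/poly_regular_fun/poly_fun_const. Qed.

Lemma regular_fun_entry j i : regular_fun (fun a => a j i).
Proof. exact/poly_regular_fun/poly_fun_entry. Qed.

Lemma regular_fun_entryV j i : regular_fun (fun a => (a j i)^-1).
Proof.
apply: regular_fun_ext (regular_fun_factorV (j, (i, i))) => a.
by rewrite /disc_factor eqxx.
Qed.

(** For [l = i] the function is constantly 0 by the convention [0^-1 = 0], which covers the terms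
    [i = l] of [lin_coef] and [quad_coef]. *)
Lemma regular_fun_diffV j l i : regular_fun (fun a => (a j l - a j i)^-1).
Proof.
have [->|li] := eqVneq l i.
  by apply: regular_fun_ext (regular_fun_const 0) => a; rewrite subrr invr0.
apply: regular_fun_ext (regular_fun_factorV (j, (l, i))) => a.
by rewrite /disc_factor /= (negPf li).
Qed.

Lemma regular_funX f k : regular_fun f -> regular_fun (fun a => f a ^+ k).
Proof.
move=> rf; elim: k => [|k IH]; first exact: regular_fun_const.
by apply: regular_fun_ext (regular_funM rf IH) => a; rewrite exprS.
Qed.

Lemma regular_funN f : regular_fun f -> regular_fun (fun a => - f a).
Proof.
move=> rf; apply: regular_fun_ext (regular_funM (regular_fun_const (-1)) rf) => a.
by rewrite mulN1r.
Qed.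

Lemma regular_fun_sum (I : Type) (r : seq I) (f : I -> 'M[K]_(2, n) -> K) :
  (forall i, regular_fun (f i)) -> regular_fun (fun a => \sum_(i <- r) f i a).
Proof.
move=> rf; elim: r => [|i r IH].
  by apply: regular_fun_ext (regular_fun_const 0) => a; rewrite big_nil.
by apply: regular_fun_ext (regular_funD (rf i) IH) => a; rewrite big_cons.
Qed.

Lemma regular_fun_prod (I : Type) (r : seq I) (f : I -> 'M[K]_(2, n) -> K) :
  (forall i, regular_fun (f i)) -> regular_fun (fun a => \prod_(i <- r) f i a).
Proof.
move=> rf; elim: r => [|i r IH].
  by apply: regular_fun_ext (regular_fun_const 1) => a; rewrite big_nil.
by apply: regular_fun_ext (regular_funM (rf i) IH) => a; rewrite big_cons.
Qed.

Lemma regular_fun_det r (A : 'M[K]_(2, n) -> 'M[K]_r) :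
  (forall i k, regular_fun (fun a => A a i k)) -> regular_fun (fun a => \det (A a)).
Proof.
move=> rA; apply: regular_fun_sum => s; apply: regular_funM; first exact: regular_fun_const.
exact: regular_fun_prod.
Qed.

Variables (m : 'I_n -> bool) (i0 : 'I_n).
Local Notation pair a l t := (gauss_pair (fun_of_matrix a) m i0 l t).

Lemma gauss_pair_regular l t i :
  regular_fun (fun a => (pair a l t).1 i) /\ regular_fun (fun a => (pair a l t).2 i).
Proof.
have R j l' i' : regular_fun (fun a => res_coef K m j l' i') by apply: regular_fun_const.
have S j i' : regular_fun (fun a => sec_sign K m j i') by apply: regular_fun_const.
have L j l' i' : regular_fun (fun a => lin_coef (fun_of_matrix a) m j l' i').
  apply: regular_funM => //; apply: regular_funD; first exact: regular_fun_diffV.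
  apply: regular_funN; apply: regular_funM; first exact: regular_fun_const.
  exact: regular_fun_entryV.
have Q j l' i' : regular_fun (fun a => quad_coef (fun_of_matrix a) m j l' i').
  apply: regular_funM => //; apply: regular_funD.
    apply: regular_funM; first exact: regular_fun_const.
    apply: regular_fun_ext (regular_funX 2 (regular_fun_entryV j l')) => a.
    by rewrite exprVn.
  apply: regular_funN; apply: regular_fun_ext (regular_funX 2 (regular_fun_diffV j l' i')) => a.
  by rewrite exprVn.
have Z j i' : regular_fun (fun a => zero_coef (fun_of_matrix a) m j i').
  by apply: regular_funM => //; exact: regular_fun_entryV.
have I j i' : regular_fun (fun a => inf_coef (fun_of_matrix a) m j i').
  by apply: regular_funM => //; exact: regular_fun_entry.
rewrite /gauss_pair; case: (val t) => [|[|[|[|?]]]]; (try case: (l == i0)); split;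
  by [exact: R | exact: L | exact: Q | exact: Z | exact: I].
Qed.

Definition gauss_matrix a : 'M[K]_(#|{: 'I_n * 'I_n}|, #|{: 'I_n * 'I_5}|) :=
  \matrix_(p, q) let: (i, k) := enum_val p in let: (l, t) := enum_val q in
  (pair a l t).1 i * (pair a l t).2 k - (pair a l t).1 k * (pair a l t).2 i.

Lemma gauss_coord_matrix a l t (u : 'rV[K]_(#|{: 'I_n * 'I_n}|)) :
  gauss_coord (fun_of_matrix a) m i0 l t (\matrix_(i, k) u 0 (enum_rank (i, k)))
  = (u *m gauss_matrix a) 0 (enum_rank (l, t)).
Proof.
rewrite /gauss_coord /wedge_form pair_bigA mxE /=.
rewrite (reindex (@enum_val _ {: 'I_n * 'I_n})) /=; last first.
  by exists enum_rank => p _; rewrite ?enum_rankK ?enum_valK.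
apply: eq_bigr => p _; rewrite !mxE -surjective_pairing enum_valK enum_rankK.
by case: (enum_val p).
Qed.

Lemma gauss_coord_surjP a :
  gauss_coord_surj (fun_of_matrix a) m i0 <-> row_full (gauss_matrix a).
Proof.
split=> [surj|/row_fullP[B BA] c].
  apply/row_fullP.
  have /choice[u Hu] : forall q, exists u : 'rV[K]_(#|{: 'I_n * 'I_n}|),
      u *m gauss_matrix a = delta_mx 0 q.
    move=> q.
    have [X HX] := surj (fun l t => (enum_rank (l, t) == q)%:R).
    exists (\row_p X (enum_val p).1 (enum_val p).2).
    apply/rowP => q'; rewrite -(enum_valK q'); case: (enum_val q') => l t.
    rewrite -gauss_coord_matrix mxE eqxx /= -HX; congr (gauss_coord _ _ _ _ _ _).
    by apply/matrixP => i k; rewrite !mxE enum_rankK.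
  exists (\matrix_q u q); apply/row_matrixP => q.
  by rewrite row_mul rowK Hu row1.
pose cv : 'rV[K]_(#|{: 'I_n * 'I_5}|) := \row_q c (enum_val q).1 (enum_val q).2.
exists (\matrix_(i, k) (cv *m B) 0 (enum_rank (i, k))) => l t.
by rewrite gauss_coord_matrix -mulmxA BA mulmx1 mxE enum_rankK.
Qed.

(* Some maximal minor of [gauss_matrix] is nonzero at [a0]. *)
Lemma gauss_surj_open a0 : adm_matrix a0 -> gauss_coord_surj (fun_of_matrix a0) m i0 ->
  exists2 P : {mpoly K[2 * n]}, P.@[mxvec a0 0] != 0 &
    forall a, P.@[mxvec a 0] != 0 ->
      adm_matrix a /\ gauss_coord_surj (fun_of_matrix a) m i0.
Proof.
move=> adm0 /gauss_coord_surjP full0.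
pose s := fullrankfun full0; pose A a := rowsub s (gauss_matrix a).
have [k [h [P eP] eA]] : regular_fun (fun a => \det (A a)).
  apply: regular_fun_det => p q; case ep: (enum_val (s p)) => [i k]; case eq: (enum_val q) => [l t].
  have E a : (pair a l t).1 i * (pair a l t).2 k - (pair a l t).1 k * (pair a l t).2 i = A a p q.
    by rewrite !mxE ep eq.
  apply: regular_fun_ext E _; have [ri ri'] := gauss_pair_regular l t i.
  have [rk rk'] := gauss_pair_regular l t k.
  by apply: regular_funD; [|apply: regular_funN]; apply: regular_funM.
have [D eD] := poly_fun_disc.
have d0 : disc a0 != 0 by apply/disc_adm.
have A0 : \det (A a0) != 0 by rewrite -unitfE -unitmxE; exact: fullrowsub_unit.
exists (P * D) => [|a]; rewrite mevalM -eP -eD.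
  by rewrite -eA // !mulf_neq0 ?expf_neq0.
rewrite mulf_eq0 negb_or => /andP[ha da]; split; first exact/disc_adm.
apply/gauss_coord_surjP; move: ha; rewrite -eA // mulf_eq0 negb_or => /andP[detA _].
have uA : A a \in unitmx by rewrite unitmxE unitfE.
apply/row_fullP; exists (invmx (A a) *m rowsub s 1%:M).
by rewrite -mulmxA -rowsubE mulVmx.
Qed.

End Openness.

(** * Genus 12 and 13 *)

Section ReductionModPrime.
Variable K : numFieldType.

(** Binary integers carry the computation; [Zin] transports it to 'F_13 and to characteristic
    zero. *)
Definition Zin (R : pzRingType) (z : Z) : R := (int_of_Z z)%:~R.

Lemma Zin0 (R : pzRingType) : Zin R 0 = 0.
Proof. by rewrite /Zin rmorph0. Qed.

Lemma ZinD R x y : Zin R (x + y) = Zin R x + Zin R y.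
Proof. by rewrite /Zin rmorphD /= intrD. Qed.

Lemma ZinM (R : pzRingType) x y : Zin R (x * y) = Zin R x * Zin R y.
Proof. by rewrite /Zin rmorphM /= intrM. Qed.

Lemma ZinN R x : Zin R (- x) = - Zin R x.
Proof. by rewrite /Zin rmorphN /= intrN. Qed.

Lemma Zin_sum (R : pzRingType) (I : finType) (f : I -> Z) :
  Zin R (\sum_i f i) = \sum_i Zin R (f i).
Proof. by rewrite /Zin raddf_sum /= raddf_sum. Qed.

Lemma Zin_eq0 x : (Zin K x == 0) = (x == 0).
Proof. by rewrite /Zin intr_eq0 -(inj_eq (can_inj int_of_ZK)). Qed.

(* An integer matrix with a right inverse modulo [p] has full rank over [K], as the
   determinant of the product is 1 modulo [p]. *)
Lemma solve_mod_prime (p : nat) (r s : nat) (E : 'M[Z]_(r, s)) (B : 'M[Z]_(s, r)) :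
  prime p -> map_mx (Zin 'F_p) (B *m E) = 1%:M ->
  forall c : 'rV[K]_s, exists x : 'rV[K]_r, x *m map_mx (Zin K) E = c.
Proof.
move=> pp BE c.
pose fp : {rmorphism Z -> 'F_p} := intmul 1 \o int_of_Z.
pose fK : {rmorphism Z -> K} := intmul 1 \o int_of_Z.
have dBE : \det (B *m E) != 0.
  apply: contra_eq_neq (oner_neq0 'F_p) => d0.
  by rewrite -(det1 _ s) -BE (det_map_mx fp) d0 rmorph0.
have u : map_mx fK (B *m E) \in unitmx.
  rewrite unitmxE unitfE det_map_mx; apply: contraNneq dBE => /eqP.
  by rewrite Zin_eq0.
exists (c *m invmx (map_mx fK (B *m E)) *m map_mx fK B).
by rewrite -mulmxA -map_mxM mulmxKV.
Qed.

End ReductionModPrime.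

Section Certificates.
Local Delimit Scope Z_scope with coqZ.

(* The nodes are [1, 2, 3, ...] on one component and the residues modulo 13 of
   [2, 4, 8, ...] on the other one.  All coordinates are made integral by the factor
   [cert_scale = lcm (1, ..., 12)]; [Z.div _ 0 = 0] agrees with [0^-1 = 0]. *)
Definition cert_node (b : bool) (i : nat) : Z :=
  if b then Z.modulo (Z.pow (Zpos 2%positive) (Z.of_nat i.+1)) (Zpos 13%positive)
  else Z.of_nat i.+1.
(** Six nodes of the first kind: floor(g/2) is 6 for g = 12 and for g = 13. *)
Definition cert_minus (i : nat) : bool := (5 < i)%N.
Definition cert_sign (b : bool) (i : nat) : Z := if ~~ b || cert_minus i then 1 else -1.
Definition cert_scale : Z := Zpos 27720%positive.
Definition cert_quot (x : Z) : Z := Z.div cert_scale x.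

Definition cert_res b (l i : nat) : Z := cert_sign b i * (i == l)%:R.
Definition cert_lin b l i : Z := cert_sign b i *
  (cert_quot (cert_node b l - cert_node b i) - (cert_minus i)%:R * cert_quot (cert_node b l)).
Definition cert_quad b l i : Z := cert_sign b i *
  ((cert_minus i)%:R * cert_quot (cert_node b l) ^+ 2
   - cert_quot (cert_node b l - cert_node b i) ^+ 2).
Definition cert_zero b i : Z := cert_sign b i * cert_quot (cert_node b i).
Definition cert_inf b i : Z := cert_sign b i * cert_node b i.

Definition cert_pair (l t : nat) : (nat -> Z) * (nat -> Z) :=
  match t with
  | 0 => (cert_res false l, cert_lin false l)
  | 1 => if l == 0 then (cert_zero false, cert_zero true)
         else (cert_res false l, cert_quad false l)
  | 2 => (cert_res true l, cert_lin true l)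
  | 3 => if l == 0 then (cert_inf false, cert_inf true)
         else (cert_res true l, cert_quad true l)
  | _ => (cert_lin false l, cert_lin true l)
  end.

Definition cert_pairs (n : nat) : seq (nat * nat) :=
  [seq (i, k) | k <- iota 0 n, i <- iota 0 k].

Definition cert_entry (q p : nat * nat) : Z :=
  let: (f, h) := cert_pair q.1 q.2 in f p.1 * h p.2 - f p.2 * h p.1.

Definition cert_coords (n : nat) : seq (nat * nat) :=
  [seq (l, t) | l <- iota 0 n, t <- iota 0 5].

Definition cert_row (n : nat) (q : nat * nat) : seq Z :=
  let: (f, h) := cert_pair q.1 q.2 in
  let fs := [seq Z.modulo (f i) (Zpos 13%positive) | i <- iota 0 n] in
  let hs := [seq Z.modulo (h i) (Zpos 13%positive) | i <- iota 0 n] in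
  [seq Z.modulo (Z.sub (Z.mul (nth 0 fs p.1) (nth 0 hs p.2))
                       (Z.mul (nth 0 fs p.2) (nth 0 hs p.1))) (Zpos 13%positive)
  | p <- cert_pairs n].

(* Lowest digit first. *)
Fixpoint hex_digits (r : nat) (z : Z) : seq Z :=
  if r is r'.+1 then Z.land z (Zpos 15%positive) :: hex_digits r' (Z.shiftr z (Zpos 4%positive))
  else [::].

Fixpoint dot (s t : seq Z) : Z :=
  match s, t with x :: s', y :: t' => Z.add (Z.mul x y) (dot s' t') | _, _ => 0 end.

Definition cert_check (n : nat) (B : seq Z) : bool :=
  let rows := [seq (q, cert_row n q) | q <- cert_coords n] in
  let r := size (cert_pairs n) in
  (size B == size rows) &&
  all (fun x => let d := hex_digits r x.2 in
    all (fun y => Z.eqb (Z.modulo (dot d y.2) (Zpos 13%positive))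
                        (if x.1 == y.1 then Zpos 1%positive else Z0)) rows)
    (zip (cert_coords n) B).

(** All the integer divisions of [cert_scale] that occur are exact, so they really are scaled
    inverses. *)
Definition cert_quot_check : bool :=
  all (fun x => (x == 0) || (cert_quot x * x == cert_scale))
    (flatten [seq [seq cert_node b l - cert_node b i | l <- iota 0 12, i <- iota 0 12]
                  ++ [seq cert_node b l | l <- iota 0 12] | b <- [:: false; true]]).

Lemma cert_quotP : cert_quot_check.
Proof. by vm_compute. Qed.

(* The hexadecimal digits of the q-th number are, modulo 13 and in the order of
   [cert_pairs], the coefficients of an element with q-th coordinate 1 and the others 0. *)
Definition cert11 : seq Z := [::
  0x96844aca94622a07419b7281280ba3c98c765b896b5b78b9c91125c;
  0x8130a58b9bb5148ccb3c76669095164c222133356a781459546622c;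
  0x263a1aa35260c816797368138666abb51c33c0c3167a32b148052cc;
  0x247a49b4200516296b9a13c2604749718880c70b859b86466179427;
  0x678582557802651266ba60018603741a2bb0a693890317b41604455;
  0x996462b9ba1c466b0a0565861c741808c888193a605a48057b56252;
  0x443417c346b520a43138530aaa0b638729542530385cba75a897381;
  0x1b5077635332b2939072a92cb351c2870c42999a01228199568691c;
  0x64931b36c55194bb697cc5c37b1a949051b93a906022c600c7b6579;
  0x6b55002a953485978b74c586aab69c881c9098ca4c750467ba4202c;
  0x38c40121005bbb60742580cb9750a1c96b4b912052558ba61870668;
  0x6715071281b88b51aab1cc25cb59c8cc8374898c91c7b68a77396c4;
  0xa461c9548a80c5815a8ab17640896578182b8205165418a4867a95;
  0x3c5ccc159cc82055795363ab505b2a4603cb726984912bb3c39c867;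
  0x61084502b95130a59a8064c8699a4cbbb10c5347c7c6351337615cc;
  0xa1079ba742870869b016402046c6473a1205218900c29c24453066a;
  0xc7625cc482b18c7b61276c4261c56753236c5a00600a33927986935;
  0x35822bc66439314c03c0a9a5b174636b15708c397687a3298476c9a;
  0x824625bc1785750ab678405c28a7369634a68326008767886385a39;
  0x249c08c67771148aac726244088bb261135617740c0924b5a7118c0;
  0x799a434c4c7656aa644a819233381622453a2919426a93981613653;
  0x38304071c7b633643c6a9928bb4b0bc313a572305cc3bb919a58aba;
  0xa86bb02c46735bc01b4c2466b933377626ac331b12961ba19197b18;
  0x349a0754b39c252a6b31087ba5165324322766864ab8c19b1a447c1;
  0x54a58ccb583344571353b607542003cb88966707563842734559078;
  0x2856ba720a285a40a39195aa36a6b24c54aab754c9986870895b047;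
  0x3a1c4b7a0903a42808575bc983b043c8c988c6562a3c01c00bc2ca7;
  0xc3b0b9622179911c3192029abcbc56ac3109ba7c4a439619777b069;
  0x814176237128558ac2ccb18b4977b56146a5b439ab284c950366178;
  0xc67b75989668b234555190bc4cc5387014c194a7347c6433054910;
  0x753209c6976a849cc30bb5376554335cc605511b3904a829097a05;
  0x4571c01c53a603073b2b706c6521730938c90a90590721ab969ac43;
  0x853291b5852cb74bba31a88b828ccc56a1756594b94896a1ab3bb09;
  0x38c7782251239089508aa43bb1162296a044c7116bc3ac480b63164;
  0xba8a7405a2abc258334c373bc97c7c4792c92cb976ba8bb9cb6b2ab;
  0x45b900aaccc6256624750c1b544118a41567747b53304b21a3a6951;
  0x2cbb32452b838889757a7c494355bc96479300816cb1cc69a9ca651;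
  0x2593bb12c2cc595666049ab972375c17b1a5ca9c297714966835190;
  0x84123169688cc61ab007a4b71634590c30957bb2a2904942282ac70;
  0x7b4a1c36b941113bb1756a486186035631b373c47c9339a0c255b41;
  0x782619713b28b901344926b5c1b143c65829a1587336995202b8821;
  0xb67b115b4b334242a7aab4acb0948a32a7c7375276a2ba8cab016a7;
  0x45c7a95c53a4543832072243c8a0a959787498b6c55b03853202056;
  0x5872b0089732497b4b6c51aa7ab69075a1265683c55632b32c089b7;
  0x9cb1a2a619209b07ac0a10a76061210878b4088a0a54b453c259263;
  0xa05c91117891b225bc33357a8a9492a52c908b65863611a10aab360;
  0x12bc07598033b06806773c49abcc38150c186bb098ca489783080b6;
  0x27c4385540a44389085b2a6b33669bb28879a5a177b09ba580542b7;
  0xa3052247176a1767cb8bc03684186a3a9017b58a71a1aab994c4c8;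
  0x746445268288766733c94b936c6c6b6373bc20c8a8851a977311835;
  0x7b046a23c81141145b0b21649a110216b109a05a923615014c77098;
  0x8ac3a175891cb02ac0793114b80b9aaa8c4695744678a417a614404;
  0xb906392a78c293a7b61ab83c8c7ab3a57611aab7aa3c38a28ac0064;
  0x72a8715a313714092bc1ba0497b3566575338ac0413c50a02ab6934;
  0x70b79130812b8c829b3995021094a1bc9a3c2a155a248110263781a]%coqZ.

Definition cert12 : seq Z := [::
  0x850a69a548396074b22541178791289215a03b2052793b600244a59c36bc;
  0xb204580709acc875616a33ba371b91321c177bb7b74608851c5aca40c17c;
  0x1c0b4201a8189c496c70459a16458cb38b731317ba64c07874826883293c;
  0xb204523ba312519761840ab311b45b3a324a9440a3836a3746799b112377;
  0x678582557802651266ba60018603741a2bb0a693890317b41604455;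
  0x760c2965434ac8b924ccaca8463a238c5869609ac0cc8c7c2bb219b0bc72;
  0x6701b4744450075322745418955b1818ac5c918303272a1b747598812661;
  0x4905310a09ab17b20bb581067a6561a693c24877817379563ccc38677b4c;
  0x760c26183b02996049a4a592bc31c976b325b6200205bc7976929176b299;
  0x58037678597515258804abb97cb2549931571b931ccb3c4c358065a6099c;
  0xb20453734c662c9ccb084b49988411ab9892427980258703b6c2968165b8;
  0x760c26405a905526b84b09a60ca4117aa668a94987c4a286c59a697b1314;
  0x850a6011655618b8404a5b585a578c52b4061b4118437a917ca1ba849125;
  0x9408a3a0ca997740a2490296b66742643b0a9589524ccc050b08993ab637;
  0x580376a380c3676753858caa36a67087795a48b7087307c448982a78c16c;
  0xa1079ba742870869b016402046c6473a1205218900c29c24453066a;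
  0x58037c39216284c058721914a65b100a2b049c00081c61558873119a45a5;
  0x6701b38925903938638b01341ab899523c5a00459997b1c12300064c127a;
  0xb204581861a2003267721261c48a27b3311c1c023c4512b60480bb32b989;
  0x2b098255c13858b0012666c0b67c1852207365709a649b12343625778970;
  0x2b0987a5a5b0b5305548624a6864cb0ac3bc789b0b8b12484b245967a703;
  0x3a07c33a0cc16707b303bac249a1aa0843c1479931751222713838a1c5aa;
  0x850a6ac3b26c8895c534abb292bc74a56b180593b0c256a4897322179278;
  0x9408a324ab40698a129651b490b447b0b168787c1181986778364ba53591;
  0x54a58ccb583344571353b607542003cb88966707563842734559078;
  0x490532aa600c0251656052386920460b12cb90c0335c18009a6a7b94c277;
  0x58037364c05a19627acab387a5468229a99b196292a4ca28a556c7b10847;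
  0x49053c5300cb049679aa481870cc416c79349b932381901840443a76c299;
  0x814176237128558ac2ccb18b4977b56146a5b439ab284c950366178;
  0x9408a0a17940b6178826bc5601ca49ab4161a56169ba0bc06881900637b0;
  0x753209c6976a849cc30bb5376554335cc605511b3904a829097a05;
  0x6701b48812b2982230a784b7c724349a0054b27a51702c2628b827615223;
  0x1c0b48c12359b2755b6399a6ca4c3c75108a2c3b04b10aa55ac161b68549;
  0xc102931170449bcca919b705ca8c67944164a8b0911957ab696039b36724;
  0xba8a7405a2abc258334c373bc97c7c4792c92cb976ba8bb9cb6b2ab;
  0x45b900aaccc6256624750c1b544118a41567747b53304b21a3a6951;
  0x1c0b4269ba62b90b9877755a878818827c812690bb60a50cb05a11927091;
  0xb20452403a353bb605b7aa678953cc59337427a223bc74750c519b8ab010;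
  0xc10298a329a83c656c72c00a9a872a16240831b5a9566b183330ab8c0530;
  0x9408a79cac9b89153157661806011377b96b9868a2557b852cb769264911;
  0xb2045776601b22799bb2574b02138444a2b2114761283911c7aa55251771;
  0x49053b8cb34a966214b072792b10617acc7ac522085cc3a1328b60bc2807;
  0x580374127638310c85cbb622a28b2678a22424515ccac7aa95724a2209c6;
  0x760c2556282cb68b5420a3b1b5cc696373b33b24a49415ccba50c4c80607;
  0x6701b92c100b3487a9578bc5b128b4410834a679015cc73bc4137a2a4543;
  0x2b098a11ca9a08c20b0017c9c3a273738b77a63434a3a6850305b8a35410;
  0xc1029180c63731b0ab17a26493304662a2c99baa08564a7b0325243ab676;
  0xb204526342096394545a048c225b186c2761a44c6160995967c2800ca137;
  0x6701b00408031a0c3a8178c39b1b74cc0181598ba889a4075778279977a8;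
  0x1c0b47b44b90c24b1755513274708a43177bc952706449992230cb34b275;
  0x5803777342457853549978b21270339cb580c8b7a044347846970bc95938;
  0x6701b80030c82b869b79b00ca33c89c8a2c1c7b22a2b6bc0331cb866c7b4;
  0x2b098ba9644b98c5191837676b0b93911087aba94698c8c56575c3a57114;
  0x6701b75b8ac6760841b7a3b42bcb87b62b8a7641c9732b797ba840a31c14;
  0x760c27aa7632352a185118bb8932b39154c7aab5310a3b499243946bc53a;
  0x25b194b40b2b8c981464a7ca519855b35a239b7a861a93317cc714c877c7;
  0xb926c6248632bac82b889b199695b571c3a138355354763498c05a6cb339;
  0x797c902954162667c395881a1353c0017738c2c2223ba6bac30622b91b57;
  0xbc5a148003a9347c633524bc63a2bc8494c271294074959290c843b2bcc1;
  0x850a604a046a943b9055aa0ba076161238717336ca9175882896160b2460]%coqZ.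

Lemma cert11P : cert_check 11 cert11.
Proof. by vm_compute. Qed.

Lemma cert12P : cert_check 12 cert12.
Proof. by vm_compute. Qed.

Let F13 := 'F_13.

Lemma Zin_mod (z : Z) : Zin F13 (Z.modulo z (Zpos 13%positive)) = Zin F13 z.
Proof.
have e : z = Zpos 13%positive * Z.div z (Zpos 13%positive) + Z.modulo z (Zpos 13%positive).
  by apply: Z.div_mod.
rewrite [in RHS]e ZinD ZinM; have -> : Zin F13 (Zpos 13%positive) = 0 by apply/eqP.
by rewrite mul0r add0r.
Qed.

Lemma Zin_dot (R : comPzRingType) (s t : seq Z) (r : nat) : size s = r -> size t = r ->
  Zin R (dot s t) = \sum_(p < r) Zin R (nth 0 s p) * Zin R (nth 0 t p).
Proof.
elim: s t r => [|x s IH] [|y t] [|r] //=; first by rewrite big_ord0.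
move=> [ss] [st]; rewrite big_ord_recl /= -IH //.
by rewrite -[Z.add _ _]/(x * y + dot s t) ZinD ZinM.
Qed.

Lemma size_hex_digits r z : size (hex_digits r z) = r.
Proof. by elim: r z => //= r IH z; rewrite IH. Qed.

Lemma cert_pairs_lt n p : p \in cert_pairs n -> (p.1 < n)%N /\ (p.2 < n)%N.
Proof.
move=> /allpairsPdep[k [i [kn ik ->]]] /=; move: kn ik; rewrite !mem_iota /=; lia.
Qed.

Lemma nth_cert_row n q p : (p < size (cert_pairs n))%N ->
  Zin F13 (nth 0 (cert_row n q) p) = Zin F13 (cert_entry q (nth (0, 0)%N (cert_pairs n) p)).
Proof.
move=> pn; rewrite /cert_row /cert_entry; case: (cert_pair q.1 q.2) => f h.
rewrite (nth_map (0, 0)%N) // Zin_mod.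
have [] := cert_pairs_lt (mem_nth (0, 0)%N pn); case: (nth _ _ p) => i k /= i_n k_n.
rewrite !(nth_map 0%N) ?size_iota // !nth_iota // !add0n.
rewrite -[Z.sub _ _]/(Z.modulo (f i) _ * Z.modulo (h k) _ - Z.modulo (f k) _ * Z.modulo (h i) _).
by rewrite !ZinD !ZinN !ZinM !Zin_mod.
Qed.

Lemma size_cert_row n q : size (cert_row n q) = size (cert_pairs n).
Proof. by rewrite /cert_row; case: (cert_pair _ _) => f h; rewrite size_map. Qed.

Lemma cert_coords_uniq n : uniq (cert_coords n).
Proof. by apply: allpairs_uniq; rewrite ?iota_uniq // => -[? ?] [? ?] _ _. Qed.

Lemma cert_solve (K : numFieldType) n B : cert_check n B ->
  forall c : nat * nat -> K, exists x : nat -> K, forall q, q \in cert_coords n ->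
    \sum_(p < size (cert_pairs n)) x p * Zin K (cert_entry q (nth (0, 0)%N (cert_pairs n) p)) = c q.
Proof.
rewrite /cert_check size_map => /andP[/eqP sB /allP H] c.
set r := size (cert_pairs n) in H *; pose s := size (cert_coords n).
pose coord q := nth (0, 0)%N (cert_coords n) q.
pose E : 'M[Z]_(r, s) := \matrix_(p, q) cert_entry (coord q) (nth (0, 0)%N (cert_pairs n) p).
pose D : 'M[Z]_(s, r) := \matrix_(q, p) nth 0 (hex_digits r (nth 0 B q)) p.
have DE : map_mx (Zin F13) (D *m E) = 1%:M.
  apply/matrixP => q q'; rewrite !mxE.
  have /H /allP /= : (coord q, nth 0 B q) \in zip (cert_coords n) B.
    by rewrite -nth_zip // mem_nth // size_zip sB minnn.
  move=> /(_ (coord q', cert_row n (coord q'))) /=.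
  have q'in : coord q' \in cert_coords n by exact: mem_nth.
  move=> /(_ (map_f _ q'in)) /Z.eqb_spec e.
  transitivity (Zin F13 (dot (hex_digits r (nth 0 B q)) (cert_row n (coord q')))).
    rewrite (Zin_dot _ (size_hex_digits _ _) (size_cert_row _ _)).
    rewrite Zin_sum; apply: eq_bigr => p _.
    by rewrite !mxE ZinM nth_cert_row.
  (* The coordinates are listed without repetition, so equality of labels is equality of indices and
     the product is the identity matrix. *)
  rewrite -Zin_mod e /coord nth_uniq ?cert_coords_uniq //.
  by rewrite -val_eqE /=; case: eqP.
have [x xE] := @solve_mod_prime K 13 r s E D isT DE (\row_q c (coord q)).
exists (fun p => if insub p is Some p' then x 0 p' else 0) => q qin.
have qs : (index q (cert_coords n) < s)%N by rewrite index_mem.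
have := congr1 (fun A : 'rV_s => A 0 (Ordinal qs)) xE; rewrite !mxE /coord /= nth_index // => <-.
apply: eq_bigr => p _; rewrite !mxE /coord /= nth_index //.
by case: insubP => [p' _ /val_inj ->|]; rewrite ?ltn_ord.
Qed.

Lemma cert_node_check : all (fun b => all (fun l => (cert_node b l != 0)
  && all (fun i => (i == l) || (cert_node b l != cert_node b i)) (iota 0 12)) (iota 0 12))
  [:: false; true].
Proof. by vm_compute. Qed.

Section CertifiedSurjectivity.
Variables (K : numFieldType) (n : nat) (i0 : 'I_n).
Hypotheses (hn : (n <= 12)%N) (hi0 : val i0 = 0%N).

Definition cert_config (j : 'I_2) (i : 'I_n) : K := Zin K (cert_node (j != 0) i).
Definition cert_minus_node (i : 'I_n) : bool := cert_minus i.

Let in12 (i : 'I_n) : val i \in iota 0 12.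
Proof. by rewrite mem_iota /=; apply: leq_trans (ltn_ord i) hn. Qed.

Lemma cert_admissible j : (forall i, cert_config j i != 0) /\ injective (cert_config j).
Proof.
have H l : (cert_node (j != 0) l != 0)
    && all (fun i => (i == l) || (cert_node (j != 0) l != cert_node (j != 0) i)) (iota 0 12)
    \/ l \notin iota 0 12.
  have [l12|] := boolP (l \in iota 0 12); [left | by right].
  have jb : (j != 0) \in [:: false; true] by case: (j != 0).
  exact: (allP (allP cert_node_check _ jb) _ l12).
split=> [i|i k e].
  by rewrite /cert_config Zin_eq0; case: (H i) => [/andP[]//|]; rewrite in12.
case: (H i) => [/andP[_ /allP/(_ _ (in12 k))]|]; last by rewrite in12.
case/orP => [/eqP ki|]; first by apply/esym/val_inj.
by rewrite -subr_eq0 -(Zin_eq0 K) ZinD ZinN subr_eq0 -/(cert_config j i) e eqxx.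
Qed.

Let quotE x : (x == 0) || (cert_quot x * x == cert_scale) ->
  Zin K (cert_quot x) = Zin K cert_scale * (Zin K x)^-1.
Proof.
case/orP => [/eqP -> /=|/eqP <-].
  by rewrite Zin0 invr0 mulr0.
have [->|x0] := eqVneq x 0; first by rewrite mulr0 !Zin0 mul0r.
by rewrite ZinM mulfK // Zin_eq0.
Qed.

Let quot_check b x : x \in [seq cert_node b l - cert_node b i | l <- iota 0 12, i <- iota 0 12]
                  ++ [seq cert_node b l | l <- iota 0 12] ->
  Zin K (cert_quot x) = Zin K cert_scale * (Zin K x)^-1.
Proof.
move=> xin; apply/quotE/(allP cert_quotP); apply/flattenP.
by eexists; [apply: map_f (_ : b \in _); case: b {xin} | exact: xin].
Qed.

Let quot_diff (j : 'I_2) (l i : 'I_n) : Zin K (cert_quot (cert_node (j != 0) l - cert_node (j != 0) i))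
  = Zin K cert_scale * (cert_config j l - cert_config j i)^-1.
Proof.
rewrite (@quot_check (j != 0)) ?ZinD ?ZinN // mem_cat.
by apply/orP; left; apply/allpairsP; exists (val l, val i); rewrite !in12.
Qed.

Let quot_node (j : 'I_2) (l : 'I_n) : Zin K (cert_quot (cert_node (j != 0) l))
  = Zin K cert_scale * (cert_config j l)^-1.
Proof.
rewrite (@quot_check (j != 0)) // mem_cat.
by apply/orP; right; exact: (map_f _ (in12 l)).
Qed.

Let ZinR (b : bool) : Zin K b%:R = b%:R.
Proof. by case: b. Qed.

Let signE (j : 'I_2) (i : 'I_n) : Zin K (cert_sign (j != 0) i) = sec_sign K cert_minus_node j i.
Proof. by rewrite /cert_sign /sec_sign negbK -/(cert_minus_node i); case: ifP. Qed.

Let N := Zin K cert_scale.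

Let resE j l i : Zin K (cert_res (j != 0) (val l) (val i)) = res_coef K cert_minus_node j l i.
Proof. by rewrite /cert_res ZinM signE ZinR. Qed.

Let linE j (l i : 'I_n) : Zin K (cert_lin (j != 0) l i) = N * lin_coef cert_config cert_minus_node j l i.
Proof.
rewrite /cert_lin /lin_coef ZinM signE ZinD ZinN ZinM ZinR quot_diff quot_node -/N.
rewrite -/(cert_minus_node i); move: (_ - _)^-1 => x; ring.
Qed.

Let quadE j (l i : 'I_n) :
  Zin K (cert_quad (j != 0) l i) = N ^+ 2 * quad_coef cert_config cert_minus_node j l i.
Proof.
rewrite /cert_quad /quad_coef ZinM signE ZinD ZinN ZinM ZinR !ZinM quot_diff quot_node -/N.
rewrite -/(cert_minus_node i) -!exprVn; move: (_ - _)^-1 => x; ring.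
Qed.

Let zeroE j (i : 'I_n) : Zin K (cert_zero (j != 0) i) = N * zero_coef cert_config cert_minus_node j i.
Proof. by rewrite /cert_zero ZinM signE quot_node mulrCA. Qed.

Let infE j (i : 'I_n) : Zin K (cert_inf (j != 0) i) = inf_coef cert_config cert_minus_node j i.
Proof. by rewrite /cert_inf ZinM signE. Qed.

(** Clearing denominators multiplies a coordinate by 1, [N] or [N ^+ 2], the same for all wedges, so
    surjectivity is unaffected. *)
Lemma cert_entryE (l : 'I_n) (t : 'I_5) : exists2 s : K, s != 0 & forall i k : 'I_n,
  let: (f, h) := gauss_pair cert_config cert_minus_node i0 l t in
  Zin K (cert_entry (val l, val t) (val i, val k)) = s * (f i * h k - f k * h i).
Proof.
have N0 : N != 0 by rewrite Zin_eq0.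
have l0 : (val l == 0)%N = (l == i0) by rewrite -hi0.
have e00 : (0 : 'I_2) != 0 = false by []; have e1 : (1 : 'I_2) != 0 = true by [].
have := (resE 0, linE 0, quadE 0, zeroE 0, infE 0); rewrite e00 => -[[[[r0 n0] q0] z0] f0].
have := (resE 1, linE 1, quadE 1, zeroE 1, infE 1); rewrite e1 => -[[[[r1 n1] q1] z1] f1].
have E f h (i k : 'I_n) : Zin K (f (val i) * h (val k) - f (val k) * h (val i))
    = Zin K (f (val i)) * Zin K (h (val k)) - Zin K (f (val k)) * Zin K (h (val i)).
  by rewrite ZinD ZinN !ZinM.
rewrite /gauss_pair /cert_entry; case: t => -[|[|[|[|[|//]]]]] ti /=; rewrite ?l0.
- by exists N => // i k; rewrite E !r0 !n0; ring.
- case: ifP => _; [exists (N ^+ 2)|exists (N ^+ 2)]; rewrite ?expf_neq0 // => i k; rewrite E.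
    by rewrite !z0 !z1; ring.
  by rewrite !r0 !q0; ring.
- by exists N => // i k; rewrite E !r1 !n1; ring.
- case: ifP => _; [exists 1|exists (N ^+ 2)]; rewrite ?oner_neq0 ?expf_neq0 // => i k; rewrite E.
    by rewrite !f0 !f1; ring.
  by rewrite !r1 !q1; ring.
- by exists (N ^+ 2); rewrite ?expf_neq0 // => i k; rewrite E !n0 !n1; ring.
Qed.

Lemma cert_surj B : cert_check n B ->
  gauss_coord_surj cert_config cert_minus_node i0.
Proof.
move=> chk c; pose P := cert_pairs n.
have /choice[s sE] : forall lt : 'I_n * 'I_5, exists s : K, s != 0 /\ forall i k : 'I_n,
    let: (f, h) := gauss_pair cert_config cert_minus_node i0 lt.1 lt.2 in
    Zin K (cert_entry (val lt.1, val lt.2) (val i, val k)) = s * (f i * h k - f k * h i).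
  by move=> [l t]; have [s s0 es] := cert_entryE l t; exists s.
have [x xE] := cert_solve chk (fun q =>
  if (insub q.1, insub q.2) is (Some l, Some t) then s (l, t) * c l t else 0).
have n0 : (0 < n)%N by case: (n) i0 => [[]|].
pose o k : 'I_n := insubd i0 k.
have oE k : (k < n)%N -> val (o k) = k by move=> kn; rewrite /o val_insubd kn.
exists (\sum_(p < size P) x p *: delta_mx (o (nth (0, 0)%N P p).1) (o (nth (0, 0)%N P p).2)).
move=> l t; have [s0 es] := sE (l, t).
apply: (mulfI s0).
have qin : (val l, val t) \in cert_coords n.
  by apply/allpairsP; exists (val l, val t); rewrite !mem_iota /= !add0n !ltn_ord.
have -> : s (l, t) * c l t = \sum_(p < size P)
    x p * Zin K (cert_entry (val l, val t) (nth (0, 0)%N P p)).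
  by rewrite xE //= !valK.
rewrite /gauss_coord; move: es => /=; case: (gauss_pair _ _ _ _ _) => f h /= es.
have W0 : wedge_form f h 0 = 0.
  by rewrite /wedge_form big1 // => i _; rewrite big1 // => k _; rewrite mxE mul0r.
rewrite (big_morph _ (wedge_formD f h) W0) mulr_sumr; apply: eq_bigr => p _.
rewrite wedge_formZ mulrCA; congr (_ * _).
have [] := cert_pairs_lt (mem_nth (0, 0)%N (ltn_ord p)); rewrite -/P.
case: (nth _ P p) => i k /= i_n k_n; rewrite -{2}(oE _ i_n) -{2}(oE _ k_n) es; congr (_ * _).
rewrite /wedge_form (bigD1 (o i)) //= [X in _ + X]big1 ?addr0 => [|r ri].
  rewrite (bigD1 (o k)) //= big1 ?addr0 ?mxE ?eqxx ?mul1r // => r rk.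
  by rewrite mxE (negPf rk) andbF mul0r.
by rewrite big1 // => r' _; rewrite mxE (negPf ri) mul0r.
Qed.

End CertifiedSurjectivity.

End Certificates.

(** * The theorem *)

Section ExistenceOfNodes.
Variable K : numClosedFieldType.

Let minus n (i : 'I_n) : bool := @minus_node n.+1 i.

Lemma cert_minusE n : (n.+1)./2 = 6 -> @cert_minus_node n = @minus n.
Proof. by move=> h; apply/funext => i; rewrite /minus /minus_node h -leqNgt. Qed.

Lemma cert_four_nodes :
  four_nodes (@cert_config K 12) (@minus 12) (widen_ord (isT : (4 <= 12)%N)).
Proof.
split=> [i k /(congr1 val) /= /val_inj //|t|].
  by rewrite /minus /minus_node /=; apply/negbF; have := ltn_ord t; lia.
rewrite /cert_config /= -!ZinN -!ZinD -!ZinM -subr_eq0 -ZinN -ZinD Zin_eq0.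
(* The nodes are 1, 2, 3, 4 and 2, 4, 8, 3; the two products are 12 and -2. *)
by vm_compute.
Qed.

(** Here [n = g - 1]. For odd [n], floor(g/2) is unchanged and the new node goes last, with h = -1.
    For even [n] it grows by one, and the new node is placed just after the nodes with h = 1 and
    joins them. *)
Lemma minus_lift n : exists h : 'I_n.+1, forall i : 'I_n, minus (lift h i) = minus i.
Proof.
have half_succ : n.+2./2 = (~~ odd n + n.+1./2)%N.
  by rewrite -[LHS]/(uphalf n.+1) uphalf_half.
have [on|en] := boolP (odd n).
  by exists ord_max => i; rewrite /minus /minus_node lift_max half_succ on.
have hn : (n.+1./2 < n.+1)%N by rewrite ltn_half_double -addnn; lia.
exists (Ordinal hn) => i; rewrite /minus /minus_node half_succ en add1n ltnS /= /bump.
by congr (~~ _); case: leqP; lia.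
Qed.

Lemma exists_four_nodes n : (12 <= n)%N -> exists a i0 p,
  [/\ forall j, (forall i, a j i != 0) /\ injective (a j),
      four_nodes a (@minus n) p & @gauss_coord_surj K n a (@minus n) i0].
Proof.
elim: n => // n IH; rewrite leq_eqVlt => /orP[/eqP <-|n12].
  exists (@cert_config K 12), ord0, (widen_ord (isT : (4 <= 12)%N)); split.
  - exact: cert_admissible.
  - exact: cert_four_nodes.
  - rewrite -(@cert_minusE 12 erefl).
    exact: (@cert_surj K 12 ord0 isT erefl cert12 cert12P).
have [a [i0 [p [adm hp surj]]]] := IH n12; have [h hm] := minus_lift n.
have [x [y [adm' hp' surj']]] := insert_node_surj n12 hm adm hp surj.
by exists (insert_node h x y a), (lift h i0), (lift h \o p).
Qed.

Lemma exists_gauss_surj n : (11 <= n)%N -> exists2 a : 'M[K]_(2, n), adm_matrix a &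
  exists i0, gauss_coord_surj (fun_of_matrix a) (@minus n) i0.
Proof.
move=> n11; suff [a [i0 [adm surj]]] : exists a i0,
    (forall j, (forall i, a j i != 0) /\ injective (a j)) /\
    @gauss_coord_surj K n a (@minus n) i0.
  have e : fun_of_matrix (\matrix_(j, i) a j i) = a.
    by apply/funext => j; apply/funext => i; rewrite mxE.
  by exists (\matrix_(j, i) a j i); rewrite /adm_matrix e //; exists i0.
case: (ltngtP 11 n) n11 => // [n12 _|<- _].
  by have [a [i0 [p [adm _ surj]]]] := exists_four_nodes n12; exists a, i0.
exists (@cert_config K 11), ord0; split; first exact: cert_admissible.
rewrite -(@cert_minusE 11 erefl).
exact: (@cert_surj K 11 ord0 isT erefl cert11 cert11P).
Qed.

End ExistenceOfNodes.

Local Open Scope complex_scope.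

Theorem theorem4p1 (R : realType) (g : nat) (hg : (12 <= g)%N) :
  exists U : 'rV[R[i]]_(2 * g.-1) -> Prop,
    [/\ zariski_open U,
        exists v, U v
      & forall a : 'M[R[i]]_(2, g.-1), U (mxvec a) ->
          admissible a /\ gaussian_map_surjective a].
Proof.
(* [U] is the union of all principal open sets on which the conclusion holds; it is open by
   construction, and only its nonemptiness needs the preceding work. *)
pose S (P : {mpoly R[i][2 * g.-1]}) := forall a : 'M[R[i]]_(2, g.-1),
  P.@[mxvec a 0] != 0 -> admissible a /\ gaussian_map_surjective a.
exists (fun v => exists2 P, S P & P.@[v 0] != 0); split.
- by exists S.
- case: g hg @S => // n n11 S.
  have [a adm [i0 surj]] := @exists_gauss_surj (R[i] : numClosedFieldType) n n11.
  have [P Pa PS] := gauss_surj_open adm surj.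
  exists (mxvec a), P => // b /PS [admb surjb]; split; first exact: admb.
  have g1 : (1 < n.+1)%N by apply: leq_trans n11.
  have two0 : 2 != 0 :> R[i] by rewrite Num.Theory.pnatr_eq0.
  exact: (gauss_coord_surj_gaussian g1 two0 admb surjb).
by move=> a [P SP Pa]; apply: SP.
Qed.
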